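(* Suppose that the entries of the $B\times B$ transition matrix $\Delta=\Delta^{\vec\varepsilon}$ are analytically parameterized by a real variable vector $\vec\varepsilon\in\mathbb{R}^m$, and let $\Phi:\{1,\dots,B\}\to\{1,\dots,A\}$. Suppose that at $\vec\varepsilon=\vec\varepsilon_0$: (1) for every $a\in\{1,\dots,A\}$ there is at least one $j$ with $\Phi(j)=a$ such that the $j$-th column of $\Delta$ is strictly positive; and (2) every column of $\Delta$ is either all zero or strictly positive. Let $\rho\in(0,1)$ be the contraction constant described in the context. Then the mapping $\vec\varepsilon\mapsto\log p^{\vec\varepsilon}(z_0|z_{-\infty}^{-1})$ is analytic at $\vec\varepsilon_0$ from the real parameter space to $F^{\rho}$. Moreover, the mapping $\vec\varepsilon\mapsto\nu^{\vec\varepsilon}$ is analytic at $\vec\varepsilon_0$ from the real parameter space to $(F^{\rho})^*$, the dual space (i.e., bounded linear functionals) of $F^{\rho}$.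
   Context: Hidden Markov chain: $Y^{\vec\varepsilon}$ is the stationary Markov chain on $\{1,\dots,B\}$ with transition matrix $\Delta^{\vec\varepsilon}$, $\Delta(i,j)=p(y_1=j|y_0=i)$, and $Z^{\vec\varepsilon}=\Phi(Y^{\vec\varepsilon})$; $p^{\vec\varepsilon}(z_{-n}^0)$ and $p^{\vec\varepsilon}(z_0|z_{-n}^{-1})$ are the distribution and conditional distributions of $Z^{\vec\varepsilon}$, where $z_m^n=z_m,\dots,z_n$, and $p^{\vec\varepsilon}(z_0|z_{-\infty}^{-1})=\lim_{n\to\infty}p^{\vec\varepsilon}(z_0|z_{-n}^{-1})$, regarded (with its logarithm) as a function of $z=z_{-\infty}^0\in\mathcal X$. Space and norms: $\mathcal X$ is the set of left infinite sequences $z_{-\infty}^0$ with entries in $\{1,\dots,A\}$, with metric $d(\xi,\eta)=2^{-k}$, $k=\inf\{|i|:\xi_i\ne\eta_i\}$. $\nu^{\vec\varepsilon}$ is the Borel probability measure on $\mathcal X$ with $\nu^{\vec\varepsilon}(\{x_{-\infty}^0: x_0=z_0,\dots,x_{-n}=z_{-n}\})=p^{\vec\varepsilon}(z_{-n}^0)$, acting as a linear functional by $\nu(f)=\int f\,d\nu$. $C(\mathcal X)$ is the space of real continuous functions on $\mathcal X$ with sup norm $|f|_\infty$. For $f\in C(\mathcal X)$, $var_n(f)=\sup\{|f(\xi)-f(\xi')|:\xi_{-i}=\xi'_{-i}\text{ for } 0\le i\le n\}$. For $0<\theta<1$, $F^\theta$ is the set of $f\in C(\mathcal X)$ with $\|f\|_\theta:=\sup_{n\ge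 0}\theta^{-n}var_n(f)<\infty$, a Banach space with norm $\|f\|=\max(|f|_\infty,\|f\|_\theta)$. Contraction constant: let $W=\{w\in\mathbb{R}^B:w_i\ge0,\sum_iw_i=1\}$ and $W_a^{\mathbb C}=\{w\in\mathbb C^B:\sum_iw_i=1,\ w_i=0\text{ if }\Phi(i)\ne a\}$ (row vectors). $\Delta_a^{\vec\varepsilon}(i,j)=\Delta^{\vec\varepsilon}(i,j)$ if $\Phi(j)=a$ and $0$ otherwise; $f_a^{\vec\varepsilon}(w)=w\Delta_a^{\vec\varepsilon}/(w\Delta_a^{\vec\varepsilon}\mathbf 1)$, where the analytic entries of $\Delta^{\vec\varepsilon}$ are extended to complex $\vec\varepsilon$ near $\vec\varepsilon_0$. Let $\Omega_{\mathbb C}(r)$ be the set of points of $\mathbb C^m$ at distance at most $r$ from $\vec\varepsilon_0$, and $N_b(R)$ the set of points of $W_b^{\mathbb C}$ at distance at most $R$ from $f_b^{\vec\varepsilon_0}(W)$. Under (1) and (2), there are $0<\rho<1$, an integer $N\ge1$ and $r,R>0$ such that for all $\vec\varepsilon\in\Omega_{\mathbb C}(r)$, all $a_1,\dots,a_N$ and all $b$, the map $f_{a_N}^{\vec\varepsilon}\circ\cdots\circ f_{a_1}^{\vec\varepsilon}$ is defined and analytic on $N_b(R)$ and is a Euclidean contraction there with coefficient $\rho^N$; $\rho$ is any such constant. (The case $N=1$: each $f_a^{\vec\varepsilon}$ is a Euclidean $\rho$-contraction on each $N_b(R)$.) Analyticity: analytic parametrization means that each entry of $\Delta^{\vec\varepsilon}$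 is real analytic in $\vec\varepsilon$ near $\vec\varepsilon_0$, rows sum to $1$, and $\Delta^{\vec\varepsilon_0}$ is stochastic. A map from the parameter space into a Banach space is analytic at $\vec\varepsilon_0$ if it is given near $\vec\varepsilon_0$ by a convergent power series in the coordinates of $\vec\varepsilon-\vec\varepsilon_0$ with coefficients in the Banach space (agreeing with the map at all $\vec\varepsilon$ near $\vec\varepsilon_0$ for which $\Delta^{\vec\varepsilon}$ is stochastic). *)

(* Defs.v *)
From HB Require Import structures.
From mathcomp Require Import all_boot all_order all_algebra.
From mathcomp Require Import complex.
From mathcomp Require Import all_classical all_reals all_analysis.

Set Implicit Arguments.
Unset Strict Implicit.
Unset Printing Implicit Defensive.

Import Order.TTheory GRing.Theory Num.Theory.
Import numFieldNormedType.Exports.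

Local Open Scope classical_set_scope.
Local Open Scope ring_scope.

Section analytic.
Context {K : numFieldType} {m : nat} {V : normedModType K}.

(* A multi-index is a function a : 'I_m -> nat; partial sums are taken over the
   boxes {a | a i < n for all i}. *)
Definition monomial (h : 'rV[K]_m) (a : 'I_m -> nat) : K :=
  \prod_i h 0 i ^+ a i.

Definition box_sum {U : nmodType} (t : ('I_m -> nat) -> U) (n : nat) : U :=
  \sum_(a : {ffun 'I_m -> 'I_n}) t (fun i => a i : nat).

(* The power series with coefficients c converges absolutely at h, to v. *)
Definition power_series_sum (c : ('I_m -> nat) -> V) (h : 'rV[K]_m) (v : V) :=
  (exists M : K, forall n, box_sum (fun a => `|monomial h a *: c a|) n <= M) /\
  (box_sum (fun a => monomial h a *: c a) n @[n --> \oo] --> v).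

Definition analytic_at (f : 'rV[K]_m -> V) (x0 : 'rV[K]_m) :=
  exists c, \forall x \near x0, power_series_sum c (x - x0) (f x).

End analytic.


(* xi n is the entry at time -n; the alphabet is 'I_A.+1, of size A + 1.  The
   argument R, in which distances are measured, keys the metric structure. *)
Definition left_seq (R : realType) (A : nat) : Type := nat -> 'I_A.+1.

HB.instance Definition _ R A := Choice.on (left_seq R A).
HB.instance Definition _ R A :=
  isPointed.Build (left_seq R A) (fun=> ord0).

Section left_seq_metric.
Context {R : realType} {A : nat}.
Implicit Types xi eta zeta : left_seq R A.

Definition left_seq_dist xi eta : R :=
  if pselect (exists i, xi i != eta i) is left h then 2 ^- ex_minn h else 0.

Lemma left_seq_dist_ltP xi eta n :
  left_seq_dist xi eta < 2 ^- n <-> forall i, (i <= n)%N -> xi i = eta i.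
Proof.
rewrite /left_seq_dist; case: pselect => [h|h]; last first.
  split=> [_ i _|_]; last by rewrite invr_gt0 exprn_gt0.
  by apply/eqP/negPn/negP => hi; apply: h; exists i.
case: ex_minnP => k hk kmin.
rewrite ltf_pV2 ?posrE ?exprn_gt0// ltr_eXn2l ?ltr1n//; split=> [nk i le_in|H].
  apply/eqP/negPn/negP => /kmin; rewrite leqNgt => /negP; apply.
  exact: leq_ltn_trans nk.
by rewrite ltnNge; apply/negP => /H /eqP; rewrite (negPf hk).
Qed.

Lemma left_seq_dist_cases xi eta :
  (xi = eta /\ left_seq_dist xi eta = 0) \/
  exists k, left_seq_dist xi eta = 2 ^- k.
Proof.
rewrite /left_seq_dist; case: pselect => [h|h]; first by right; eexists.
left; split=> //; apply/funext => i; apply/eqP/negPn/negP => hi.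
by apply: h; exists i.
Qed.

Lemma left_seq_distxx xi : left_seq_dist xi xi = 0.
Proof.
by rewrite /left_seq_dist; case: pselect => // h; have [j /eqP] := h.
Qed.

Lemma left_seq_dist_ge0 xi eta : 0 <= left_seq_dist xi eta.
Proof.
case: (left_seq_dist_cases xi eta) => [[_ ->]//|[k ->]].
by rewrite invr_ge0 exprn_ge0.
Qed.

Lemma left_seq_dist_positivity xi eta : left_seq_dist xi eta = 0 -> xi = eta.
Proof.
case: (left_seq_dist_cases xi eta) => [[]//|[k ->]] /eqP.
by rewrite invr_eq0 expf_eq0 pnatr_eq0 andbF.
Qed.

Lemma left_seq_dist_sym xi eta : left_seq_dist xi eta = left_seq_dist eta xi.
Proof.
suff le u v : left_seq_dist u v <= left_seq_dist v u.
  by apply/le_anti; rewrite !le.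
case: (left_seq_dist_cases u v) => [[-> _]//|[k uv]].
rewrite uv leNgt; apply/negP => /left_seq_dist_ltP H.
suff : left_seq_dist u v < 2 ^- k by rewrite uv ltxx.
by apply/left_seq_dist_ltP => i /H.
Qed.

Lemma left_seq_dist_triangle eta xi zeta :
  left_seq_dist xi zeta <= left_seq_dist xi eta + left_seq_dist eta zeta.
Proof.
case: (left_seq_dist_cases xi zeta) => [[_ ->]|[k xz]].
  by rewrite addr_ge0 ?left_seq_dist_ge0.
rewrite leNgt; apply/negP => H.
suff : left_seq_dist xi zeta < 2 ^- k by rewrite xz ltxx.
apply/left_seq_dist_ltP => i ik; rewrite xz in H; transitivity (eta i).
- apply: (proj1 (left_seq_dist_ltP _ _ k)) ik; apply: le_lt_trans H.
  by rewrite lerDl left_seq_dist_ge0.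
- apply: (proj1 (left_seq_dist_ltP _ _ k)) ik; apply: le_lt_trans H.
  by rewrite lerDr left_seq_dist_ge0.
Qed.

End left_seq_metric.

HB.instance Definition _ (R : realType) (A : nat) :=
  @isMetric.Build R (left_seq R A) left_seq_dist left_seq_distxx
    left_seq_dist_positivity left_seq_dist_sym left_seq_dist_triangle.

(* X with its Borel sigma-algebra *)
Notation borel X := (g_sigma_algebraType (@open X)).

Section holder_space.
Context {R : realType} {A : nat}.
Local Notation X := (left_seq R A).
Local Open Scope ereal_scope.
Implicit Types (f g : X -> R) (theta : R).

Definition sup_norm f : \bar R := ereal_sup [set `|f xi|%:E | xi in setT].

Definition var n f : \bar R :=
  ereal_sup [set `|f xi.1 - f xi.2|%:E |
    xi in [set xi : X * X | forall i, (i <= n)%N -> xi.1 i = xi.2 i]].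

Definition var_norm theta f : \bar R :=
  ereal_sup [set (theta ^- n)%:E * var n f | n in setT].

Definition holder_set theta : set (X -> R) :=
  [set f | continuous f /\ var_norm theta f < +oo].

Definition holder_norm theta f : \bar R := maxe (sup_norm f) (var_norm theta f).

Lemma le_sup_norm f xi : `|f xi|%:E <= sup_norm f.
Proof. by apply: ereal_sup_ubound; exists xi. Qed.

Lemma sup_norm_ge0 f : 0 <= sup_norm f.
Proof. by apply: (le_trans _ (le_sup_norm f point)); rewrite lee_fin. Qed.

Lemma le_var n f xi eta : (forall i, (i <= n)%N -> xi i = eta i) ->
  `|f xi - f eta|%:E <= var n f.
Proof. by move=> H; apply: ereal_sup_ubound; exists (xi, eta). Qed.

Lemma var_ge0 n f : 0 <= var n f.
Proof. have := @le_var n f (point : X) (point : X) (fun=> fun=> erefl).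
by apply: le_trans; rewrite lee_fin. Qed.

Lemma var_leP n f (y : \bar R) :
  var n f <= y <-> forall xi eta, (forall i, (i <= n)%N -> xi i = eta i) ->
    `|f xi - f eta|%:E <= y.
Proof.
split=> [H xi eta agree|H]; first exact: le_trans (le_var f agree) H.
by apply: ge_ereal_sup => _ [[xi eta] /= agree <-]; exact: H.
Qed.

Lemma le_var_norm theta n f : (theta ^- n)%:E * var n f <= var_norm theta f.
Proof. by apply: ereal_sup_ubound; exists n. Qed.

Lemma var_norm_ge0 theta f : (0 <= theta)%R -> 0 <= var_norm theta f.
Proof.
move=> t0; apply: le_trans (le_var_norm theta 0 f).
by rewrite mule_ge0 ?var_ge0// lee_fin invr_ge0 exprn_ge0.
Qed.

Lemma holder_norm_ge0 theta f : 0 <= holder_norm theta f.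
Proof. by rewrite le_max sup_norm_ge0. Qed.

Lemma sup_normD f g : sup_norm (f \+ g)%R <= sup_norm f + sup_norm g.
Proof.
apply: ge_ereal_sup => _ [xi _ <-].
apply: (@le_trans _ _ (`|f xi|%:E + `|g xi|%:E)).
  by rewrite -EFinD lee_fin ler_normD.
by apply: leeD; exact: le_sup_norm.
Qed.

Lemma varD n f g : var n (f \+ g)%R <= var n f + var n g.
Proof.
apply/var_leP => xi eta agree.
apply: (@le_trans _ _ (`|f xi - f eta|%:E + `|g xi - g eta|%:E)).
  rewrite -EFinD lee_fin.
  rewrite (_ : _ - _ = (f xi - f eta) + (g xi - g eta))%R ?ler_normD//=.
  by rewrite addrACA opprD.
by apply: leeD; exact: le_var.
Qed.

Lemma var_normD theta f g : (0 <= theta)%R ->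
  var_norm theta (f \+ g)%R <= var_norm theta f + var_norm theta g.
Proof.
move=> t0; apply: ge_ereal_sup => _ [n _ <-].
have tn0 : 0 <= (theta ^- n)%:E by rewrite lee_fin invr_ge0 exprn_ge0.
apply: (le_trans (lee_wpmul2l tn0 (varD n f g))).
rewrite ge0_muleDr ?var_ge0//; apply: leeD; exact: le_var_norm.
Qed.

Lemma holder_normD theta f g : (0 <= theta)%R ->
  holder_norm theta (f \+ g)%R <= holder_norm theta f + holder_norm theta g.
Proof.
move=> t0; rewrite ge_max; apply/andP; split.
  apply: le_trans (sup_normD f g) _; apply: leeD; rewrite le_max lexx//.
apply: le_trans (var_normD f g t0) _; apply: leeD; rewrite le_max lexx ?orbT//.
Qed.

Lemma holder_normZ_le theta (a : R) f : (0 <= theta)%R ->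
  holder_norm theta (a \*: f)%R <= `|a|%:E * holder_norm theta f.
Proof.
move=> t0; have a0 : 0 <= `|a|%:E by rewrite lee_fin.
have varZ n : var n (a \*: f)%R <= `|a|%:E * var n f.
  apply/var_leP => xi eta agree /=.
  by rewrite -mulrBr normrM EFinM lee_wpmul2l// le_var.
rewrite ge_max; apply/andP; split.
  apply: (@le_trans _ _ (`|a|%:E * sup_norm f)); last first.
    by rewrite lee_wpmul2l// le_max lexx.
  apply: ge_ereal_sup => _ [xi _ <-] /=.
  by rewrite normrM EFinM lee_wpmul2l// le_sup_norm.
apply: (@le_trans _ _ (`|a|%:E * var_norm theta f)); last first.
  by rewrite lee_wpmul2l// le_max lexx orbT.
apply: ge_ereal_sup => _ [n _ <-].
have tn0 : 0 <= (theta ^- n)%:E by rewrite lee_fin invr_ge0 exprn_ge0.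
apply: (le_trans (lee_wpmul2l tn0 (varZ n))).
by rewrite muleCA lee_wpmul2l// le_var_norm.
Qed.

Lemma sup_norm_lty f : var 0 f < +oo -> sup_norm f < +oo.
Proof.
move=> v0; pose M : R := (\sum_(a : 'I_A.+1) `|f (fun=> a)|)%R.
apply: (@le_lt_trans _ _ (M%:E + var 0 f)); last first.
  by rewrite lte_add_pinfty ?ltry.
apply: ge_ereal_sup => _ [xi _ <-].
pose c : X := fun=> xi 0%N.
apply: (@le_trans _ _ (`|f c|%:E + `|f xi - f c|%:E)).
  rewrite -EFinD lee_fin addrC.
  by rewrite -{1}(subrK (f c) (f xi)) ler_normD.
apply: leeD; last first.
  by apply: le_var => i; rewrite leqn0 => /eqP ->.
by rewrite lee_fin /M (bigD1 (xi 0%N))//= lerDl sumr_ge0.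
Qed.

Lemma holder_norm_lty theta f : holder_set theta f -> holder_norm theta f < +oo.
Proof.
move=> [_ vf]; rewrite gt_max vf andbT; apply: sup_norm_lty.
apply: le_lt_trans vf; have := le_var_norm theta 0 f.
by rewrite expr0 invr1 mul1e.
Qed.

End holder_space.

Definition holder_pred (R : realType) (A : nat) (theta : {posnum R}) :
  {pred left_seq R A -> R} := mem (holder_set theta%:num).

(* F^theta; the parameter theta is taken positive for the norm axioms to hold *)
Record holder (R : realType) (A : nat) (theta : {posnum R}) := Holder {
  holder_fun :> left_seq R A -> R;
  _ : holder_fun \in @holder_pred R A theta }.

HB.instance Definition _ (R : realType) (A : nat) (theta : {posnum R}) :=
  [isSub for @holder_fun R A theta].
HB.instance Definition _ (R : realType) (A : nat) (theta : {posnum R}) :=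
  [Choice of holder A theta by <:].

Section holder_normed_module.
Context {R : realType} {A : nat} {theta : {posnum R}}.
Implicit Types f g : holder A theta.

Let theta0 : 0 <= theta%:num :> R. Proof. by []. Qed.

Lemma holder_submod_closed : submod_closed (@holder_pred R A theta).
Proof.
split=> [|a f g]; rewrite /holder_pred ?inE.
  split=> [x|]; first exact: cst_continuous.
  rewrite (le_lt_trans _ (ltry 0))//; apply: ge_ereal_sup => _ [n _ <-].
  rewrite (_ : var n _ = 0%E) ?mule0//; apply/le_anti; rewrite var_ge0 andbT.
  by apply/var_leP => xi eta _ /=; rewrite subrr normr0.
move=> fF gF; have [fc _] := fF; have [gc vg] := gF; split.
  by move=> x; apply: cvgD (gc x); apply: cvgZ (fc x); exact: cvg_cst.
apply: (le_lt_trans (var_normD _ _ theta0)); apply: lte_add_pinfty => //.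
apply: (@le_lt_trans _ _ (holder_norm theta%:num (a \*: f))).
  by rewrite le_max lexx orbT.
apply: (le_lt_trans (holder_normZ_le _ _ theta0)).
by rewrite lte_mul_pinfty// holder_norm_lty.
Qed.

HB.instance Definition _ := GRing.isSubmodClosed.Build R (left_seq R A -> R)
  (@holder_pred R A theta) holder_submod_closed.
HB.instance Definition _ :=
  [SubChoice_isSubLmodule of holder A theta by <:].

Definition holder_normr f : R := fine (holder_norm theta%:num f).

Let normE f : (holder_normr f)%:E = holder_norm theta%:num f.
Proof.
rewrite fineK// ge0_fin_numE ?holder_norm_ge0//; apply: holder_norm_lty.
by have := valP f; rewrite inE.
Qed.

Lemma holder_normr_ler_normD f g :
  holder_normr (f + g) <= holder_normr f + holder_normr g.
Proof. by rewrite -lee_fin EFinD !normE; exact: holder_normD. Qed.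

Lemma holder_normr_normrZ (a : R) f :
  holder_normr (a *: f) = `|a| * holder_normr f.
Proof.
have leZ (b : R) g : holder_normr (b *: g) <= `|b| * holder_normr g.
  by rewrite -lee_fin EFinM !normE; exact: holder_normZ_le.
have [->|a0] := eqVneq a 0.
  rewrite normr0 mul0r; apply/le_anti/andP; split; last first.
    by rewrite -lee_fin normE; exact: holder_norm_ge0.
  by apply: le_trans (leZ _ _) _; rewrite normr0 mul0r.
apply/le_anti; rewrite leZ /= mulrC -ler_pdivlMr ?normr_gt0// mulrC -normfV.
by rewrite -{1}(scalerK a0 f) leZ.
Qed.

Lemma holder_normr_eq0 f : holder_normr f = 0 -> f = 0.
Proof.
move=> f0; apply/val_inj/funext => xi; apply/eqP; rewrite -normr_le0 -lee_fin.
by rewrite -[X in (_ <= X%:E)%E]f0 normE le_max le_sup_norm.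
Qed.

HB.instance Definition _ := Lmodule_isNormed.Build R (holder A theta)
  holder_normr_ler_normD holder_normr_normrZ holder_normr_eq0.

End holder_normed_module.

Section dual.
Context {R : realType} {V : normedModType R}.
Implicit Types phi psi : V -> R.

Definition bounded_functional : set (V -> R) :=
  [set phi | scalar phi /\ exists M : R, forall v, `|phi v| <= M * `|v|].

Definition dual_norm phi : R := sup [set `|phi v| | v in [set v | `|v| <= 1]].

Lemma le_dual_norm phi v : bounded_functional phi ->
  `|phi v| <= dual_norm phi * `|v|.
Proof.
move=> [lin [M bM]]; have [->|v0] := eqVneq v 0.
  by rewrite normr0 mulr0; apply: le_trans (bM 0) _; rewrite normr0 mulr0.
have phiZ (a : R) w : phi (a *: w) = a * phi w.
  have := lin a w 0; have := lin 1 0 0; rewrite addr0 scaler0 addr0 mul1r.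
  move/eqP; rewrite -subr_eq0 opprD addNKr oppr_eq0 => /eqP ->.
  by rewrite addr0.
rewrite -ler_pdivrMr ?normr_gt0//.
have -> : `|phi v| / `|v| = `|phi (`|v|^-1 *: v)|.
  by rewrite phiZ normrM normfV normr_id mulrC.
apply: ub_le_sup.
  exists `|M| => _ [w /= w1 <-]; apply: le_trans (bM w) _.
  apply: (@le_trans _ _ (`|M| * `|w|)); first by rewrite ler_wpM2r// ler_norm.
  by rewrite -[leRHS]mulr1 ler_wpM2l.
exists (`|v|^-1 *: v) => //=.
by rewrite normrZ normfV normr_id mulVf// normr_eq0.
Qed.

Lemma dual_norm_le phi (M : R) : (forall v, `|v| <= 1 -> `|phi v| <= M) ->
  dual_norm phi <= M.
Proof.
move=> H; apply: ge_sup; last by move=> _ [v v1 <-]; exact: H.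
by exists `|phi 0|; exists 0 => //=; rewrite normr0.
Qed.

Lemma le_dual_norm1 phi v : bounded_functional phi -> `|v| <= 1 ->
  `|phi v| <= dual_norm phi.
Proof.
move=> Bphi v1; apply: le_trans (le_dual_norm v Bphi) _.
rewrite -[leRHS]mulr1 ler_wpM2l//; apply: le_trans (normr_ge0 (phi 0)) _.
apply: ub_le_sup; last by exists 0 => //=; rewrite normr0.
have [_ [M bM]] := Bphi.
exists `|M| => _ [w /= w1 <-]; apply: le_trans (bM w) _.
apply: (@le_trans _ _ (`|M| * `|w|)); first by rewrite ler_wpM2r// ler_norm.
by rewrite -[leRHS]mulr1 ler_wpM2l.
Qed.

End dual.

Definition dual_pred (R : realType) (V : normedModType R) : {pred V -> R} :=
  mem (@bounded_functional R V).

Record dual_space (R : realType) (V : normedModType R) := Dual {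
  dual_fun :> V -> R;
  _ : dual_fun \in @dual_pred R V }.

HB.instance Definition _ (R : realType) (V : normedModType R) :=
  [isSub for @dual_fun R V].
HB.instance Definition _ (R : realType) (V : normedModType R) :=
  [Choice of dual_space V by <:].

Section dual_normed_module.
Context {R : realType} {V : normedModType R}.
Implicit Types phi psi : dual_space V.

Lemma dual_submod_closed : submod_closed (@dual_pred R V).
Proof.
split=> [|a f g]; rewrite /dual_pred ?inE.
  split=> [b u v|]; first by rewrite /= mulr0 addr0.
  by exists 0 => v; rewrite normr0 mul0r.
move=> [fl [M fM]] [gl [N gN]]; split.
  by move=> b u v; rewrite !fctE fl gl /GRing.scale/= !mulrDr mulrCA addrACA.
exists (`|a| * M + N) => v; rewrite mulrDl; apply: le_trans (ler_normD _ _) _.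
by apply: lerD => //; rewrite normrM -mulrA ler_wpM2l.
Qed.

HB.instance Definition _ := GRing.isSubmodClosed.Build R (V -> R)
  (@dual_pred R V) dual_submod_closed.
HB.instance Definition _ := [SubChoice_isSubLmodule of dual_space V by <:].

Let dualP phi : bounded_functional phi.
Proof. by have := valP phi; rewrite inE. Qed.

Definition dual_normr phi : R := dual_norm phi.

Lemma dual_normr_ler_normD phi psi :
  dual_normr (phi + psi) <= dual_normr phi + dual_normr psi.
Proof.
apply: dual_norm_le => v v1; apply: le_trans (ler_normD _ _) _.
by apply: lerD; apply: le_dual_norm1 => //; exact: dualP.
Qed.

Lemma dual_normr_normrZ (a : R) phi :
  dual_normr (a *: phi) = `|a| * dual_normr phi.
Proof.
have leZ (b : R) psi : dual_normr (b *: psi) <= `|b| * dual_normr psi.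
  apply: dual_norm_le => v v1; rewrite normrM ler_wpM2l//.
  by apply: le_dual_norm1 => //; exact: dualP.
have [->|a0] := eqVneq a 0.
  rewrite normr0 mul0r; apply/le_anti/andP; split; last first.
    apply: le_trans (normr_ge0 ((0 *: phi : dual_space V) 0)) _.
    by apply: le_dual_norm1; [exact: dualP|rewrite normr0].
  by apply: le_trans (leZ _ _) _; rewrite normr0 mul0r.
apply/le_anti; rewrite leZ /= mulrC -ler_pdivlMr ?normr_gt0// mulrC -normfV.
by rewrite -{1}(scalerK a0 phi) leZ.
Qed.

Lemma dual_normr_eq0 phi : dual_normr phi = 0 -> phi = 0.
Proof.
move=> phi0; apply/val_inj/funext => v; apply/eqP; rewrite -normr_le0.
by have := le_dual_norm v (dualP phi); rewrite [dual_norm _]phi0 mul0r.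
Qed.

HB.instance Definition _ := Lmodule_isNormed.Build R (dual_space V)
  dual_normr_ler_normD dual_normr_normrZ dual_normr_eq0.

End dual_normed_module.

Section hidden_markov_chain.
Context {R : realType} {A B : nat}.
Implicit Types (D : 'M[R]_B) (p : 'rV[R]_B) (Phi : 'I_B -> 'I_A.+1).
Implicit Types z : left_seq R A.

Definition stochastic D :=
  (forall i j, 0 <= D i j) /\ (forall i, \sum_j D i j = 1).

Definition stationary_distribution D p :=
  [/\ forall i, 0 <= p 0 i, \sum_i p 0 i = 1 & p *m D = p].

(* The probability that Y_{-n} = y n, ..., Y_0 = y 0. *)
Definition path_prob D p (n : nat) (y : {ffun 'I_n.+1 -> 'I_B}) : R :=
  p 0 (y ord_max) *
  \prod_(i < n) D (y (lift ord0 i)) (y (widen_ord (leqnSn n) i)).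

(* p(z_{-n}^0) *)
Definition word_prob D p Phi (n : nat) z : R :=
  \sum_(y : {ffun 'I_n.+1 -> 'I_B} | [forall i, Phi (y i) == z i])
    path_prob D p y.

Definition shift_seq z : left_seq R A := fun i => z i.+1.

(* p(z_0 | z_{-(n+1)}^{-1}), where p(z_{-(n+1)}^{-1}) is, by stationarity, the
   probability of the same word ending at time 0 *)
Definition cond_prob D p Phi (n : nat) z : R :=
  word_prob D p Phi n.+1 z / word_prob D p Phi n (shift_seq z).

Definition cond_prob_limit D p Phi z : R :=
  lim (cond_prob D p Phi n z @[n --> \oo]).

Definition cylinder (n : nat) z : set (left_seq R A) :=
  [set x | forall i, (i <= n)%N -> x i = z i].

End hidden_markov_chain.

Section contraction.
Context {R : realType} {A B m : nat}.
Local Notation C := R[i].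
Implicit Types Phi : 'I_B -> 'I_A.+1.

Section action.
Context {K : fieldType}.
Implicit Types (D : 'M[K]_B) (w : 'rV[K]_B).

Definition col_restrict Phi D (a : 'I_A.+1) : 'M[K]_B :=
  \matrix_(i, j) (if Phi j == a then D i j else 0).

Definition letter_mass Phi D a w : K :=
  \sum_j (w *m col_restrict Phi D a) 0 j.

Definition letter_map Phi D a w : 'rV[K]_B :=
  (letter_mass Phi D a w)^-1 *: (w *m col_restrict Phi D a).

(* For s = [:: a_1; ...; a_N], the map f_{a_N} o ... o f_{a_1} *)
Definition word_map Phi D (s : seq 'I_A.+1) w : 'rV[K]_B :=
  foldl (fun u a => letter_map Phi D a u) w s.

Fixpoint word_map_defined Phi D (s : seq 'I_A.+1) w : Prop :=
  if s is a :: s' then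
    letter_mass Phi D a w != 0 /\
    word_map_defined Phi D s' (letter_map Phi D a w)
  else True.

End action.

Definition toC {k l : nat} (M : 'M[R]_(k, l)) : 'M[C]_(k, l) :=
  map_mx (real_complex R) M.

Definition euclidean_norm {n : nat} (w : 'rV[C]_n) : R :=
  Num.sqrt (\sum_i ComplexField.Normc.normc (w 0 i) ^+ 2).

Definition simplex : set 'rV[R]_B :=
  [set w | (forall i, 0 <= w 0 i) /\ \sum_i w 0 i = 1].

Definition complex_face Phi (b : 'I_A.+1) : set 'rV[C]_B :=
  [set w | \sum_i w 0 i = 1 /\ forall i, Phi i != b -> w 0 i = 0].

(* The distance to f_b(simplex) is attained, this set being compact when f_b is
   defined on the simplex. *)
Definition face_nbhd Phi (D : 'M[R]_B) (b : 'I_A.+1) (rad : R) :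
    set 'rV[C]_B :=
  [set w | complex_face Phi b w /\
    exists2 v, simplex v &
      euclidean_norm (w - toC (letter_map Phi D b v)) <= rad].

(* DeltaC is the extension of Delta to complex parameters, as a germ at eps0. *)
Definition complex_extension (Delta : 'rV[R]_m -> 'M[R]_B)
    (DeltaC : 'rV[C]_m -> 'M[C]_B) (eps0 : 'rV[R]_m) :=
  (forall i j, analytic_at (fun e => DeltaC e i j : C^o) (toC eps0)) /\
  (\forall e \near eps0, DeltaC (toC e) = toC (Delta e)).

(* Analyticity of the word map on the face is that of the ambient rational map.
   As the condition is inherited by smaller r, it depends only on the germ of
   DeltaC, hence only on Delta. *)
Definition contraction_constant Phi (Delta : 'rV[R]_m -> 'M[R]_B)
    (eps0 : 'rV[R]_m) (rho : R) :=
  0 < rho < 1 /\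
  exists DeltaC : 'rV[C]_m -> 'M[C]_B,
    complex_extension Delta DeltaC eps0 /\
  exists (N : nat) (r rad : R), [/\ (0 < N)%N, 0 < r, 0 < rad &
    forall eps : 'rV[C]_m, euclidean_norm (eps - toC eps0) <= r ->
    forall (s : seq 'I_A.+1) (b : 'I_A.+1), size s = N ->
    let U := face_nbhd Phi (Delta eps0) b rad in
    let F := word_map Phi (DeltaC eps) s in
    (forall w, U w ->
      word_map_defined Phi (DeltaC eps) s w /\ analytic_at F w) /\
    (forall w w', U w -> U w' ->
      euclidean_norm (F w - F w') <= rho ^+ N * euclidean_norm (w - w'))].

End contraction.

(* Main.v *)
(* Everything is read off from power series in the complexified parameter, on a
   fixed small polydisc.

   Multiplying on the left by the letter matrices, the normalized rows of a word
   product are averaged by a matrix whose rows sum to 1 and which is a small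
   perturbation (in the l1-norm of power series) of a positive kernel; by
   Dobrushin's argument their oscillation decays geometrically.  Hence the
   conditional probabilities given n past letters converge geometrically, as
   power series on a polydisc that does not depend on the sequence.  The rate so
   obtained is not rho; but as the orbits of the complexified dynamics stay in the
   neighbourhoods N_b(R), the contraction hypothesis bounds the dependence of the
   limit on the remote past by a multiple of rho^n, uniformly over the polydisc.
   Cauchy's estimates then bound the coefficients in F^rho, and a logarithm with
   the same Lipschitz property is obtained by composing with its series.

   For the measure, nu(f) = lim sum_w f(w) p(w) over words w of length n.  The
   increments of this sequence are at most |f| rho^n sum_w |p(w)|, and for complex
   parameters near eps_0 the last sum is at most C (1 + delta)^n with
   rho (1 + delta) < 1. *)

Require Import Defs.
From HB Require Import structures.
From mathcomp Require Import all_boot all_order all_algebra.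
From mathcomp Require Import complex.
From mathcomp Require Import all_classical all_reals all_analysis.
From mathcomp Require Import separable cyclotomic cyclic ring lra.

Set Implicit Arguments.
Unset Strict Implicit.
Unset Printing Implicit Defensive.

Import Order.TTheory GRing.Theory Num.Theory.
Import numFieldNormedType.Exports.

Local Open Scope classical_set_scope.
Local Open Scope ring_scope.

(** * Complex modulus and limits *)

(** A word can be lengthened at either end. A letter added in the remote past multiplies the word
    product on the left and averages the normalized rows; a recent letter multiplies it on the right
    and moves each row by [letter_map]. The first yields the limit as a power series, the second its
    rate [rho]. They are kept apart because the hypothesis on [rho] is pointwise at each complex
    parameter and says nothing of power series; but sup bounds on a polydisc are all that Cauchy's
    estimate requires. The obstacle on the side of power series is uniformity in the length of the
    word. Complex row sums may drift geometrically from the real ones, so they are divided by the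
    row sums at eps_0, and only ratios of these quotients between two states are followed; a fixed
    neighbourhood of 1 is invariant for them. All rows have the same limit, so the stationary
    vector, which enters the conditional probabilities only through the weights of an average, drops
    out of it. The measure does require that vector as a power series; it comes from the powers of
    the transition matrix. *)

Notation cn := ComplexField.Normc.normc.
#[local] Arguments ComplexField.Normc.normc : simpl never.

Section complex_modulus.
Context {R : realType}.
Local Notation C := R[i].
Implicit Types (x y : C) (u v : nat -> C).

Lemma cn0 : cn (0 : C) = 0. Proof. exact: ComplexField.Normc.normc0. Qed.
Lemma cn1 : cn (1 : C) = 1. Proof. exact: ComplexField.Normc.normc1. Qed.
Lemma cnM x y : cn (x * y) = cn x * cn y.
Proof. exact: ComplexField.Normc.normcM. Qed.
Lemma cnV x : cn x^-1 = (cn x)^-1.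
Proof. exact: ComplexField.Normc.normcV. Qed.
Lemma cnN x : cn (- x) = cn x. Proof. exact: normcN. Qed.
Lemma cnD x y : cn (x + y) <= cn x + cn y. Proof. exact: le_normcD. Qed.
Lemma cn_ge0 x : 0 <= cn x. Proof. by case: x => a b; exact: sqrtr_ge0. Qed.
Lemma cnB x y : cn (x - y) = cn (y - x). Proof. by rewrite -opprB cnN. Qed.

Lemma cn_eq0 x : (cn x == 0) = (x == 0).
Proof.
by apply/eqP/eqP => [|->]; [exact: ComplexField.Normc.eq0_normc|exact: cn0].
Qed.

Lemma cn_triangle x y z : cn (x - z) <= cn (x - y) + cn (y - z).
Proof. by apply: le_trans (cnD _ _); rewrite addrA subrK. Qed.

Lemma cn_sum (I : Type) (r : seq I) (P : pred I) (F : I -> C) :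
  cn (\sum_(i <- r | P i) F i) <= \sum_(i <- r | P i) cn (F i).
Proof.
elim/big_rec2: _ => [|i a b _ h]; first by rewrite cn0.
by apply: le_trans (cnD _ _) _; rewrite lerD2l.
Qed.

Lemma cn_prod (I : Type) (r : seq I) (P : pred I) (F : I -> C) :
  cn (\prod_(i <- r | P i) F i) = \prod_(i <- r | P i) cn (F i).
Proof.
by elim/big_rec2: _ => [|i a b _ h]; rewrite ?cn1// cnM h.
Qed.

Lemma cnX x n : cn (x ^+ n) = cn x ^+ n.
Proof. by elim: n => [|n ih]; rewrite ?expr0 ?cn1// !exprS cnM ih. Qed.

Lemma cn_real (a : R) : cn (a%:C%C) = `|a|.
Proof. by rewrite /ComplexField.Normc.normc/= expr0n /= addr0 sqrtr_sqr. Qed.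

Lemma cn_Re x : `|complex.Re x| <= cn x.
Proof.
case: x => a b; rewrite /ComplexField.Normc.normc/= -sqrtr_sqr ler_wsqrtr//.
by rewrite lerDl sqr_ge0.
Qed.

Lemma cn_Im x : `|complex.Im x| <= cn x.
Proof.
case: x => a b; rewrite /ComplexField.Normc.normc/= -sqrtr_sqr ler_wsqrtr//.
by rewrite lerDr sqr_ge0.
Qed.

Lemma cn_le_ReIm x : cn x <= `|complex.Re x| + `|complex.Im x|.
Proof.
case: x => a b; rewrite /ComplexField.Normc.normc/= -[leRHS]ger0_norm ?addr_ge0//.
rewrite -sqrtr_sqr ler_wsqrtr// sqrrD !real_normK ?num_real//.
by rewrite lerD2r lerDl mulrn_wge0 ?mulr_ge0.
Qed.

Lemma normr_cn x : `|x| = (cn x)%:C%C :> C.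
Proof. by case: x. Qed.

(** Complex convergence is stated through the real sequence of moduli, so that only limits of real
    sequences are ever taken. *)
Definition clim u x := cn (u n - x) @[n --> \oo] --> (0 : R).

Lemma climP u x : clim u x <->
  forall e : R, 0 < e -> exists N, forall n, (N <= n)%N -> cn (u n - x) <= e.
Proof.
split=> [/cvgrPdist_le H e e0|H].
  have [N _ HN] := H e e0; exists N => n /HN /=.
  by rewrite sub0r normrN ger0_norm ?cn_ge0.
apply/cvgrPdist_le => e e0; have [N HN] := H e e0; exists N => // n /= /HN.
by rewrite sub0r normrN ger0_norm ?cn_ge0.
Qed.

Lemma clim_squeeze u x (t : nat -> R) :
  (forall n, cn (u n - x) <= t n) -> t n @[n --> \oo] --> (0 : R) -> clim u x.
Proof.
move=> ut t0; apply: (@squeeze_cvgr _ _ _ _ (fun=> 0) t) => //; last exact: cvg_cst.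
by apply: nearW => n; rewrite cn_ge0 ut.
Qed.

Lemma clim_near_le u x y (M : R) N : clim u x ->
  (forall n, (N <= n)%N -> cn (u n - y) <= M) -> cn (x - y) <= M.
Proof.
move=> /climP ux uM; apply/ler_addgt0Pl => e e0; have [n0 h] := ux e e0.
have := h _ (leq_maxl n0 N); have := uM _ (leq_maxr n0 N).
move: (maxn n0 N) => n un1 un2; apply: le_trans (cn_triangle x (u n) y) _.
by rewrite lerD// cnB.
Qed.

Lemma clim_unique u x y : clim u x -> clim u y -> x = y.
Proof.
move=> ux /climP uy; apply/eqP; rewrite -subr_eq0 -cn_eq0; apply/eqP/le_anti.
rewrite cn_ge0 andbT; apply/ler_addgt0Pl => e e0; rewrite addr0.
by have [N h] := uy e e0; exact: clim_near_le ux h.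
Qed.

Lemma clim_cst x : clim (fun=> x) x.
Proof. by apply/climP => e e0; exists 0%N => n _; rewrite subrr cn0 ltW. Qed.

Lemma climD u v x y : clim u x -> clim v y -> clim (fun n => u n + v n) (x + y).
Proof.
move=> ux vy; apply: (@clim_squeeze _ _ (fun n => cn (u n - x) + cn (v n - y))).
  by move=> n; apply: le_trans (cnD _ _); rewrite opprD addrACA.
by rewrite -[0]addr0; exact: cvgD ux vy.
Qed.

Lemma climZ a u x : clim u x -> clim (fun n => a * u n) (a * x).
Proof.
move=> ux; apply: (@clim_squeeze _ _ (fun n => cn a * cn (u n - x))).
  by move=> n; rewrite -mulrBr cnM.
by rewrite -[X in _ --> X](mulr0 (cn a)); apply: cvgM => //; exact: cvg_cst.
Qed.

Lemma clim_sum (I : Type) (r : seq I) (u_ : I -> nat -> C) (x_ : I -> C) :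
  (forall i, clim (u_ i) (x_ i)) ->
  clim (fun n => \sum_(i <- r) u_ i n) (\sum_(i <- r) x_ i).
Proof.
move=> h; elim: r => [|i r ih].
  by rewrite big_nil; under eq_fun do rewrite big_nil; exact: clim_cst.
by rewrite big_cons; under eq_fun do rewrite big_cons; exact: climD.
Qed.

Lemma climM u v x y : clim u x -> clim v y -> clim (fun n => u n * v n) (x * y).
Proof.
move=> ux vy; apply: (@clim_squeeze _ _ (fun n =>
  cn (u n - x) * cn (v n - y) + cn (u n - x) * cn y + cn x * cn (v n - y))).
  move=> n; rewrite -!cnM.
  rewrite (_ : _ - _ = (u n - x) * (v n - y) + (u n - x) * y + x * (v n - y)).
    by apply: le_trans (cnD _ _) _; rewrite lerD2r; exact: cnD.
  by ring.
rewrite [X in _ --> X](_ : 0 = 0 * 0 + 0 * cn y + cn x * 0); last by ring.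
apply: cvgD; first apply: cvgD.
- exact: cvgM.
- by apply: cvgM => //; exact: cvg_cst.
- by apply: cvgM => //; exact: cvg_cst.
Qed.

Lemma clim_shift u x k : clim u x -> clim (fun n => u (n + k)%N) x.
Proof.
move=> /climP ux; apply/climP => e /ux[N h]; exists N => n Nn.
by apply: h; rewrite (leq_trans Nn)// leq_addr.
Qed.

Lemma clim_Re u x : clim u x -> complex.Re (u n) @[n --> \oo] --> complex.Re x.
Proof.
move=> ux; apply/cvgrPdist_le => e e0; have /climP /(_ e e0) [N h] := ux.
exists N => // n /h /=; apply: le_trans; rewrite cnB.
by apply: le_trans (cn_Re _); case: (x) => a b; case: (u n).
Qed.

Lemma real_clim (a : nat -> R) (l : R) :
  clim (fun n => (a n)%:C%C) l%:C%C <-> a n @[n --> \oo] --> l.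
Proof.
split=> [/clim_Re//|al]; apply/climP => e e0.
have /cvgrPdist_le /(_ e e0) [N _ h] := al; exists N => n /h /=.
by rewrite -rmorphB cn_real distrC.
Qed.

Lemma monotone_bounded_cvg (s : nat -> R) (M : R) :
  (forall n, s n <= s n.+1) -> (forall n, s n <= M) ->
  exists l, [/\ s n @[n --> \oo] --> l, l <= M & forall n, s n <= l].
Proof.
move=> smon sM; have snd : nondecreasing_seq s by apply/nondecreasing_seqP.
have sb : has_ubound (range s) by exists M => _ [n _ <-].
exists (sup (range s)); split.
- exact: nondecreasing_cvgn.
- by apply: ge_sup; [exists (s 0%N), 0%N|move=> _ [n _ <-]].
- by move=> n; apply: ub_le_sup => //; exists n.
Qed.

Lemma clim_step_bound u (m : nat -> R) n k :
  (forall n, cn (u n.+1 - u n) <= m n) -> (n <= k)%N ->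
  cn (u k - u n) <= \sum_(i < k) m i - \sum_(i < n) m i.
Proof.
move=> um; elim: k => [|k ih]; first by rewrite leqn0 => /eqP ->; rewrite !subrr cn0.
have [->|nk] := eqVneq n k.+1; first by rewrite !subrr cn0.
rewrite leq_eqVlt (negPf nk)/= ltnS => /ih h; apply: le_trans (cn_triangle _ (u k) _) _.
by rewrite big_ord_recr/= [leRHS]addrAC [leLHS]addrC; apply: lerD.
Qed.

(** Real and imaginary parts are Cauchy because the partial sums of [m] converge. The tail is
    measured against the bound [M] rather than the sum of the series, which later gives rates in
    closed form. *)
Lemma summable_clim u (m : nat -> R) (M : R) :
  (forall n, cn (u n.+1 - u n) <= m n) -> (forall n, \sum_(i < n) m i <= M) ->
  exists2 l, clim u l & forall n, cn (l - u n) <= M - \sum_(i < n) m i.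
Proof.
move=> um mM; have m0 n : 0 <= m n := le_trans (cn_ge0 _) (um n).
pose s n := \sum_(i < n) m i.
have [l [sl lM sle]] : exists l, [/\ s n @[n --> \oo] --> l, l <= M &
    forall n, s n <= l].
  by apply: monotone_bounded_cvg => // n; rewrite /s big_ord_recr/= lerDl.
have cauchy (p : C -> R) : {morph p : x y / x - y} -> (forall x, `|p x| <= cn x) ->
    cvgn (fun n => p (u n)).
  move=> pB pc; apply: cauchy_cvg; apply: cauchy_exP => e e0.
  have /cvgrPdist_lt /(_ _ (divr_gt0 e0 (ltr0Sn _ 1))) [N _ h] := sl.
  have H n : (N <= n)%N -> `|p (u N) - p (u n)| < e / 2.
    move=> Nn; rewrite -pB; apply: le_lt_trans (pc _) _; rewrite cnB.
    apply: le_lt_trans (clim_step_bound um Nn) _.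
    apply: le_lt_trans (h N (leqnn N)); rewrite ger0_norm ?subr_ge0// lerD2r//.
    exact: sle.
  exists (p (u N)); exists N => // n /= Nn; rewrite -ball_normE /ball_ /=.
  by apply: lt_trans (H n Nn) _; rewrite ltr_pdivrMr// ltr_pMr// ltr1n.
have ReB : {morph (@complex.Re R) : x y / x - y} by case=> ? ? [].
have ImB : {morph (@complex.Im R) : x y / x - y} by case=> ? ? [].
have /cvg_ex[/= a ua] := cauchy _ ReB cn_Re.
have /cvg_ex[/= b ub] := cauchy _ ImB cn_Im.
have ul : clim u (a +i* b)%C.
  apply: (@clim_squeeze _ _ (fun n =>
      `|complex.Re (u n) - a| + `|complex.Im (u n) - b|)).
    by move=> n; apply: le_trans (cn_le_ReIm _) _; case: (u n).
  rewrite -[X in _ --> X]addr0; apply: cvgD; apply/norm_cvg0P.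
    by apply/subr_cvg0.
  by apply/subr_cvg0.
exists (a +i* b)%C => // n; apply: (clim_near_le ul (N := n)) => k nk.
by apply: le_trans (clim_step_bound um nk) _; rewrite lerD2r.
Qed.

End complex_modulus.

(** * Functions majorized on a polydisc *)

Section majorants.
Context {R : realType} {m : nat}.
Local Notation C := R[i].
Local Notation mi := {ffun 'I_m -> nat}.
Implicit Types (r M : R) (L : seq (C * mi)) (h : 'rV[C]_m).
Implicit Types f g : 'rV[C]_m -> C.

Definition deg (a : 'I_m -> nat) : nat := \sum_i a i.

Definition lev L h : C := \sum_(t <- L) t.1 * monomial h t.2.

Definition lnorm r L : R := \sum_(t <- L) cn t.1 * r ^+ deg t.2.

Definition polydisc r : set 'rV[C]_m := [set h | forall i, cn (h 0 i) <= r].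

(* [f] is, on the closed polydisc of radius [r], the sum of a family of
   monomials whose l1-norm in radius [r] is at most [M]; the family is arranged
   in a sequence of finite lists and may repeat monomials, which makes products
   and series of such functions straightforward. *)
Definition majorized r f M := exists L : nat -> seq (C * mi),
  (forall n, \sum_(k < n) lnorm r (L k) <= M) /\
  (forall h, polydisc r h -> clim (fun n => \sum_(k < n) lev (L k) h) (f h)).

Lemma monomial_norm r h (a : 'I_m -> nat) : 0 <= r -> polydisc r h ->
  cn (monomial h a) <= r ^+ deg a.
Proof.
move=> r0 hr; rewrite /monomial cn_prod /deg -prodrXr.
by apply: ler_prod => i _; rewrite cn_ge0 cnX lerXn2r ?nnegrE ?cn_ge0 ?hr.
Qed.

Lemma lev_norm r L h : 0 <= r -> polydisc r h -> cn (lev L h) <= lnorm r L.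
Proof.
move=> r0 hr; apply: le_trans (cn_sum _ _ _) _; apply: ler_sum => t _.
by rewrite cnM ler_wpM2l ?cn_ge0 ?monomial_norm.
Qed.

Lemma lnorm_ge0 r L : 0 <= r -> 0 <= lnorm r L.
Proof.
by move=> r0; apply: sumr_ge0 => t _; rewrite mulr_ge0 ?cn_ge0 ?exprn_ge0.
Qed.

Lemma lev_cat L L' h : lev (L ++ L') h = lev L h + lev L' h.
Proof. by rewrite /lev big_cat. Qed.

Lemma lnorm_cat r L L' : lnorm r (L ++ L') = lnorm r L + lnorm r L'.
Proof. by rewrite /lnorm big_cat. Qed.

Lemma lev_flatten (I : Type) (s : seq I) (F : I -> seq (C * mi)) h :
  lev (flatten [seq F i | i <- s]) h = \sum_(i <- s) lev (F i) h.
Proof.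
by elim: s => [|i s ih]; rewrite ?big_nil ?big_cons -?ih /= ?lev_cat// /lev big_nil.
Qed.

Lemma lnorm_flatten r (I : Type) (s : seq I) (F : I -> seq (C * mi)) :
  lnorm r (flatten [seq F i | i <- s]) = \sum_(i <- s) lnorm r (F i).
Proof.
by elim: s => [|i s ih]; rewrite ?big_nil ?big_cons -?ih /= ?lnorm_cat// /lnorm big_nil.
Qed.

Definition lmul L L' : seq (C * mi) :=
  
  [seq (t.1 * u.1, [ffun i => (t.2 i + u.2 i)%N] : mi) |
    t : C * mi <- L, u : C * mi <- L'].

Lemma lev_mul L L' h : lev (lmul L L') h = lev L h * lev L' h.
Proof.
rewrite /lev /lmul big_allpairs_dep/= big_distrlr/=.
apply: eq_bigr => t _; apply: eq_bigr => u _ /=.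
rewrite mulrACA; congr (_ * _); rewrite /monomial -big_split/=.
by apply: eq_bigr => i _; rewrite ffunE exprD.
Qed.

Lemma lnorm_mul r L L' : lnorm r (lmul L L') = lnorm r L * lnorm r L'.
Proof.
rewrite /lnorm /lmul big_allpairs_dep/= big_distrlr/=.
apply: eq_bigr => t _; apply: eq_bigr => u _ /=.
rewrite mulrACA cnM; congr (_ * _); rewrite -exprD; congr (_ ^+ _).
by rewrite /deg -big_split/=; apply: eq_bigr => i _; rewrite ffunE.
Qed.

Definition lprefix (L : nat -> seq (C * mi)) n := flatten [seq L k | k <- iota 0 n].

Lemma lev_prefix (l : nat -> seq (C * mi)) n h :
  lev (lprefix l n) h = \sum_(k < n) lev (l k) h.
Proof. by rewrite lev_flatten -{1}[n]subn0 big_mkord. Qed.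

Lemma lnorm_prefix r (l : nat -> seq (C * mi)) n :
  lnorm r (lprefix l n) = \sum_(k < n) lnorm r (l k).
Proof. by rewrite lnorm_flatten -{1}[n]subn0 big_mkord. Qed.

Lemma majorized_ge0 r f M : majorized r f M -> 0 <= M.
Proof. by move=> [L [/(_ 0%N)]]; rewrite big_ord0. Qed.

Lemma majorized_le r f M M' : majorized r f M -> M <= M' -> majorized r f M'.
Proof. by move=> [L [LM Lf]] MM'; exists L; split=> // n; apply: le_trans MM'. Qed.

Lemma majorized_ext r f g M : (forall h, polydisc r h -> f h = g h) ->
  majorized r f M -> majorized r g M.
Proof.
by move=> fg [L [LM Lf]]; exists L; split=> // h hr; rewrite -fg//; exact: Lf.
Qed.

Lemma majorized_radius r r' f M : 0 <= r' -> r' <= r ->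
  majorized r f M -> majorized r' f M.
Proof.
move=> r0 rr [L [LM Lf]]; exists L; split=> [n|h hr].
  apply: le_trans (LM n); apply: ler_sum => k _; apply: ler_sum => t _.
  by rewrite ler_wpM2l ?cn_ge0// lerXn2r// nnegrE (le_trans r0).
by apply: Lf => i; apply: le_trans (hr i) rr.
Qed.

Lemma majorized_list r L : 0 <= r -> majorized r (lev L) (lnorm r L).
Proof.
move=> r0; exists (fun k => if k is 0%N then L else [::]); split=> [[|n]|h _].
- by rewrite big_ord0 lnorm_ge0.
- rewrite big_ord_recl/= big1 ?addr0// => i _.
  by rewrite /lnorm big_nil.
- apply/climP => e e0; exists 1%N => -[//|n] _; rewrite big_ord_recl/= big1.
    by rewrite addr0 subrr cn0 ltW.
  by move=> i _; rewrite /lev big_nil.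
Qed.

Lemma majorized_cst r c : 0 <= r -> majorized r (fun=> c) (cn c).
Proof.
move=> r0; have := majorized_list [:: (c, [ffun=> 0%N])] r0.
rewrite /lnorm big_seq1 /= (_ : deg _ = 0%N) ?expr0 ?mulr1; last first.
  by rewrite /deg big1// => i _; rewrite ffunE.
apply: majorized_ext => h _; rewrite /lev big_seq1 /monomial big1 ?mulr1// => i _.
by rewrite ffunE expr0.
Qed.

Lemma majorized0 r M : 0 <= r -> 0 <= M -> majorized r (fun=> 0) M.
Proof.
by move=> r0; rewrite -{1}cn0; apply: majorized_le; exact: majorized_cst.
Qed.

Lemma majorizedD r f g M M' : majorized r f M -> majorized r g M' ->
  majorized r (fun h => f h + g h) (M + M').
Proof.
move=> [L [LM Lf]] [L' [LM' Lg]]; exists (fun k => L k ++ L' k); split=> [n|h hr].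
  by under eq_bigr do rewrite lnorm_cat; rewrite big_split lerD.
under eq_fun => n do (under eq_bigr do rewrite lev_cat).
under eq_fun do rewrite big_split.
by apply: climD; [exact: Lf|exact: Lg].
Qed.

Lemma majorizedM r f g M M' : 0 <= r -> majorized r f M -> majorized r g M' ->
  majorized r (fun h => f h * g h) (M * M').
Proof.
move=> r0 [L [LM Lf]] [L' [LM' Lg]].
(* The increment S_{n+1} S'_{n+1} - S_n S'_n of the product of the partial sums. Both [lev] and
   [lnorm] are multiplicative on lists, so values and norms telescope alike. *)
pose P n := lmul (L n) (lprefix L' n) ++ lmul (lprefix L n.+1) (L' n).
have levP h n : \sum_(k < n) lev (P k) h =
    (\sum_(k < n) lev (L k) h) * (\sum_(k < n) lev (L' k) h).
  elim: n => [|n ih]; first by rewrite !big_ord0 mul0r.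
  rewrite big_ord_recr/= ih /P lev_cat !lev_mul !lev_prefix !big_ord_recr/=.
  by ring.
have lnormP n : \sum_(k < n) lnorm r (P k) =
    (\sum_(k < n) lnorm r (L k)) * (\sum_(k < n) lnorm r (L' k)).
  elim: n => [|n ih]; first by rewrite !big_ord0 mul0r.
  rewrite big_ord_recr/= ih /P lnorm_cat !lnorm_mul !lnorm_prefix !big_ord_recr/=.
  by ring.
exists P; split=> [n|h hr].
  rewrite lnormP; apply: ler_pM => //; apply: sumr_ge0 => k _; exact: lnorm_ge0.
by under eq_fun do rewrite levP; apply: climM; [exact: Lf|exact: Lg].
Qed.

Lemma majorizedZ r c f M : 0 <= r -> majorized r f M ->
  majorized r (fun h => c * f h) (cn c * M).
Proof. by move=> r0; apply: majorizedM => //; exact: majorized_cst. Qed.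

Lemma majorizedN r f M : 0 <= r -> majorized r f M ->
  majorized r (fun h => - f h) M.
Proof.
move=> r0 /(majorizedZ (-1) r0); rewrite cnN cn1 mul1r.
by apply: majorized_ext => h _; rewrite mulN1r.
Qed.

Lemma majorizedB r f g M M' : 0 <= r -> majorized r f M -> majorized r g M' ->
  majorized r (fun h => f h - g h) (M + M').
Proof. by move=> r0 mf /(majorizedN r0); exact: majorizedD. Qed.

Lemma majorized_sum r (I : Type) (s : seq I) (P : pred I)
    (F : I -> 'rV[C]_m -> C) (M : I -> R) :
  0 <= r -> (forall i, P i -> majorized r (F i) (M i)) ->
  majorized r (fun h => \sum_(i <- s | P i) F i h) (\sum_(i <- s | P i) M i).
Proof.
move=> r0 FM; elim: s => [|i s ih].
  rewrite big_nil; apply: majorized_ext (_ : majorized r (fun=> 0) 0).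
    by move=> h _; rewrite big_nil.
  by rewrite -cn0; exact: majorized_cst.
rewrite big_cons; case: ifP => Pi.
  apply: majorized_ext (majorizedD (FM i Pi) ih) => h _.
  by rewrite big_cons Pi.
by apply: majorized_ext ih => h _; rewrite big_cons Pi.
Qed.

Lemma majorizedX r f M n : 0 <= r -> majorized r f M ->
  majorized r (fun h => f h ^+ n) (M ^+ n).
Proof.
move=> r0 fM; elim: n => [|n ih].
  by rewrite expr0 -cn1; exact: majorized_cst.
by rewrite exprS; apply: majorized_ext (majorizedM r0 fM ih) => h _; rewrite exprS.
Qed.

Lemma majorized_bound r f M h : 0 <= r -> majorized r f M -> polydisc r h ->
  cn (f h) <= M.
Proof.
move=> r0 [L [LM Lf]] hr; rewrite -[f h]subr0.
apply: (clim_near_le (Lf h hr) (N := 0)) => n _; rewrite subr0.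
apply: le_trans (cn_sum _ _ _) (le_trans _ (LM n)).
by apply: ler_sum => k _; exact: lev_norm.
Qed.

(** The square of side [K] is cut into the hooks max(k, j) = n. *)
Lemma sum_square (V : nmodType) (x : nat -> nat -> V) K :
  \sum_(n < K) (\sum_(k < n) x k n + \sum_(j < n.+1) x n j) =
  \sum_(k < K) \sum_(j < K) x k j.
Proof.
elim: K => [|K ih]; first by rewrite !big_ord0.
rewrite big_ord_recr/= ih [RHS]big_ord_recr/= addrA; congr (_ + _).
by rewrite -big_split/=; apply: eq_bigr => k _; rewrite big_ord_recr.
Qed.

(** The double family of lists is enumerated along growing squares, whose norms are at most the
    partial sums of [M_]. The distance to the partial sums is recorded because it identifies [F]
    wherever the sum is known otherwise. *)
Lemma majorized_series r (f : nat -> 'rV[C]_m -> C) (M_ : nat -> R) M : 0 <= r ->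
  (forall k, majorized r (f k) (M_ k)) -> (forall n, \sum_(k < n) M_ k <= M) ->
  exists2 F, majorized r F M & forall h n, polydisc r h ->
    cn (F h - \sum_(k < n) f k h) <= M - \sum_(k < n) M_ k.
Proof.
move=> r0 /choice[L LP] MM.
pose Q n := flatten [seq L k n | k <- iota 0 n] ++ lprefix (L n) n.+1.
have levQ h n : \sum_(k < n) lev (Q k) h =
    \sum_(k < n) \sum_(j < n) lev (L k j) h.
  rewrite -[RHS](sum_square (fun k j => lev (L k j) h)).
  apply: eq_bigr => k _; rewrite lev_cat lev_prefix.
  by rewrite lev_flatten -{1}[k : nat]subn0 big_mkord.
have lnormQ n : \sum_(k < n) lnorm r (Q k) =
    \sum_(k < n) \sum_(j < n) lnorm r (L k j).
  rewrite -[RHS](sum_square (fun k j => lnorm r (L k j))).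
  apply: eq_bigr => k _; rewrite lnorm_cat lnorm_prefix.
  by rewrite lnorm_flatten -{1}[k : nat]subn0 big_mkord.
have QM n : \sum_(k < n) lnorm r (Q k) <= M.
  rewrite lnormQ; apply: le_trans (MM n); apply: ler_sum => k _.
  by have [h _] := LP k; exact: h.
have /choice[F FP] : forall h, exists l, polydisc r h ->
    clim (fun n => \sum_(k < n) lev (Q k) h) l.
  move=> h; have [hr|nhr] := pselect (polydisc r h); last by exists 0.
  have [|l Ql _] := summable_clim (u := fun n => \sum_(k < n) lev (Q k) h)
    (m := fun k => lnorm r (Q k)) _ QM.
    by move=> n; rewrite big_ord_recr/= addrAC subrr add0r lev_norm.
  by exists l.
exists F; first by exists Q.
move=> h n hr.
have Ff : clim (fun K => \sum_(k < K) lev (Q k) h +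
     -1 * \sum_(k < n) \sum_(j < K) lev (L k j) h)
    (F h + -1 * \sum_(k < n) f k h).
  apply: climD; first exact: FP.
  apply: climZ; apply: (@clim_sum _ _ _ (fun (k : 'I_n) K => \sum_(j < K) lev (L k j) h)
    (fun k : 'I_n => f k h)) => k.
  by have [_] := LP k; apply.
rewrite -[X in cn X]subr0 -[X in F h - X]mul1r -mulNr.
apply: (clim_near_le Ff (N := n)) => K nK; rewrite subr0 levQ.
have split_sum (V : nmodType) (x : nat -> V) :
    \sum_(k < K) x k = \sum_(k < n) x k + \sum_(n <= k < K) x k.
  by rewrite -!(big_mkord xpredT x) -big_cat_nat.
rewrite (split_sum _ (fun k => \sum_(j < K) lev (L k j) h)) mulN1r addrAC subrr add0r.
apply: le_trans (cn_sum _ _ _) _; rewrite lerBrDl.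
apply: le_trans (MM K); rewrite split_sum lerD2l; apply: ler_sum => k _.
apply: le_trans (cn_sum _ _ _) _; have [/(_ K) + _] := LP k; apply: le_trans.
by apply: ler_sum => j _; exact: lev_norm.
Qed.

Lemma geometric_partial (q : R) n : q != 1 ->
  \sum_(k < n) q ^+ k = (1 - q ^+ n) / (1 - q).
Proof.
move=> q1; have q1' : 1 - q != 0 by rewrite subr_eq0 eq_sym.
apply: (mulIf q1'); rewrite divfK// mulrC.
by rewrite -opprB mulNr -subrX1 opprB.
Qed.

(** The geometric series in [- u], majorized by the one in [t]. *)
Lemma majorized_inv r u t : 0 <= r -> t < 1 -> majorized r u t ->
  (forall h, polydisc r h -> 1 + u h != 0) /\
  majorized r (fun h => (1 + u h)^-1) (1 - t)^-1.
Proof.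
move=> r0 t1 ut; have t0 := majorized_ge0 ut; have t1' : 0 < 1 - t by rewrite subr_gt0.
have unz h : polydisc r h -> 1 + u h != 0.
  move=> hr; apply/negP => /eqP /(congr1 (fun x => x - 1)).
  rewrite addrC addrA addNr add0r sub0r => uh.
  have := majorized_bound r0 ut hr; rewrite uh cnN cn1; by rewrite leNgt t1.
split=> //.
have sumt n : \sum_(k < n) t ^+ k <= (1 - t)^-1.
  rewrite geometric_partial ?lt_eqF// ler_pdivrMr// mulVf ?gt_eqF//.
  by rewrite gerBl exprn_ge0.
have [F FM FP] := majorized_series r0
  (fun k => majorizedX k r0 (majorizedN r0 ut)) sumt.
apply: majorized_ext FM => h hr; apply: (mulIf (unz _ hr)); rewrite mulVf ?unz//.
have geom n : (\sum_(k < n) (- u h) ^+ k) * (1 + u h) = 1 - (- u h) ^+ n.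
  by rewrite -[X in 1 + X]opprK mulrC -opprB mulNr -subrX1 opprB.
have uh := majorized_bound r0 ut hr.
have tn : t ^+ n @[n --> \oo] --> (0 : R).
  by apply: cvg_expr; rewrite ger0_norm.
apply: (@clim_unique _ (fun n => F h * (1 + u h))); first exact: clim_cst.
(* The tail t^n / (1 - t) of the series is multiplied by |1 + u| <= 1 + t; the remaining t^n bounds
   (- u)^n. *)
apply: (@clim_squeeze _ _ _ (fun n => ((1 - t)^-1 * (1 + t) + 1) * t ^+ n)); last first.
  rewrite -[X in _ --> X](mulr0 ((1 - t)^-1 * (1 + t) + 1)).
  by apply: cvgM => //; exact: cvg_cst.
move=> n; apply: le_trans (cn_triangle _ (1 - (- u h) ^+ n) _) _.
rewrite mulrDl mul1r lerD//; last first.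
  by rewrite addrAC subrr sub0r cnN cnX cnN lerXn2r// nnegrE ?cn_ge0.
rewrite -geom -mulrBl cnM mulrAC ler_pM ?cn_ge0//.
  apply: le_trans (FP _ n hr) _; rewrite geometric_partial ?lt_eqF//.
  by rewrite mulrBl mul1r opprB addrC subrK mulrC.
by apply: le_trans (cnD _ _) _; rewrite cn1 lerD2l.
Qed.

Lemma monomial0 (a : 'I_m -> nat) : monomial (0 : 'rV[C]_m) a = (deg a == 0%N)%:R.
Proof.
rewrite /monomial /deg; have [[i ai]|a0] := pselect (exists i, a i != 0%N).
  rewrite (bigD1 i)//= mxE expr0n (negPf ai) mul0r (bigD1 i)//=.
  by rewrite addn_eq0 (negPf ai).
have {}a0 i : a i = 0%N by apply/eqP/negPn/negP => ai; apply: a0; exists i.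
by rewrite !big1// => i _; rewrite a0// expr0.
Qed.

Lemma polydisc0 r : 0 <= r -> polydisc r 0.
Proof. by move=> r0 i; rewrite mxE cn0. Qed.

Lemma polydisc_le r r' h : r <= r' -> polydisc r h -> polydisc r' h.
Proof. by move=> rr hr i; apply: le_trans (hr i) rr. Qed.

(** The terms of degree 0 add up to [f 0], and every other monomial gains at least one factor [s] in
    the smaller radius: an l1 form of the Schwarz lemma. *)
Lemma majorized_shrink r f M s : 0 <= r -> 0 <= s -> s <= 1 -> majorized r f M ->
  majorized (s * r) (fun h => f h - f 0) (s * M).
Proof.
move=> r0 s0 s1 [L [LM Lf]].
exists (fun k => [seq t : C * mi <- L k | deg t.2 != 0%N]); split=> [n|h hr].
  apply: le_trans (_ : s * \sum_(k < n) lnorm r (L k) <= _); last first.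
    by rewrite ler_wpM2l.
  rewrite mulr_sumr; apply: ler_sum => k _; rewrite /lnorm big_filter mulr_sumr.
  rewrite [leRHS](bigID (fun t : C * mi => deg t.2 != 0%N))/= -[leLHS]addr0.
  apply: lerD; last first.
    by apply: sumr_ge0 => t _; rewrite !mulr_ge0 ?cn_ge0 ?exprn_ge0.
  apply: ler_sum => t; rewrite -lt0n => dt; rewrite mulrCA ler_wpM2l ?cn_ge0//.
  rewrite exprMn ler_wpM2r ?exprn_ge0// -[leRHS]expr1.
  exact: ler_wiXn2l.
have sr : s * r <= r by rewrite ler_piMl.
have := climD (Lf h (polydisc_le sr hr)) (climZ (-1) (Lf 0 (polydisc0 r0))).
rewrite mulN1r; under eq_fun do rewrite mulr_sumr -big_split.
congr (clim _ _); apply/funext => n; apply: eq_bigr => k _.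
rewrite mulN1r /lev -sumrN -big_split/= big_filter.
rewrite [LHS](bigID (fun t : C * mi => deg t.2 != 0%N))/= [X in _ + X]big1 ?addr0.
  by apply: eq_bigr => t /negPf dt; rewrite monomial0 dt mulr0 subr0.
move=> t; rewrite negbK => dt; rewrite monomial0 dt /monomial big1 ?subrr// => i _.
by move: dt; rewrite /deg sum_nat_eq0 => /forallP/(_ i)/implyP/(_ isT)/eqP ->.
Qed.

End majorants.

(** * Coefficients and Cauchy estimates *)

Section boxes.
Context {m : nat}.
Local Notation mi := {ffun 'I_m -> nat}.

Definition boxseq n : seq mi :=
  
  [seq [ffun i => b i : nat] | b : {ffun 'I_m -> 'I_n} <- enum {ffun 'I_m -> 'I_n}].

Lemma mem_boxseq n (a : mi) : (a \in boxseq n) = [forall i, (a i < n)%N].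
Proof.
apply/mapP/forallP => [[b _ ->] i|h]; first by rewrite ffunE.
exists [ffun i => Ordinal (h i)]; first by rewrite mem_enum.
by apply/ffunP => i; rewrite !ffunE.
Qed.

Lemma boxseq_uniq n : uniq (boxseq n).
Proof.
rewrite map_inj_uniq ?enum_uniq// => b b' /ffunP e; apply/ffunP => i.
by apply/val_inj; have := e i; rewrite !ffunE.
Qed.

Lemma box_sumE (U : nmodType) (t : ('I_m -> nat) -> U) n :
  box_sum t n = \sum_(a <- boxseq n) t a.
Proof.
rewrite /box_sum /boxseq big_map big_enum; apply: eq_bigr => b _.
by congr t; apply/funext => i; rewrite ffunE.
Qed.

Lemma boxseq_le n k (a : mi) : (n <= k)%N -> a \in boxseq n -> a \in boxseq k.
Proof.
rewrite !mem_boxseq => nk /forallP h; apply/forallP => i.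
exact: leq_trans (h i) nk.
Qed.

Lemma boxseq_split (U : nmodType) (t : mi -> U) n k : (n <= k)%N ->
  \sum_(a <- boxseq k) t a =
  \sum_(a <- boxseq n) t a + \sum_(a <- boxseq k | a \notin boxseq n) t a.
Proof.
move=> nk; rewrite (bigID (fun a => a \in boxseq n))/=; congr (_ + _).
rewrite -big_filter; apply: perm_big; apply: uniq_perm.
- by rewrite filter_uniq ?boxseq_uniq.
- exact: boxseq_uniq.
- move=> a; rewrite mem_filter andb_idr//; exact: boxseq_le.
Qed.

Lemma boxseq_exhaust (s : seq mi) :
  exists n, forall a, a \in s -> a \in boxseq n.
Proof.
elim: s => [|b s [n h]]; first by exists 0%N.
exists (maxn n (\max_i b i).+1) => a; rewrite inE => /orP[/eqP ->|/h].
  rewrite mem_boxseq; apply/forallP => i; apply: leq_trans (leq_maxr _ _).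
  by rewrite ltnS leq_bigmax.
by apply: boxseq_le; exact: leq_maxl.
Qed.

End boxes.

Section real_limits.
Context {R : realType}.
Implicit Types (s t : nat -> R) (l M : R).

Lemma cvg_near_le s l M N : s n @[n --> \oo] --> l ->
  (forall n, (N <= n)%N -> s n <= M) -> l <= M.
Proof.
move=> sl sM; have -> : l = lim (s n @[n --> \oo]) by apply/esym/cvg_lim.
by apply: limr_le; [apply/cvg_ex; exists l|exists N].
Qed.

Lemma clim_cn (u : nat -> R[i]) x : clim u x -> cn (u n) @[n --> \oo] --> cn x.
Proof.
move=> ux; apply/cvgrPdist_le => e e0; have /climP /(_ e e0) [N h] := ux.
exists N => // n /h /=; apply: le_trans.
rewrite ler_norml; apply/andP; split.
  rewrite lerNl opprB lerBlDr; apply: le_trans (cnD _ _); by rewrite subrK.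
by rewrite lerBlDr cnB; apply: le_trans (cnD _ _); rewrite subrK.
Qed.

Lemma cvg_finite_sum (I : Type) (r : seq I) (u_ : I -> nat -> R) (x_ : I -> R) :
  (forall i, u_ i n @[n --> \oo] --> x_ i) ->
  \sum_(i <- r) u_ i n @[n --> \oo] --> \sum_(i <- r) x_ i.
Proof.
move=> h; elim: r => [|i r ih].
  by rewrite big_nil; under eq_fun do rewrite big_nil; exact: cvg_cst.
by rewrite big_cons; under eq_fun do rewrite big_cons; exact: cvgD.
Qed.

End real_limits.

(** * Coefficients of a majorized function *)

Section coefficients.
Context {R : realType} {m : nat}.
Local Notation C := R[i].
Local Notation mi := {ffun 'I_m -> nat}.
Implicit Types (r M : R) (L : seq (C * mi)) (h : 'rV[C]_m).
Implicit Types f g : 'rV[C]_m -> C.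

(** Majorization with the terms collected: one coefficient for each exponent, summed over boxes as
    in [power_series_sum]. *)
Definition expansion r (c : ('I_m -> nat) -> C) f M :=
  (forall n, \sum_(a <- boxseq n) cn (c a) * r ^+ deg a <= M) /\
  (forall h, polydisc r h ->
    clim (fun n => \sum_(a <- boxseq n) c a * monomial h a) (f h)).

Lemma expansion_majorized r c f M : 0 <= r -> expansion r c f M ->
  majorized r f M.
Proof.
move=> r0 [cM cf].
(* Shells between consecutive boxes. The case k = 0 takes the whole first box, because with no
   variables the box of side 0 already contains the only exponent. *)
pose L k := [seq (c a, a) | a : mi <- boxseq k.+1 & (k == 0%N) || (a \notin boxseq k)].
have LE (U : nmodType) (t : mi -> U) n :
    \sum_(k < n.+1) \sum_(a <- boxseq k.+1 | (k == 0%N :> nat) || (a \notin boxseq k)) t a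
    = \sum_(a <- boxseq n.+1) t a.
  elim: n => [|n ih]; first by rewrite big_ord_recl big_ord0 addr0.
  by rewrite big_ord_recr/= ih -boxseq_split.
exists L; split=> [[|n]|h hr].
- rewrite big_ord0; apply: le_trans (cM 0%N); apply: sumr_ge0 => a _.
  by rewrite mulr_ge0 ?cn_ge0 ?exprn_ge0.
- apply: le_trans (cM n.+1); rewrite -LE; apply: ler_sum => k _.
  by rewrite /lnorm /L big_map big_filter.
- have /climP H := cf h hr; apply/climP => e /H[N NP]; exists N.+1 => -[//|n] Nn.
  have := NP n.+1 (ltnW Nn); rewrite -LE; congr (cn (_ - _) <= _).
  by apply: eq_bigr => k _; rewrite [RHS]/lev /L [RHS]big_map big_filter.
Qed.

Lemma lnorm_filter_split r L (P : pred mi) :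
  lnorm r L = lnorm r [seq t : C * mi <- L | P t.2] +
              lnorm r [seq t : C * mi <- L | ~~ P t.2].
Proof. by rewrite /lnorm (bigID (fun t : C * mi => P t.2))/= !big_filter. Qed.

Lemma lev_filter_split h L (P : pred mi) :
  lev L h = lev [seq t : C * mi <- L | P t.2] h +
            lev [seq t : C * mi <- L | ~~ P t.2] h.
Proof. by rewrite /lev (bigID (fun t : C * mi => P t.2))/= !big_filter. Qed.

Definition lcoef L (a : mi) : C := \sum_(t <- L | t.2 == a) t.1.

Lemma lcoef_sum (V : nmodType) (F : C * mi -> V) L (s : seq mi) : uniq s ->
  \sum_(a <- s) \sum_(t <- L | t.2 == a) F t = \sum_(t <- L | t.2 \in s) F t.
Proof.
move=> us; under eq_bigr do rewrite big_mkcond.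
rewrite exchange_big/= [RHS]big_mkcond/=; apply: eq_bigr => t _.
case: ifPn => ts.
  rewrite (bigD1_seq t.2)//= eqxx big1 ?addr0// => a.
  by rewrite eq_sym => /negPf ->.
rewrite big_seq big1// => a sa; case: eqP => // ta.
by rewrite ta sa in ts.
Qed.

Lemma lcoef_lev L s h : uniq s ->
  \sum_(a <- s) lcoef L a * monomial h a = lev [seq t : C * mi <- L | t.2 \in s] h.
Proof.
move=> us; rewrite /lev big_filter -lcoef_sum//; apply: eq_bigr => a _.
by rewrite /lcoef mulr_suml; apply: eq_bigr => t /eqP ->.
Qed.

Lemma lcoef_lnorm r L s : 0 <= r -> uniq s ->
  \sum_(a <- s) cn (lcoef L a) * r ^+ deg a <= lnorm r L.
Proof.
move=> r0 us; rewrite (lnorm_filter_split r L (fun a => a \in s)).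
rewrite -[leLHS]addr0 lerD ?lnorm_ge0// /lnorm big_filter -lcoef_sum//.
apply: ler_sum => a _; rewrite (eq_bigr (fun t => cn t.1 * r ^+ deg a)); last first.
  by move=> t /eqP ->.
by rewrite -mulr_suml ler_wpM2r ?exprn_ge0// cn_sum.
Qed.

(** Terms of equal exponent are added up; these series converge because, in a positive radius, the
    l1-norm controls each coefficient. A box holding all exponents of the first lists leaves only an
    l1 tail. *)
Lemma majorized_expansion r f M : 0 < r -> majorized r f M ->
  exists c, expansion r c f M.
Proof.
move=> r0 [L [LM Lf]]; have r0' := ltW r0.
have cE (a : mi) : exists l, clim (fun n => \sum_(k < n) lcoef (L k) a) l.
  have [|n|l] := @summable_clim _ (fun n => \sum_(k < n) lcoef (L k) a)
    (fun k => lnorm r (L k) / r ^+ deg a) (M / r ^+ deg a); last by exists l.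
    move=> n; rewrite big_ord_recr/= addrAC subrr add0r ler_pdivlMr ?exprn_gt0//.
    by have := @lcoef_lnorm r (L n) [:: a] r0' isT; rewrite big_seq1.
  by rewrite -mulr_suml ler_pM2r// invr_gt0 exprn_gt0.
have [c cP] := choice cE.
(* The choice is made on finite functions, so that the coefficient depends only on the values of the
   exponent. *)
pose c' (a : 'I_m -> nat) := c [ffun i => a i].
have c'E (a : mi) : c' a = c a.
  by congr c; apply/ffunP => i; rewrite ffunE.
exists c'; split=> [n|h hr].
  have S : \sum_(a <- boxseq n) cn (\sum_(k < K) lcoef (L k) a) * r ^+ deg a @[K --> \oo]
      --> \sum_(a <- boxseq n) cn (c' a) * r ^+ deg a.
    apply: (@cvg_finite_sum _ _ _ (fun (a : mi) K =>
      cn (\sum_(k < K) lcoef (L k) a) * r ^+ deg a)) => a.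
    apply: cvgM; last exact: cvg_cst.
    by rewrite c'E; exact: clim_cn.
  apply: (cvg_near_le S (N := 0)) => K _; apply: le_trans (LM K).
  apply: le_trans (_ : \sum_(a <- boxseq n) \sum_(k < K)
      cn (lcoef (L k) a) * r ^+ deg a <= _).
    by apply: ler_sum => a _; rewrite -mulr_suml ler_wpM2r ?exprn_ge0// cn_sum.
  rewrite exchange_big/=; apply: ler_sum => k _.
  by apply: lcoef_lnorm => //; exact: boxseq_uniq.
pose S n := \sum_(k < n) lnorm r (L k).
have [l [Sl _ Sle]] : exists l, [/\ S n @[n --> \oo] --> l, l <= M &
    forall n, S n <= l].
  by apply: monotone_bounded_cvg => // n; rewrite /S big_ord_recr/= lerDl lnorm_ge0.
apply/climP => e e0; have /cvgrPdist_le /(_ e e0) [K _ /(_ K (leqnn K)) /= KP] := Sl.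
rewrite ger0_norm ?subr_ge0 ?Sle// in KP.
(* From the box [n0] on, the first [K] lists cancel exactly against the collected terms. *)
have [n0 n0P] := boxseq_exhaust [seq t.2 | t <- lprefix L K].
exists n0 => n nn; rewrite cnB.
have Q : clim (fun K' => \sum_(k < K') lev (L k) h +
      -1 * \sum_(a <- boxseq n) (\sum_(k < K') lcoef (L k) a) * monomial h a)
    (f h + -1 * \sum_(a <- boxseq n) c' a * monomial h a).
  apply: climD; first exact: Lf.
  apply: climZ; apply: (@clim_sum _ _ _ (fun (a : mi) K' =>
    (\sum_(k < K') lcoef (L k) a) * monomial h a)) => a.
  by rewrite c'E; apply: climM; [exact: cP|exact: clim_cst].
rewrite mulN1r in Q.
rewrite -[X in cn X]subr0; apply: (clim_near_le Q (N := K)) => K' KK'.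
rewrite subr0 mulN1r.
have -> : \sum_(a <- boxseq n) (\sum_(k < K') lcoef (L k) a) * monomial h a =
    \sum_(k < K') lev [seq t : C * mi <- L k | t.2 \in boxseq n] h.
  under eq_bigr do rewrite mulr_suml.
  rewrite exchange_big/=; apply: eq_bigr => k _.
  by rewrite lcoef_lev ?boxseq_uniq.
rewrite -sumrB; apply: le_trans (cn_sum _ _ _) (le_trans _ KP).
apply: le_trans (_ : S K' - S K <= _); last by rewrite lerD2r Sle.
rewrite /S -!(big_mkord xpredT (fun k => lnorm r (L k))) (big_cat_nat (leq0n K) KK')//=.
rewrite addrAC subrr add0r.
rewrite -(big_mkord xpredT (fun k => cn (lev (L k) h -
  lev [seq t : C * mi <- L k | t.2 \in boxseq n] h))) (big_cat_nat (leq0n K) KK')//=.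
rewrite [X in X + _]big_nat big1 ?add0r => [|k kK].
  apply: ler_sum => k _; rewrite (lev_filter_split h (L k) (mem (boxseq n))).
  rewrite addrAC subrr add0r.
  rewrite (lnorm_filter_split r (L k) (mem (boxseq n))).
  apply: le_trans (lev_norm _ r0' hr) _.
  by rewrite lerDr lnorm_ge0.
rewrite (_ : [seq _ <- _ | _] = L k) ?subrr ?cn0//; apply/all_filterP/allP => t tL.
apply: (boxseq_le nn); apply: n0P; apply/mapP; exists t => //.
by apply/flattenP; exists (L k) => //; apply: map_f; rewrite mem_iota.
Qed.

(** [X^n - 1] splits over an algebraically closed field and is separable; among its [n] distinct
    roots one is primitive. *)
Lemma prim_root_exists n : (0 < n)%N -> exists z : C, n.-primitive_root z.
Proof.
pose p : {poly C} := 'X^n - 1; have [s Dp] := closed_field_poly_normal p.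
move=> n_gt0; rewrite (monicP _) ?monicXnsubC// scale1r in Dp.
have sn1 : all n.-unity_root s by apply/allP=> z; rewrite -root_prod_XsubC -Dp.
have sz_s : (n < (size s).+1)%N.
  by rewrite -(size_prod_XsubC s id) -Dp size_XnsubC.
have [|z] := hasP (cyclic.has_prim_root n_gt0 sn1 _ sz_s); last by exists z.
by rewrite -separable_prod_XsubC -Dp separable_Xn_sub_1// pnatr_eq0 -lt0n.
Qed.

Lemma sum_powers_unity n (w : C) : w ^+ n = 1 -> w != 1 ->
  \sum_(s < n) w ^+ s = 0.
Proof.
move=> wn w1; apply: (mulfI (_ : w - 1 != 0)); first by rewrite subr_eq0.
by rewrite mulr0 -subrX1 wn subrr.
Qed.

(* Averaging against the characters of the n-th roots of unity keeps only the
   coefficients congruent to [a] modulo [n]. *)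
Lemma cauchy_estimate r c f M K a : 0 < r -> expansion r c f M ->
  (forall h, polydisc r h -> cn (f h) <= K) -> cn (c a) * r ^+ deg a <= K.
Proof.
move=> r0 [cM cf] fK; have r0' := ltW r0.
pose S n := \sum_(b <- boxseq n) cn (c b) * r ^+ deg b.
have Smon n k : (n <= k)%N -> S k - S n =
    \sum_(b <- boxseq k | b \notin boxseq n) cn (c b) * r ^+ deg b.
  by move=> nk; rewrite /S (boxseq_split _ nk) addrAC subrr add0r.
have [l [Sl _ Sle]] : exists l, [/\ S n @[n --> \oo] --> l, l <= M &
    forall n, S n <= l].
  apply: monotone_bounded_cvg => // n; rewrite -subr_ge0 Smon//.
  by apply: sumr_ge0 => b _; rewrite mulr_ge0 ?cn_ge0 ?exprn_ge0.
have [n0 an0] : exists n0, forall i, (a i < n0)%N.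
  by exists (\max_i a i).+1 => i; rewrite ltnS leq_bigmax.
have Kl : K + (l - S n) @[n --> \oo] --> K.
  rewrite -[X in _ --> X]addr0 -[X in K + X](subrr l); apply: cvgD.
    exact: cvg_cst.
  by apply: cvgB => //; exact: cvg_cst.
(* The average over a grid of n-th roots of unity equals the wanted term up to coefficients outside
   the box of side [n], whose l1 mass is at most l - S n. Letting [n] grow removes this aliasing
   error. *)
suff main n : (n0 <= n)%N -> (0 < n)%N -> cn (c a) * r ^+ deg a <= K + (l - S n).
  have /cvgrPdist_le H := Kl; apply/ler_addgt0Pr => e /H [N _ NP].
  pose n := (maxn N n0).+1.
  apply: le_trans (main n _ _) _ => //; first by rewrite ltnW// ltnS leq_maxr.
  have := NP n; rewrite /= ltnW ?ltnS ?leq_maxl// => /(_ isT).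
  by rewrite opprD addrA subrr add0r normrN => /(le_trans (ler_norm _)); rewrite lerD2l.
move=> n0n n_gt0; have [z zP] := prim_root_exists n_gt0.
have an i : (a i < n)%N := leq_trans (an0 i) n0n.
have zn := prim_expr_order zP.
have z1 : cn z = 1.
  by apply/eqP; rewrite -(pexpr_eq1 n_gt0 (cn_ge0 _)) -cnX zn cn1.
have z0 : z != 0 by rewrite -cn_eq0 z1 oner_neq0.
pose pt (t : {ffun 'I_m -> 'I_n}) : 'rV[C]_m := \row_i (r%:C%C * z ^+ t i).
have ptr t : polydisc r (pt t).
  by move=> i; rewrite mxE cnM cn_real cnX z1 expr1n mulr1 ger0_norm.
pose ch (t : {ffun 'I_m -> 'I_n}) : C := \prod_i (z ^+ a i) ^- t i.
have cnch t : cn (ch t) = 1.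
  rewrite /ch cn_prod big1// => i _; by rewrite cnV !cnX z1 !expr1n invr1.
pose q : C := (n%:R ^+ m)^-1.
have cnn : cn (n%:R : C) = n%:R.
  by rewrite -[n%:R]/(1 *+ n) normcMn cn1.
have qn : cn q * (n%:R ^+ m) = 1.
  by rewrite /q cnV cnX cnn mulVf// expf_neq0// pnatr_eq0 -lt0n.
pose u N := q * \sum_t (\sum_(b <- boxseq N) c b * monomial (pt t) b) * ch t.
have cardf : #|{ffun 'I_m -> 'I_n}|%:R = n%:R ^+ m :> R.
  by rewrite card_ffun !card_ord natrX.
pose A := q * \sum_t f (pt t) * ch t.
have uA : clim u A.
  apply: climZ; apply: (@clim_sum _ _ _ (fun t N =>
    (\sum_(b <- boxseq N) c b * monomial (pt t) b) * ch t)) => t.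
  by apply: climM; [exact: cf|exact: clim_cst].
have AK : cn A <= K.
  rewrite cnM; apply: le_trans (_ : cn q * (n%:R ^+ m * K) <= _); last first.
    by rewrite mulrA qn mul1r.
  rewrite ler_wpM2l ?cn_ge0//; apply: le_trans (cn_sum _ _ _) _.
  rewrite -cardf mulr_natl -sumr_const; apply: ler_sum => t _.
  by rewrite cnM cnch mulr1 fK.
have orth (b : mi) : q * \sum_t monomial (pt t) b * ch t =
    r%:C%C ^+ deg b * \prod_i (n%:R^-1 * \sum_(s < n) (z ^+ b i / z ^+ a i) ^+ s).
  rewrite big_split/= prodr_const card_ord exprVn mulrCA; congr (_ * _).
  rewrite bigA_distr_bigA/= mulr_sumr; apply: eq_bigr => t _.
  rewrite /monomial /ch -big_split/= /deg -prodrXr -big_split/=.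
  apply: eq_bigr => i _; rewrite mxE exprMn -mulrA; congr (_ * _).
  by rewrite exprMn exprVn -!exprM mulnC.
have orth1 : r%:C%C ^+ deg a * \prod_i (n%:R^-1 * \sum_(s < n) (z ^+ a i / z ^+ a i) ^+ s)
    = r%:C%C ^+ deg a.
  rewrite big1 ?mulr1// => i _; under eq_bigr do rewrite divff ?expf_neq0// expr1n.
  by rewrite sumr_const card_ord mulVf// pnatr_eq0 -lt0n.
(* Outside the box the characters may coincide with that of [a], so only the bound 1 is available
   there. *)
have orth_le (b : mi) :
    cn (\prod_i (n%:R^-1 * \sum_(s < n) (z ^+ b i / z ^+ a i) ^+ s)) <= 1.
  rewrite cn_prod; apply: prodr_ile1 => i _; rewrite cn_ge0/= cnM cnV cnn.
  rewrite mulrC ler_pdivrMr ?ltr0n// mul1r; apply: le_trans (cn_sum _ _ _) _.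
  apply: le_trans (_ : \sum_(s < n) 1 <= _).
    by apply: ler_sum => s _; rewrite cnX cnM cnV !cnX z1 !expr1n invr1 mulr1 expr1n.
  by rewrite sumr_const card_ord.
have orth0 (b : mi) : b \in boxseq n -> b != [ffun i => a i] ->
    \prod_i (n%:R^-1 * \sum_(s < n) (z ^+ b i / z ^+ a i) ^+ s) = 0 :> C.
  rewrite mem_boxseq => /forallP bn ba.
  have [i bi] : exists i, b i != a i.
    apply: contrapT => H; case/eqP: ba; apply/ffunP => i; rewrite ffunE.
    by apply/eqP/negPn/negP => bi; apply: H; exists i.
  rewrite (bigD1 i)//= sum_powers_unity ?mulr0 ?mul0r//.
    by rewrite exprMn exprVn -!exprM ![(_ * n)%N]mulnC !exprM zn !expr1n divr1.
  apply/negP => /eqP /(congr1 (fun x => x * z ^+ a i)).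
  rewrite divfK ?expf_neq0// mul1r => /eqP.
  by rewrite (eq_prim_root_expr zP) !modn_small// (negPf bi).
have cA : cn (A - c a * r%:C%C ^+ deg a) <= l - S n.
  apply: (clim_near_le uA (N := n)) => N nN.
  have -> : u N = \sum_(b <- boxseq N) c b * (r%:C%C ^+ deg b *
      \prod_i (n%:R^-1 * \sum_(s < n) (z ^+ b i / z ^+ a i) ^+ s)).
    rewrite /u; under eq_bigr do rewrite mulr_suml.
    rewrite exchange_big/= mulr_sumr; apply: eq_bigr => b _.
    rewrite -orth [RHS]mulrCA; congr (_ * _); rewrite mulr_sumr.
    by apply: eq_bigr => t _; rewrite mulrA.
  rewrite (boxseq_split _ nN).
  pose a' : mi := [ffun i => a i].
  have a'E : a' = a :> ('I_m -> nat) by apply/funext => i; rewrite ffunE.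
  have aE : \sum_(b <- boxseq n) c b * (r%:C%C ^+ deg b *
      \prod_i (n%:R^-1 * \sum_(s < n) (z ^+ b i / z ^+ a i) ^+ s)) =
      c a * r%:C%C ^+ deg a.
    rewrite (bigD1_seq a') ?boxseq_uniq//=; last first.
      by rewrite mem_boxseq; apply/forallP => i; rewrite ffunE.
    rewrite a'E.
    rewrite orth1 big_seq_cond big1 ?addr0// => b /andP[bn ba].
    by rewrite orth0// !mulr0.
  rewrite aE addrAC subrr add0r; apply: le_trans (cn_sum _ _ _) _.
  apply: le_trans (_ : S N - S n <= _); last by rewrite lerD2r Sle.
  rewrite Smon//; apply: ler_sum => b _; rewrite !cnM cnX cn_real ger0_norm//.
  by rewrite ler_wpM2l ?cn_ge0// ler_piMr ?exprn_ge0.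
have -> : cn (c a) * r ^+ deg a = cn (c a * r%:C%C ^+ deg a).
  by rewrite cnM cnX cn_real ger0_norm.
rewrite -[X in cn X](subKr A); apply: le_trans (cnD _ _) _; rewrite cnN.
exact: lerD.
Qed.

End coefficients.

(** * Between analyticity and majorized series *)

Section import_export.
Context {R : realType} {m : nat}.
Local Notation C := R[i].

Lemma polydisc_near (x0 : 'rV[C : numFieldType]_m) (P : 'rV[C]_m -> Prop) :
  (\forall x \near x0, P x) ->
  exists2 r : R, 0 < r & forall h, polydisc r h -> P (x0 + h).
Proof.
move=> /nbhs_ballP[e /= e0 eP].
have [e1 e2] : e = (complex.Re e)%:C%C /\ 0 < complex.Re e.
  move: e0; rewrite ltcE/= => /andP[/eqP e1 e2].
  by split=> //; case: e e1 {eP e2} => a b /= ->.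
exists (complex.Re e / 2); first by rewrite divr_gt0.
move=> h hr; apply: eP; split=> // i j; rewrite -ball_normE /ball_ /= ord1 !mxE.
rewrite opprD addrA subrr add0r normrN normr_cn e1 ltcR.
by apply: le_lt_trans (hr j) _; rewrite ltr_pdivrMr// ltr_pMr// ltr1n.
Qed.

(** Absolute convergence at the corner with all coordinates [r] already bounds the l1-norm on the
    polydisc of radius [r]. *)
Lemma analytic_majorized (g : 'rV[C]_m -> C) (x0 : 'rV[C]_m) :
  analytic_at (g : _ -> C^o) x0 ->
  exists2 r : R, 0 < r & exists M, majorized r (fun h => g (x0 + h)) M.
Proof.
move=> [c /polydisc_near[r r0 H]]; exists r => //.
have r0' := ltW r0.
have [|[M' HM] _] := H (const_mx r%:C%C).
  by move=> i; rewrite mxE cn_real ger0_norm.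
have hM n : \sum_(a <- boxseq n) cn (c a) * r ^+ deg a <= complex.Re M'.
  have := HM n; rewrite box_sumE lecE => /andP[_]; apply: le_trans.
  rewrite le_eqVlt; apply/orP; left; apply/eqP.
  have ReD : {morph (@complex.Re R) : x y / x + y} by case=> ? ? [].
  rewrite (big_morph _ ReD (erefl : complex.Re (0 : C) = 0)).
  apply: eq_bigr => a _.
  rewrite addrC addKr normrM !normr_cn -rmorphM/= mulrC; congr (_ * _).
  rewrite /monomial /deg cn_prod -prodrXr; apply: eq_bigr => i _.
  by rewrite mxE cnX cn_real ger0_norm.
exists (complex.Re M'); apply: (@expansion_majorized _ _ _ c) => //; split=> // h hr.
have [_ /cvgrPdist_le cv] := H h hr; apply/climP => e e0.
have [|N _ NP] := cv e%:C%C; first by rewrite ltcR.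
exists N => n /NP /=; rewrite box_sumE normr_cn lecR cnB [x0 + h]addrC addrK.
apply: le_trans; rewrite le_eqVlt; apply/orP; left; apply/eqP; congr (cn (_ - _)).
by apply: eq_bigr => a _; rewrite mulrC.
Qed.

(** The sum factors into [m] geometric sums, each at most 2. *)
Lemma box_geometric_le n : \sum_(a <- @boxseq m n) (2^-1 : R) ^+ deg a <= 2 ^+ m.
Proof.
rewrite -(box_sumE (fun a => (2^-1 : R) ^+ deg a)) /box_sum.
under eq_bigr do rewrite /deg -prodrXr.
rewrite -(bigA_distr_bigA (fun (i : 'I_m) (s : 'I_n) => (2^-1 : R) ^+ s)).
rewrite prodr_const card_ord lerXn2r// ?nnegrE ?ler0n//.
  by apply: sumr_ge0 => s _; rewrite exprn_ge0.
rewrite geometric_partial ?lt_eqF//; last by rewrite invf_lt1 ?ltr1n.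
rewrite ler_pdivrMr ?subr_gt0 ?invf_lt1 ?ltr1n//.
rewrite mulrBr mulr1 divff// (_ : 2 - 1 = 1); last by ring.
by rewrite gerBl exprn_ge0.
Qed.

(* The last hypothesis expresses that the norm is lower semicontinuous for the
   (weak) sense in which [v] is the sum of the series. *)
Lemma power_series_of_bound (V : normedModType R) (c : ('I_m -> nat) -> V)
    (K r : R) (h : 'rV[R]_m) (v : V) : 0 < r ->
  (forall a, `|c a| * r ^+ deg a <= K) -> (forall i, `|h 0 i| <= r / 2) ->
  (forall n M, (forall N, (n <= N)%N ->
      `|\sum_(a <- boxseq N) monomial h a *: c a -
        \sum_(a <- boxseq n) monomial h a *: c a| <= M) ->
    `|v - \sum_(a <- boxseq n) monomial h a *: c a| <= M) ->
  power_series_sum c h v.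
Proof.
move=> r0 cK hr lsc.
have K0 : 0 <= K.
  by apply: le_trans (cK (fun=> 0%N)); rewrite mulr_ge0 ?exprn_ge0// ltW.
have tK (a : {ffun 'I_m -> nat}) : `|monomial h a *: c a| <= K * 2^-1 ^+ deg a.
  rewrite normrZ; apply: le_trans (_ : (r / 2) ^+ deg a * `|c a| <= _).
    rewrite ler_wpM2r// /monomial normr_prod /deg -prodrXr.
    apply: ler_prod => i _; rewrite normr_ge0 normrX/=.
    by apply: lerXn2r; rewrite ?nnegrE ?hr//; apply: divr_ge0 => //; exact: ltW.
  by rewrite exprMn mulrAC mulrC mulrC [_ * `|c a|]mulrC ler_wpM2r ?exprn_ge0.
pose T n := \sum_(a <- @boxseq m n) K * 2^-1 ^+ deg a.
have Tsplit n k : (n <= k)%N -> T k - T n =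
    \sum_(a <- @boxseq m k | a \notin boxseq n) K * 2^-1 ^+ deg a.
  by move=> nk; rewrite /T (boxseq_split _ nk) addrAC subrr add0r.
have [l [Tl _ Tle]] : exists l, [/\ T n @[n --> \oo] --> l, l <= K * 2 ^+ m &
    forall n, T n <= l].
  apply: monotone_bounded_cvg => n.
    rewrite -subr_ge0 Tsplit//; apply: sumr_ge0 => a _.
    by rewrite mulr_ge0 ?exprn_ge0.
  by rewrite /T -mulr_sumr ler_wpM2l ?box_geometric_le.
split.
  exists l => n; rewrite box_sumE; apply: le_trans (Tle n).
  by apply: ler_sum => a _; exact: tK.
have vT n : `|v - \sum_(a <- boxseq n) monomial h a *: c a| <= l - T n.
  apply: lsc => N nN; rewrite (boxseq_split _ nN) addrAC subrr add0r.
  apply: le_trans (ler_norm_sum _ _ _) _.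
  apply: le_trans (_ : T N - T n <= _); last by rewrite lerD2r.
  by rewrite Tsplit//; apply: ler_sum => a _; exact: tK.
apply/cvgrPdist_le => e e0; have /cvgrPdist_le /(_ e e0) [N _ NP] := Tl.
exists N => // n /NP /=; rewrite box_sumE ger0_norm ?subr_ge0//.
exact: le_trans.
Qed.

End import_export.

(** * Contraction of oscillations *)

Section dobrushin.
Context {R : realType} {m B : nat}.
Local Notation C := R[i].
Local Notation RC := (real_complex R).
Implicit Types (r : R) (p q kap : 'I_B -> R) (X : 'I_B -> 'rV[C]_m -> C).

(** Without the common part [kap] both weights have mass 1 - k. The difference of the averages is (1
    - k)^-1 times the sum of a_j b_l (X_j - X_l), which involves only differences and has total
    weight 1 - k. *)
Lemma dobrushin_average r p q kap k X D : 0 <= r -> k < 1 ->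
  (forall j, kap j <= p j) -> (forall j, kap j <= q j) ->
  \sum_j p j = 1 -> \sum_j q j = 1 -> \sum_j kap j = k ->
  (forall i j, majorized r (fun h => X i h - X j h) D) ->
  majorized r (fun h => \sum_j RC (p j) * X j h - \sum_j RC (q j) * X j h)
    ((1 - k) * D).
Proof.
move=> r0 k1 kp kq p1 q1 kk XD; have k1' : 1 - k != 0 by rewrite subr_eq0 gt_eqF.
pose a j := p j - kap j; pose b j := q j - kap j.
have a1 : \sum_j a j = 1 - k by rewrite sumrB p1 kk.
have b1 : \sum_j b j = 1 - k by rewrite sumrB q1 kk.
have H := majorizedZ (RC (1 - k)^-1) r0 (@majorized_sum _ _ r _ (index_enum _) xpredT
  (fun j h => \sum_l RC (a j * b l) * (X j h - X l h))
  (fun j => \sum_l cn (RC (a j * b l)) * D) r0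
  (fun j _ => majorized_sum _ r0 (fun l _ => majorizedZ _ r0 (XD j l)))).
have -> : (1 - k) * D = cn (RC (1 - k)^-1) *
    (\sum_j \sum_l cn (RC (a j * b l)) * D).
  under eq_bigr => j _.
    under eq_bigr => l _ do rewrite cn_real ger0_norm ?mulr_ge0 ?subr_ge0//.
    rewrite -mulr_suml -mulr_sumr b1. over.
  rewrite -mulr_suml -mulr_suml a1 cn_real ger0_norm ?invr_ge0 ?subr_ge0 ?ltW//.
  by rewrite !mulrA mulVf// mul1r.
apply: majorized_ext H => h _.
have RCs (f : 'I_B -> R) : RC (\sum_j f j) = \sum_j RC (f j) by rewrite rmorph_sum.
have -> : \sum_j \sum_l RC (a j * b l) * (X j h - X l h) =
    RC (1 - k) * (\sum_j RC (a j) * X j h - \sum_l RC (b l) * X l h).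
  rewrite mulrBr -{1}b1 -a1 !RCs !big_distrlr/= [X in _ = X - _]exchange_big/=.
  rewrite -sumrB; apply: eq_bigr => j _; rewrite -sumrB; apply: eq_bigr => l _.
  by rewrite rmorphM/=; ring.
rewrite mulrA -rmorphM mulVf// rmorph1 mul1r -!sumrB; apply: eq_bigr => j _.
by rewrite /a /b !rmorphB/=; ring.
Qed.

(** [W] is the stochastic [P] plus an error whose rows sum to 0, so the error also sees only
    differences of [X] and costs 2 B E. The second conclusion compares new values with old ones; it
    is what makes the iterates a Cauchy sequence. *)
Lemma dobrushin_step r (P : 'I_B -> 'I_B -> R) kap k E D
    (W : 'I_B -> 'I_B -> 'rV[C]_m -> C) X : 0 <= r -> k < 1 ->
  (forall i j, 0 <= P i j) -> (forall i j, kap j <= P i j) ->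
  (forall i, \sum_j P i j = 1) -> \sum_j kap j = k ->
  (forall i j, majorized r (fun h => W i j h - RC (P i j)) E) ->
  (forall i h, polydisc r h -> \sum_j W i j h = 1) ->
  (forall i j, majorized r (fun h => X i h - X j h) D) ->
  forall i l,
  majorized r (fun h => \sum_j W i j h * X j h - \sum_j W l j h * X j h)
    ((1 - k + 2 * B%:R * E) * D) /\
  majorized r (fun h => \sum_j W i j h * X j h - X l h) ((1 + B%:R * E) * D).
Proof.
move=> r0 k1 P0 kP P1 kk WE W1 XD i l; split.
  have H1 := dobrushin_average r0 k1 (kP i) (kP l) (P1 i) (P1 l) kk XD.
  have H2 := @majorized_sum _ _ r _ (index_enum _) xpredT
    (fun j h => ((W i j h - RC (P i j)) - (W l j h - RC (P l j))) * (X j h - X i h))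
    (fun j => (E + E) * D) r0
    (fun j _ => majorizedM r0 (majorizedB r0 (WE i j) (WE l j)) (XD j i)).
  rewrite sumr_const card_ord -[_ *+ B]mulr_natl in H2.
  have := majorizedD H1 H2.
  have -> : (1 - k) * D + B%:R * ((E + E) * D) = (1 - k + 2 * B%:R * E) * D.
    by ring.
  apply: majorized_ext => h hr.
  have S0 : \sum_j ((W i j h - RC (P i j)) - (W l j h - RC (P l j))) = 0.
    by rewrite !sumrB -!rmorph_sum !P1 !W1// subrr.
  under [X in _ + X = _]eq_bigr do rewrite mulrBr.
  rewrite [X in _ + X]sumrB -[X in _ + (_ - X)]mulr_suml S0 mul0r subr0.
  by rewrite -!sumrB -big_split/=; apply: eq_bigr => j _; ring.
have H := @majorized_sum _ _ r _ (index_enum _) xpredT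
    (fun j h => (RC (P i j) + (W i j h - RC (P i j))) * (X j h - X l h))
    (fun j => (cn (RC (P i j)) + E) * D) r0
    (fun j _ => majorizedM r0
      (majorizedD (majorized_cst (RC (P i j)) r0) (WE i j)) (XD j l)).
have E1 : \sum_(j < B) (cn (RC (P i j)) + E) * D = (1 + B%:R * E) * D.
  rewrite -mulr_suml big_split/= sumr_const card_ord -[_ *+ B]mulr_natl.
  by under eq_bigr => j _ do rewrite cn_real ger0_norm//; rewrite P1.
rewrite E1 in H; apply: majorized_ext H => h hr.
rewrite -[X in _ = _ - X]mul1r -(W1 i h hr) mulr_suml -sumrB.
by apply: eq_bigr => j _; ring.
Qed.

End dobrushin.

(** * Word products, row sums and normalized rows *)

Section word_products.
Context {K : fieldType} {A B : nat} (Phi : 'I_B -> 'I_A.+1).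
Implicit Types (M : 'M[K]_B) (s t : seq 'I_A.+1).

(** Letters are read from the oldest. For a stochastic matrix, [rsum] is the probability of emitting
    [s] after the state [i], and [nrow] is the law of the last state given that this happens. *)
Definition wprod M s : 'M[K]_B :=
  foldr (fun a P => col_restrict Phi M a *m P) 1%:M s.

Definition rsum M s i : K := \sum_j wprod M s i j.

Definition nrow M s i j : K := wprod M s i j / rsum M s i.

Lemma wprod_cat M s t : wprod M (s ++ t) = wprod M s *m wprod M t.
Proof. by elim: s => [|a s ih] /=; rewrite ?mul1mx// ih mulmxA. Qed.

Lemma rsum_nil M i : rsum M [::] i = 1.
Proof.
rewrite /rsum (bigD1 i)//= mxE eqxx big1 ?addr0// => j ji.
by rewrite mxE eq_sym (negPf ji).
Qed.

Lemma rsum_cons M a s i :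
  rsum M (a :: s) i = \sum_j col_restrict Phi M a i j * rsum M s j.
Proof.
rewrite /rsum; under eq_bigr do rewrite /= mxE.
rewrite exchange_big/=; apply: eq_bigr => j _; by rewrite mulr_sumr.
Qed.

Lemma nrow_nil M i j : nrow M [::] i j = (i == j)%:R.
Proof. by rewrite /nrow rsum_nil divr1 /= mxE. Qed.

(** The first transition of the chain conditioned to emit [a :: s], a Doob transform of the letter
    matrix. *)
Definition step_weight M a s i j : K :=
  col_restrict Phi M a i j * rsum M s j / rsum M (a :: s) i.

Lemma step_weight_sum M a s i : rsum M (a :: s) i != 0 ->
  \sum_j step_weight M a s i j = 1.
Proof. by move=> nz; rewrite -mulr_suml -rsum_cons divff. Qed.

Lemma nrow_cons M a s i j : (forall l, rsum M s l != 0) ->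
  nrow M (a :: s) i j = \sum_l step_weight M a s i l * nrow M s l j.
Proof.
move=> nz; rewrite /nrow /= mxE mulr_suml; apply: eq_bigr => l _.
by rewrite /step_weight -[LHS]mulr1 -(divff (nz l)); ring.
Qed.

End word_products.

(** * Perturbed word products, uniformly in the length of the word *)

Section backward_products.
Context {R : realType} {m A B : nat} (Phi : 'I_B -> 'I_A.+1).
Local Notation C := R[i].
Local Notation RC := (real_complex R).
(** [c] bounds the nonzero entries at eps_0 from below, [delta] is the size of the perturbation,
    [tau] the tolerance on ratios of row sums, and [eta] the total effect of the perturbation on one
    step. *)
Context (r c delta tau eta : R) (D0 : 'M[R]_B) (Dh : 'rV[C]_m -> 'M[C]_B).
Context (r0 : 0 <= r) (c0 : 0 < c) (c1 : c < 1) (B0 : (0 < B)%N).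
Context (D0_ge0 : forall i j, 0 <= D0 i j) (D0_le1 : forall i j, D0 i j <= 1).
Context (D0_row : forall i, \sum_j D0 i j = 1).
Context (D0_col : forall j, (forall i, D0 i j = 0) \/ (forall i, c <= D0 i j)).
Context (D0_pos : forall a, exists2 j, Phi j = a & forall i, c <= D0 i j).
Context (Dh_near :
  forall i j, majorized r (fun h => Dh h i j - RC (D0 i j)) delta).
Context (delta0 : 0 <= delta) (tau0 : 0 < tau) (tauB : 32 * B%:R * tau <= c ^+ 2).
Context (eta_ge : B%:R * (delta / c ^+ 2 * (1 + tau)) <= eta).
Context (eta_le : eta <= c ^+ 2 * tau / 8).

Local Notation q0 := (rsum Phi D0).
Local Notation P0 := (step_weight Phi D0).

(** Entries of one column are all 0 or all between [c] and 1, hence comparable up to 1 / c; the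
    comparison passes to the row sums of every word. Positivity comes from the positive column of
    each letter. *)
Lemma base_rsum s :
  (forall i, 0 < q0 s i) /\ (forall i l, q0 s i <= q0 s l / c).
Proof.
elim: s => [|a s [ih1 ih2]].
  by split=> [i|i l]; rewrite !rsum_nil// mul1r invf_ge1// ltW.
have cr0 i j : 0 <= col_restrict Phi D0 a i j by rewrite mxE; case: ifP.
split=> [i|i l]; rewrite !rsum_cons.
  have [j ja jc] := D0_pos a; rewrite (bigD1 j)//=; apply: ltr_wpDr.
    by apply: sumr_ge0 => l _; rewrite mulr_ge0// ltW.
  by rewrite mulr_gt0// mxE ja eqxx (lt_le_trans c0).
rewrite mulr_suml; apply: ler_sum => j _; rewrite mulrAC ler_wpM2r//; first exact: ltW.
rewrite !mxE; case: ifP; last by rewrite mul0r.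
have [j0|jc] := D0_col j; first by rewrite !j0 mul0r.
by move=> _; rewrite ler_pdivlMr//; apply: le_trans _ (jc l); rewrite ler_piMl// ltW.
Qed.

Lemma base_rsum_gt0 s i : 0 < q0 s i. Proof. by have [] := base_rsum s. Qed.

Lemma base_rsum_ge0 s i : 0 <= q0 s i. Proof. exact/ltW/base_rsum_gt0. Qed.

(** One factor [c] is an entry of a positive column, the other the comparison of row sums. *)
Lemma base_rsum_lower a s i j : c ^+ 2 * q0 s j <= q0 (a :: s) i.
Proof.
have [l la lc] := D0_pos a; rewrite rsum_cons (bigD1 l)//= -[leLHS]addr0.
apply: lerD; last first.
  apply: sumr_ge0 => ? _; rewrite mulr_ge0 ?base_rsum_ge0// mxE.
  by case: ifP.
rewrite mxE la eqxx; apply: le_trans (_ : c * q0 s l <= _).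
  rewrite expr2 -mulrA ler_wpM2l ?(ltW c0)// mulrC -ler_pdivlMr//.
  by have [_] := base_rsum s; apply.
by rewrite ler_wpM2r ?base_rsum_ge0.
Qed.

Lemma base_weight_ge0 a s i j : 0 <= P0 a s i j.
Proof.
rewrite /step_weight divr_ge0 ?mulr_ge0 ?base_rsum_ge0//.
by rewrite mxE; case: ifP.
Qed.

Lemma base_weight_sum a s i : \sum_j P0 a s i j = 1.
Proof. by apply: step_weight_sum; rewrite gt_eqF ?base_rsum_gt0. Qed.

Lemma base_weight_le1 a s i j : P0 a s i j <= 1.
Proof.
rewrite -(base_weight_sum a s i) (bigD1 j)//= lerDl.
by apply: sumr_ge0 => l _; exact: base_weight_ge0.
Qed.

(** All the mass is put on one state [l] with a positive column: the numerator of the weight is at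
    least c q(l), and the denominator at most an average of values q(j) <= q(l) / c. *)
Lemma base_weight_minorization a s : exists kap : 'I_B -> R,
  (forall i j, kap j <= P0 a s i j) /\ \sum_j kap j = c ^+ 2.
Proof.
have [l la lc] := D0_pos a.
exists (fun j => if j == l then c ^+ 2 else 0); split=> [i j|]; last first.
  by rewrite -big_mkcond big_pred1_eq.
case: eqP => [->|_]; last exact: base_weight_ge0.
rewrite /step_weight ler_pdivlMr ?base_rsum_gt0// mxE la eqxx.
apply: le_trans (_ : c * q0 s l <= _); last first.
  by rewrite ler_wpM2r ?base_rsum_ge0.
rewrite expr2 -mulrA ler_wpM2l ?(ltW c0)// mulrC -ler_pdivlMr// rsum_cons.
rewrite -[leRHS]mul1r -(D0_row i) mulr_suml; apply: ler_sum => l' _.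
apply: le_trans (_ : D0 i l' * q0 s l' <= _).
  by rewrite ler_wpM2r ?base_rsum_ge0// mxE; case: ifP.
by rewrite ler_wpM2l//; have [_] := base_rsum s; apply.
Qed.

Let B1 : 1 <= B%:R :> R. Proof. by rewrite ler1n. Qed.

Let k1 : c ^+ 2 < 1. Proof. by rewrite expr_lt1 ?ltW. Qed.
Let k0 : 0 < c ^+ 2. Proof. exact: exprn_gt0. Qed.

Let d := delta / c ^+ 2 * (1 + tau).

Let d0 : 0 <= d.
Proof. by rewrite /d mulr_ge0 ?divr_ge0 ?addr_ge0 ?(ltW k0) ?(ltW tau0). Qed.

Let d_eta : d <= eta.
Proof. by apply: le_trans eta_ge; rewrite ler_peMl. Qed.

Let eta0 : 0 <= eta. Proof. exact: le_trans d_eta. Qed.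

Let tau_le : 32 * tau <= c ^+ 2.
Proof. by apply: le_trans tauB; rewrite ler_wpM2r ?(ltW tau0)// ler_peMr. Qed.

Let te1 : tau + eta < 1.
Proof.
have : c ^+ 2 * tau <= tau by rewrite ler_piMl ?(ltW tau0)// ltW.
by move: tau_le k1 eta_le tau0; move: (c ^+ 2) => k *; lra.
Qed.

(** This closes the induction on words: averaging gains c^2 on the oscillation tau (1 + tau), each
    of the two rows adds an error [eta], and the division is by a quantity within tau + eta of 1. *)
Let contraction_bound :
  ((1 - c ^+ 2) * (tau * (1 + tau)) + (eta + eta)) * (1 - (tau + eta))^-1 <= tau.
Proof.
rewrite ler_pdivrMr ?subr_gt0 ?te1//.
move: tau_le k1 eta_le tau0 eta0 k0; move: (c ^+ 2) => k tk k1' ek t0 e0 k0'.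
have e1 : eta * tau <= eta * (k / 32).
  by rewrite ler_wpM2l// ler_pdivlMr// mulrC.
have e2 : eta * k <= eta by rewrite ler_piMr// ltW.
have t2 : tau * tau <= tau * (k / 32).
  by rewrite ler_wpM2l ?(ltW t0)// ler_pdivlMr// mulrC.
have kt : 0 <= k * tau ^+ 2 by rewrite mulr_ge0 ?ltW// exprn_gt0.
have kt2 : 0 <= k * tau by rewrite mulr_ge0 ?ltW.
rewrite -subr_ge0.
rewrite (_ : _ - _ = k * tau + k * tau ^+ 2 - 2 * (tau * tau) - eta * tau - 2 * eta).
  by lra.
by ring.
Qed.

Let weight_bound : (tau + (tau + eta)) * (1 - (tau + eta))^-1 +
  d * (1 - (tau + eta))^-1 <= 4 * tau.
Proof.
rewrite -mulrDl ler_pdivrMr ?subr_gt0 ?te1//.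
move: tau_le k1 eta_le tau0 eta0 k0 d_eta; move: (c ^+ 2) => k tk k1' ek t0 e0 k0' de.
have kt : k * tau <= tau by rewrite ler_piMl ?ltW.
have t2 : tau * (tau + eta) <= tau * (1 / 4).
  by rewrite ler_wpM2l ?(ltW t0)//; lra.
rewrite mulrBr mulr1 -mulrA; lra.
Qed.

Let phi s i h : C := rsum Phi (Dh h) s i / RC (q0 s i).

(** Only ratios are controlled: [phi] itself may grow or decay geometrically with the length of the
    word. *)
Definition nearly_base s :=
  (forall h, polydisc r h -> forall i, rsum Phi (Dh h) s i != 0) /\
  (forall i l, majorized r (fun h => phi s i h / phi s l h - 1) tau).

Let RCq0 s i : RC (q0 s i) != 0.
Proof. by rewrite (fmorph_eq0 RC) gt_eqF// base_rsum_gt0. Qed.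

Lemma nearly_base_nil : nearly_base [::].
Proof.
split=> [h _ i|i l]; first by rewrite rsum_nil oner_neq0.
have := @majorized0 R m r tau r0 (ltW tau0); apply: majorized_ext => h _.
by rewrite /phi !rsum_nil rmorph1 !divr1 subrr.
Qed.

Section step.
Context (a : 'I_A.+1) (s : seq 'I_A.+1) (inv : nearly_base s) (k : 'I_B).

Let phi_neq0 h i : polydisc r h -> phi s i h != 0.
Proof. by move=> hr; rewrite mulf_neq0 ?invr_eq0 ?RCq0//; have [+ _] := inv; apply. Qed.

Let u j h : C := phi s j h / phi s k h - 1.

Let G i j h : C :=
  col_restrict Phi (Dh h) a i j * RC (q0 s j / q0 (a :: s) i).

Let F i j h : C := G i j h - RC (P0 a s i j).

(** By [phi_step], [1 + x i h] is the quotient of [phi (a :: s) i h] by [phi s k h], with [k] a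
    fixed reference state. The base weights average [u]; [F] carries the perturbation of the
    matrix. *)
Let x i h : C := \sum_j RC (P0 a s i j) * u j h + \sum_j F i j h * (1 + u j h).

Let uM j : majorized r (u j) tau. Proof. by have [_] := inv; apply. Qed.

Let u_osc i j : majorized r (fun h => u i h - u j h) (tau * (1 + tau)).
Proof.
have [_ iv] := inv.
have H1 := majorizedD (majorized_cst (1 : C) r0) (uM j); rewrite cn1 in H1.
apply: majorized_ext (majorizedM r0 (iv i j) H1) => h hr.
have -> : 1 + u j h = phi s j h / phi s k h by rewrite addrC subrK.
rewrite mulrBl mul1r mulrA divfK ?phi_neq0// /u; ring.
Qed.

Let FM i j : majorized r (F i j) (delta / c ^+ 2).
Proof.
have q_le : q0 s j / q0 (a :: s) i <= (c ^+ 2)^-1.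
  rewrite ler_pdivrMr ?base_rsum_gt0// ler_pdivlMl//.
  exact: base_rsum_lower.
have q_ge0 : 0 <= q0 s j / q0 (a :: s) i by rewrite divr_ge0 ?base_rsum_ge0.
have [ja|ja] := eqVneq (Phi j) a; last first.
  have dc : 0 <= delta / c ^+ 2 by rewrite divr_ge0// ltW.
  apply: majorized_ext (@majorized0 R m r _ r0 dc) => h _.
  by rewrite /F /G /step_weight !mxE (negPf ja) !mul0r rmorph0 subrr.
have := majorizedM r0 (Dh_near i j) (majorized_cst (RC (q0 s j / q0 (a :: s) i)) r0).
rewrite cn_real ger0_norm// => H; have {}H := majorized_le H (ler_wpM2l delta0 q_le).
apply: majorized_ext H => h _.
by rewrite /F /G /step_weight !mxE ja eqxx -mulrA [RC (D0 i j * _)]rmorphM/= mulrBl.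
Qed.

Let FuM i j : majorized r (fun h => F i j h * (1 + u j h)) d.
Proof.
have H1 := majorizedD (majorized_cst (1 : C) r0) (uM j); rewrite cn1 in H1.
exact: majorizedM.
Qed.

Let FusumM i : majorized r (fun h => \sum_j F i j h * (1 + u j h)) eta.
Proof.
have H := majorized_sum (index_enum _) r0 (fun j (_ : xpredT j) => FuM i j).
apply: majorized_le H _; rewrite sumr_const card_ord -[_ *+ B]mulr_natl.
exact: eta_ge.
Qed.

Let xM i : majorized r (x i) (tau + eta).
Proof.
apply: majorizedD; last exact: FusumM.
have := majorized_sum (index_enum _) r0
  (fun j (_ : xpredT j) => majorizedZ (RC (P0 a s i j)) r0 (uM j)).
rewrite (_ : \sum_(j < B) _ = tau)// -mulr_suml.
under eq_bigr => j _ do rewrite cn_real ger0_norm ?base_weight_ge0//.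
by rewrite base_weight_sum mul1r.
Qed.

Let x_osc i l : majorized r (fun h => x i h - x l h)
  ((1 - c ^+ 2) * (tau * (1 + tau)) + (eta + eta)).
Proof.
have [kap [kapP kap1]] := base_weight_minorization a s.
have H1 := dobrushin_average r0 k1 (kapP i) (kapP l) (base_weight_sum a s i)
  (base_weight_sum a s l) kap1 u_osc.
apply: majorized_ext (majorizedD H1 (majorizedB r0 (FusumM i) (FusumM l))) => h _.
by rewrite /x opprD addrACA.
Qed.

Let phi_step i h : polydisc r h -> phi (a :: s) i h = phi s k h * (1 + x i h).
Proof.
move=> hr; have uE j : 1 + u j h = phi s j h / phi s k h by rewrite addrC subrK.
have -> : 1 + x i h = \sum_j G i j h * (1 + u j h).
  rewrite /x addrA -{1}(rmorph1 RC) -(base_weight_sum a s i) rmorph_sum/=.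
  by rewrite -!big_split/=; apply: eq_bigr => j _; rewrite /F; ring.
rewrite mulr_sumr {1}/phi rsum_cons mulr_suml; apply: eq_bigr => j _.
rewrite uE mulrCA [phi s k h * _]mulrC divfK ?phi_neq0//.
rewrite /G /phi fmorph_div/= -[LHS]mulr1 -(divff (RCq0 s j)).
by ring.
Qed.

Let x_inv i : (forall h, polydisc r h -> 1 + x i h != 0) /\
  majorized r (fun h => (1 + x i h)^-1) (1 - (tau + eta))^-1.
Proof. exact: majorized_inv (xM i). Qed.

Lemma step_neq0 h i : polydisc r h -> rsum Phi (Dh h) (a :: s) i != 0.
Proof.
move=> hr; have := phi_step i hr; rewrite /phi => E.
have : rsum Phi (Dh h) (a :: s) i / RC (q0 (a :: s) i) != 0.
  by rewrite E mulf_neq0 ?phi_neq0//; have [+ _] := x_inv i; apply.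
by apply: contra_neq => ->; rewrite mul0r.
Qed.

(** The ratio minus 1 is (x_i - x_l) / (1 + x_l), whose numerator is small by averaging. *)
Lemma step_ratio i l :
  majorized r (fun h => phi (a :: s) i h / phi (a :: s) l h - 1) tau.
Proof.
have [xl0 xlM] := x_inv l.
have := majorized_le (majorizedM r0 (x_osc i l) xlM) contraction_bound.
apply: majorized_ext => h hr; rewrite !phi_step// -mulf_div divff ?phi_neq0// mul1r.
have nz := xl0 h hr; apply: (mulIf nz); rewrite [RHS]mulrBl !divfK//.
by ring.
Qed.

(** The conditioned kernel is G_ij (1 + u_j) / (1 + x_i). Its distance to the base weight P_ij
    splits as P_ij (u_j - x_i) / (1 + x_i) + F_ij (1 + u_j) / (1 + x_i), both of order [tau]. *)
Lemma step_weight_near i j :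
  majorized r (fun h => step_weight Phi (Dh h) a s i j - RC (P0 a s i j)) (4 * tau).
Proof.
have [xi0 xiM] := x_inv i.
have H1 : majorized r (fun h => RC (P0 a s i j) * (u j h - x i h)) (tau + (tau + eta)).
  have := majorizedZ (RC (P0 a s i j)) r0 (majorizedB r0 (uM j) (xM i)).
  move=> H; apply: majorized_le H _.
  rewrite cn_real ger0_norm ?base_weight_ge0// ler_piMl ?base_weight_le1//.
  by rewrite !addr_ge0 ?(ltW tau0).
have := majorizedD (majorizedM r0 H1 xiM) (majorizedM r0 (FuM i j) xiM).
move=> H; have := majorized_le H weight_bound; apply: majorized_ext => h hr.
have -> : step_weight Phi (Dh h) a s i j = G i j h * (1 + u j h) / (1 + x i h).
  have uE : 1 + u j h = phi s j h / phi s k h by rewrite addrC subrK.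
  have xE : 1 + x i h = phi (a :: s) i h / phi s k h.
    by rewrite phi_step// mulrC mulrA mulVf ?mul1r ?phi_neq0.
  rewrite uE xE /G fmorph_div.
  transitivity (step_weight Phi (Dh h) a s i j * (phi s k h / phi s k h) *
    (RC (q0 s j) / RC (q0 s j)) * (RC (q0 (a :: s) i) / RC (q0 (a :: s) i))).
    by rewrite !divff ?phi_neq0 ?RCq0// !mulr1.
  rewrite /step_weight /phi; field.
  by apply/and5P; split; [exact: RCq0|exact: inv.1|exact: RCq0|exact: step_neq0|
    exact: RCq0].
have nz := xi0 h hr; apply: (mulIf nz); rewrite [LHS]mulrDl [RHS]mulrBl !divfK//.
by rewrite /F; ring.
Qed.

End step.

Lemma all_nearly_base s : nearly_base s.
Proof.
elim: s => [|a s ih]; first exact: nearly_base_nil.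
split=> [h hr i|i l]; first exact: (step_neq0 _ ih i).
exact: (step_ratio _ ih i).
Qed.

Lemma rsum_neq0 s h i : polydisc r h -> rsum Phi (Dh h) s i != 0.
Proof. by move=> hr; have [+ _] := all_nearly_base s; apply. Qed.

(** The base kernel contracts by 1 - c^2; the error 8 B tau is at most c^2 / 4 by [tauB], so that at
    least half of the gain survives. *)
Let lam := 1 - c ^+ 2 / 2.

Lemma nrow_step a s j D :
  (forall i l, majorized r (fun h => nrow Phi (Dh h) s i j - nrow Phi (Dh h) s l j) D) ->
  forall i l,
  majorized r (fun h => nrow Phi (Dh h) (a :: s) i j - nrow Phi (Dh h) (a :: s) l j)
    (lam * D) /\
  majorized r (fun h => nrow Phi (Dh h) (a :: s) i j - nrow Phi (Dh h) s l j)
    (2 * D).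
Proof.
move=> sD i l; have D_ge0 := majorized_ge0 (sD i l).
have [kap [kapP kap1]] := base_weight_minorization a s.
have W1 i' h : polydisc r h -> \sum_j step_weight Phi (Dh h) a s i' j = 1.
  by move=> hr; apply: step_weight_sum; exact: rsum_neq0.
have [H1 H2] := dobrushin_step (W := fun i' j' h => step_weight Phi (Dh h) a s i' j')
  (X := fun i' h => nrow Phi (Dh h) s i' j)
  r0 k1 (base_weight_ge0 a s) kapP (base_weight_sum a s) kap1
  (step_weight_near _ (all_nearly_base s) i) W1 sD i l.
have consE i' h : polydisc r h -> nrow Phi (Dh h) (a :: s) i' j =
    \sum_l step_weight Phi (Dh h) a s i' l * nrow Phi (Dh h) s l j.
  by move=> hr; apply: nrow_cons => l'; exact: rsum_neq0.
have tB : B%:R * (4 * tau) <= c ^+ 2 / 8 by move: tauB; lra.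
split.
  apply: (@majorized_le _ _ _ _ ((1 - c ^+ 2 + 2 * B%:R * (4 * tau)) * D)); last first.
    by rewrite ler_wpM2r// /lam; move: tB k0; rewrite -mulrA; lra.
  by apply: majorized_ext H1 => h hr; rewrite !consE.
apply: (@majorized_le _ _ _ _ ((1 + B%:R * (4 * tau)) * D)); last first.
  by rewrite ler_wpM2r//; move: tB k1; lra.
by apply: majorized_ext H2 => h hr; rewrite !consE.
Qed.

Lemma nrow_osc s i l j :
  majorized r (fun h => nrow Phi (Dh h) s i j - nrow Phi (Dh h) s l j)
    (lam ^+ size s).
Proof.
elim: s i l => [|a s ih] i l.
  have H := @majorized_cst R m r ((i == j)%:R - (l == j)%:R) r0.
  apply: (@majorized_le _ _ _ _ (cn ((i == j)%:R - (l == j)%:R : C))).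
    by apply: majorized_ext H => h _; rewrite !nrow_nil.
  rewrite expr0; case: (i == j); case: (l == j);
    by rewrite ?subrr ?subr0 ?sub0r ?cnN ?cn0 ?cn1 ?ler01 ?lexx.
by rewrite exprS; have [] := nrow_step a ih i l.
Qed.

Let lam1 : 0 < 1 - lam. Proof. by rewrite /lam; move: k0; lra. Qed.
Let lam0 : 0 <= lam. Proof. by rewrite /lam; move: k1; lra. Qed.

(** Each prepended letter moves the rows by at most twice their current oscillation, and these
    oscillations form a geometric series, whatever the length of [t]. *)
Lemma nrow_tail t s i l j :
  majorized r (fun h => nrow Phi (Dh h) (t ++ s) i j - nrow Phi (Dh h) s l j)
    (3 / (1 - lam) * lam ^+ size s).
Proof.
suff H : majorized r (fun h => nrow Phi (Dh h) (t ++ s) i j - nrow Phi (Dh h) s l j)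
    (lam ^+ size s * (1 + 2 * \sum_(k < size t) lam ^+ k)).
  apply: majorized_le H _; rewrite [leRHS]mulrC ler_wpM2l ?exprn_ge0//.
  rewrite geometric_partial; last by rewrite -subr_eq0 -opprB oppr_eq0 gt_eqF.
  rewrite ler_pdivlMr// mulrDl mul1r -mulrA divfK ?gt_eqF//.
  by have := exprn_ge0 (size t) lam0; move: lam1 lam0; lra.
elim: t i => [|a t ih] i.
  by rewrite big_ord0 mulr0 addr0 mulr1; exact: nrow_osc.
have [_ H] := nrow_step a (fun i l => nrow_osc (t ++ s) i l j) i l.
have := majorizedD H (ih l).
have -> : 2 * lam ^+ size (t ++ s) +
    lam ^+ size s * (1 + 2 * \sum_(k < size t) lam ^+ k) =
    lam ^+ size s * (1 + 2 * \sum_(k < size (a :: t)) lam ^+ k).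
  by rewrite size_cat exprD big_ord_recr/=; ring.
by apply: majorized_ext => h _; rewrite addrA subrK.
Qed.

Lemma nrow_bound s i j :
  majorized r (fun h => nrow Phi (Dh h) s i j) (1 + 3 / (1 - lam)).
Proof.
have H1 := nrow_tail s [::] i i j; rewrite cats0 expr0 mulr1 in H1.
have H2 := majorizedD (majorized_cst ((i == j)%:R : C) r0) H1.
apply: majorized_le (majorized_ext _ H2) _ => [h _|].
  by rewrite nrow_nil addrC subrK.
by rewrite lerD2r; case: (i == j); rewrite ?cn0 ?cn1.
Qed.

End backward_products.

Section normalized_rows.
Context {R : realType} {m A B : nat} (Phi : 'I_B -> 'I_A.+1).
Local Notation C := R[i].
Local Notation RC := (real_complex R).

Lemma common_lower_bound (I : finType) (f : I -> R) : (forall i, 0 < f i) ->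
  exists r, [/\ 0 < r, r <= 1 & forall i, r <= f i].
Proof.
move=> f0; exists (\prod_i Num.min 1 (f i)).
have g i : 0 <= Num.min 1 (f i) <= 1 by rewrite le_min ler01 (ltW (f0 i)) ge_min lexx.
split; [|by apply: prodr_ile1|move=> i].
  by apply: prodr_gt0 => i _; rewrite lt_min ltr01 f0.
rewrite (bigD1 i)//=; apply: le_trans (_ : Num.min 1 (f i) * 1 <= _).
  by apply: ler_wpM2l; [have /andP[] := g i|apply: prodr_ile1].
by rewrite mulr1 ge_min lexx orbT.
Qed.

Lemma common_majorized (I : finType) (f : I -> 'rV[C]_m -> C) :
  (forall i, exists2 r : R, 0 < r & exists M, majorized r (f i) M) ->
  exists r M, [/\ 0 < r, 0 <= M & forall i, majorized r (f i) M].
Proof.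
move=> fr; have {fr}fr i : exists r : R, 0 < r /\ exists M, majorized r (f i) M.
  by have [r r0 fM] := fr i; exists r.
have [r_ rP] := choice fr.
have [M_ H] := choice (fun i => proj2 (rP i)).
have [r [r1 _ rr]] := common_lower_bound (fun i => proj1 (rP i)).
exists r, (\sum_i M_ i).
have M0 i : 0 <= M_ i := majorized_ge0 (H i).
split=> // [|i]; first exact: sumr_ge0.
apply: majorized_le (majorized_radius (ltW r1) (rr i) (H i)) _.
by rewrite (bigD1 i)//= lerDl sumr_ge0.
Qed.

(** The new radius depends only on [r], [M] and [delta], so it serves infinitely many indices at
    once, such as all words or all sequences. *)
Lemma near_base_value (I : Type) (f : I -> 'rV[C]_m -> C) (r M delta : R) :
  0 < r -> 0 <= M -> 0 < delta -> (forall i, majorized r (f i) M) ->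
  exists r', [/\ 0 < r', r' <= r &
    forall i, majorized r' (fun h => f i h - f i 0) delta].
Proof.
move=> r0 M0 d0 fM; pose s := Num.min 1 (delta / (M + 1)).
have M1 : 0 < M + 1 by rewrite ltr_wpDl.
have s0 : 0 < s by rewrite lt_min ltr01 divr_gt0.
have s1 : s <= 1 by rewrite ge_min lexx.
exists (s * r); split; [exact: mulr_gt0|by rewrite ler_piMl// ltW|move=> i].
apply: majorized_le (majorized_shrink (ltW r0) (ltW s0) s1 (fM i)) _.
apply: le_trans (_ : delta / (M + 1) * M <= _).
  by rewrite ler_wpM2r// ge_min lexx orbT.
by rewrite mulrAC ler_pdivrMr// ler_wpM2l ?(ltW d0)// lerDl.
Qed.

(** The bounds keep the same [lam] and [K] at all smaller radii, because the radius is reduced once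
    more when the contraction hypothesis comes in. *)
Lemma normalized_rows (D0 : 'M[R]_B) (Dh : 'rV[C]_m -> 'M[C]_B) (r M : R) :
  0 < r -> 0 <= M -> (forall i j, majorized r (fun h => Dh h i j) M) ->
  Dh 0 = toC D0 -> stochastic D0 ->
  (forall a, exists2 j, Phi j = a & forall i, 0 < D0 i j) ->
  (forall j, (forall i, D0 i j = 0) \/ (forall i, 0 < D0 i j)) ->
  exists r' lam K, [/\ 0 < r', r' <= r, 0 <= lam, lam < 1 & 0 <= K] /\
  forall r'', 0 < r'' -> r'' <= r' ->
   [/\ (forall s h i, polydisc r'' h -> rsum Phi (Dh h) s i != 0),
      (forall s i j, majorized r'' (fun h => nrow Phi (Dh h) s i j) K) &
      (forall t s i l j, majorized r''
        (fun h => nrow Phi (Dh h) (t ++ s) i j - nrow Phi (Dh h) s l j)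
        (K * lam ^+ size s))].
Proof.
move=> r0 M0 DM Dh0 [D0_ge0 D0_row] pos col.
have B0 : (0 < B)%N by have [j _ _] := pos ord0; case: (B) j => [[]|].
have D0_le1 i j : D0 i j <= 1.
  by rewrite -(D0_row i) (bigD1 j)//= lerDl sumr_ge0.
have f0 (ij : 'I_B * 'I_B) : 0 < (if 0 < D0 ij.1 ij.2 then D0 ij.1 ij.2 else 1).
  by case: ifP.
(* Halving makes [c] strictly less than 1. The constants [tau], [eta] and [delta] below are then the
   largest allowed by [tauB], [eta_le] and [eta_ge]. *)
have [c' [c0' c1' cP]] := common_lower_bound f0; pose c := c' / 2.
have c0 : 0 < c by rewrite divr_gt0.
have c1 : c < 1 by rewrite /c; move: c1'; lra.
have c_le i j : 0 < D0 i j -> c <= D0 i j.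
  by move=> h; have := cP (i, j); rewrite /= h /c; move: c0'; lra.
have D0_col j : (forall i, D0 i j = 0) \/ (forall i, c <= D0 i j).
  by have [|h] := col j; [left|right=> i; exact: c_le].
have D0_pos a : exists2 j, Phi j = a & forall i, c <= D0 i j.
  by have [j ja h] := pos a; exists j => // i; exact: c_le.
have BR : 0 < B%:R :> R by rewrite ltr0n.
have B1 : 1 <= B%:R :> R by rewrite ler1n.
have k0 : 0 < c ^+ 2 by rewrite exprn_gt0.
pose tau := c ^+ 2 / (32 * B%:R).
have tau0 : 0 < tau by rewrite divr_gt0 ?mulr_gt0.
have tauB : 32 * B%:R * tau <= c ^+ 2.
  by rewrite /tau mulrC divfK// gt_eqF ?mulr_gt0.
pose eta := c ^+ 2 * tau / 8.
have eta0 : 0 < eta by apply: divr_gt0 => //; exact: mulr_gt0.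
pose delta := eta * c ^+ 2 / (B%:R * (1 + tau)).
have Bt : 0 < B%:R * (1 + tau) by rewrite mulr_gt0 ?addr_gt0.
have delta0 : 0 < delta by apply: divr_gt0 => //; exact: mulr_gt0.
have eta_ge : B%:R * (delta / c ^+ 2 * (1 + tau)) <= eta.
  rewrite (_ : _ * _ = eta)// /delta; field.
  by rewrite !gt_eqF// addr_gt0.
have [r' [r0' r'r H]] := @near_base_value ('I_B * 'I_B)%type
  (fun ij h => Dh h ij.1 ij.2) r M delta r0 M0 delta0 (fun ij => DM ij.1 ij.2).
have lam1 : 0 < c ^+ 2 / 2 by rewrite divr_gt0.
have k1 : c ^+ 2 < 1 by rewrite expr_lt1 ?ltW.
have K0 : 0 <= 3 / (c ^+ 2 / 2) by rewrite divr_ge0 ?ltW.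
exists r', (1 - c ^+ 2 / 2), (1 + 3 / (c ^+ 2 / 2)); split.
  by split=> //; [move: k1; lra|move: lam1; lra|rewrite addr_ge0].
move=> r'' r0'' r''r'; have r0''' := ltW r0''.
have Dh_near i j : majorized r'' (fun h => Dh h i j - RC (D0 i j)) delta.
  apply: majorized_radius (ltW r0'') r''r' _.
  by apply: majorized_ext (H (i, j)) => h _ /=; rewrite Dh0 mxE.
have lamE : 1 - (1 - c ^+ 2 / 2) = c ^+ 2 / 2 by ring.
split.
- move=> s h i.
  exact: (rsum_neq0 r0''' c0 c1 B0 D0_ge0 D0_le1 D0_row D0_col D0_pos Dh_near
    (ltW delta0) tau0 tauB eta_ge (lexx _)).
- move=> s i j; rewrite -{1}lamE.
  exact: (nrow_bound r0''' c0 c1 B0 D0_ge0 D0_le1 D0_row D0_col D0_pos Dh_near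
    (ltW delta0) tau0 tauB eta_ge (lexx _)).
- move=> t s i l j; have lam0 : 0 <= 1 - c ^+ 2 / 2 by move: k1; lra.
  apply: (@majorized_le _ _ _ _
    (3 / (1 - (1 - c ^+ 2 / 2)) * (1 - c ^+ 2 / 2) ^+ size s)); last first.
    by rewrite lamE ler_wpM2r ?exprn_ge0// lerDr.
  exact: (nrow_tail r0''' c0 c1 B0 D0_ge0 D0_le1 D0_row D0_col D0_pos Dh_near
    (ltW delta0) tau0 tauB eta_ge (lexx _)).
Qed.

End normalized_rows.

(** * Conditional probabilities *)

Lemma majorized_telescope (R : realType) (m : nat) (r K lam : R)
    (f : nat -> 'rV[R[i]]_m -> R[i]) : 0 <= r -> 0 <= lam -> lam < 1 ->
  majorized r (f 0%N) K ->
  (forall n, majorized r (fun h => f n.+1 h - f n h) (K * lam ^+ n)) ->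
  exists2 F, majorized r F (K + K / (1 - lam)) &
    forall h n, polydisc r h -> cn (F h - f n h) <= K / (1 - lam) * lam ^+ n.
Proof.
move=> r0 lam0 lam1 f0 fS; have K0 := majorized_ge0 f0.
have lam1' : 0 < 1 - lam by rewrite subr_gt0.
pose g k h := if k is k'.+1 then f k h - f k' h else f 0%N h.
pose M k := if k is k'.+1 then K * lam ^+ k' else K.
have gM k : majorized r (g k) (M k) by case: k.
have sM n : \sum_(k < n.+1) M k = K + K / (1 - lam) * (1 - lam ^+ n).
  rewrite big_ord_recl/= -mulr_sumr geometric_partial ?lt_eqF//; congr (_ + _).
  by rewrite mulrA mulrAC.
have sg n h : \sum_(k < n.+1) g k h = f n h.
  elim: n => [|n ih]; first by rewrite big_ord_recl big_ord0 addr0.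
  by rewrite big_ord_recr/= ih addrC subrK.
have Kl : 0 <= K / (1 - lam) by rewrite divr_ge0// ltW.
have MM n : \sum_(k < n) M k <= K + K / (1 - lam).
  case: n => [|n]; first by rewrite big_ord0 addr_ge0.
  by rewrite sM lerD2l ler_piMr// gerBl exprn_ge0.
have [F FM FP] := majorized_series r0 gM MM; exists F => // h n hr.
have := FP h n.+1 hr; rewrite sg sM => /le_trans; apply.
rewrite le_eqVlt; apply/orP; left; apply/eqP; ring.
Qed.

(** * Conditional probabilities as averages of normalized rows *)

Section positive_rows.
Context {R : realType} {A B : nat} (Phi : 'I_B -> 'I_A.+1).
Local Notation RC := (real_complex R).
Implicit Types (D : 'M[R]_B) (p : 'rV[R]_B) (z : left_seq R A).

Lemma col_restrict_toC D a : col_restrict Phi (toC D) a = toC (col_restrict Phi D a).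
Proof.
by apply/matrixP => i j; rewrite !mxE; case: ifP; rewrite // rmorph0.
Qed.

Lemma wprod_toC D s : wprod Phi (toC D) s = toC (wprod Phi D s).
Proof.
elim: s => [|a s ih]; first by rewrite /toC map_mx1.
by rewrite /= ih col_restrict_toC /toC map_mxM.
Qed.

Lemma rsum_toC D s i : rsum Phi (toC D) s i = RC (rsum Phi D s i).
Proof.
by rewrite /rsum rmorph_sum; apply: eq_bigr => j _; rewrite wprod_toC mxE.
Qed.

Lemma nrow_toC D s i j : nrow Phi (toC D) s i j = RC (nrow Phi D s i j).
Proof. by rewrite /nrow wprod_toC rsum_toC mxE fmorph_div. Qed.

Lemma wprod_ge0 D s i j : stochastic D -> 0 <= wprod Phi D s i j.
Proof.
move=> [D0 _]; elim: s i => [|a s ih] i; first by rewrite mxE ler0n.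
by rewrite mxE sumr_ge0// => l _; rewrite mulr_ge0// mxE; case: ifP.
Qed.

Lemma rsum_gt0 D s i : stochastic D -> rsum Phi (toC D) s i != 0 ->
  0 < rsum Phi D s i.
Proof.
move=> sD; rewrite rsum_toC fmorph_eq0 => nz; rewrite lt_neqAle eq_sym nz.
by apply: sumr_ge0 => j _; exact: wprod_ge0.
Qed.

Lemma nrow_ge0 D s i j : stochastic D -> 0 <= nrow Phi D s i j.
Proof.
move=> sD; rewrite divr_ge0 ?wprod_ge0//.
by apply: sumr_ge0 => l _; exact: wprod_ge0.
Qed.

Lemma nrow_sum (K : fieldType) (M : 'M[K]_B) s i : rsum Phi M s i != 0 ->
  \sum_j nrow Phi M s i j = 1.
Proof. by move=> nz; rewrite -mulr_suml divff. Qed.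

(* [past z n] is the word z_{-n}, ..., z_{-1}. *)
Fixpoint past (z : left_seq R A) n : seq 'I_A.+1 :=
  if n is k.+1 then z n :: past z k else [::].

Lemma past_shift z n : past z n.+1 = rcons (past (shift_seq z) n) (z 1%N).
Proof. by elim: n => [|n ih] //; rewrite [LHS]/= -[z n.+1 :: _]/(past z n.+1) ih. Qed.

(** Paths are sorted by their state at time 0, so that the next letter acts by a matrix on the
    right. *)
Definition path_row D p n (z : left_seq R A) : 'rV[R]_B := \row_j
  \sum_(y : {ffun 'I_n.+1 -> 'I_B} | [forall i, Phi (y i) == z i] && (y ord0 == j))
    path_prob D p y.

(** Indices count backwards in time: a new present state enters at index 0 and moves the others
    up. *)
Definition consf n (jy : 'I_B * {ffun 'I_n.+1 -> 'I_B}) : {ffun 'I_n.+2 -> 'I_B} :=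
  [ffun i => if unlift ord0 i is Some k then jy.2 k else jy.1].

Lemma consf0 n jy : @consf n jy ord0 = jy.1.
Proof. by rewrite ffunE unlift_none. Qed.

Lemma consf_lift n jy k : @consf n jy (lift ord0 k) = jy.2 k.
Proof. by rewrite ffunE liftK. Qed.

Lemma consf_bij n : bijective (@consf n).
Proof.
exists (fun y : {ffun 'I_n.+2 -> 'I_B} => (y ord0, [ffun k => y (lift ord0 k)])).
  move=> [j y]; rewrite consf0; congr pair; apply/ffunP => k.
  by rewrite ffunE consf_lift.
move=> y; apply/ffunP => i; have [k ->|->] := unliftP ord0 i.
  by rewrite consf_lift ffunE.
by rewrite consf0.
Qed.

Lemma path_prob_cons D p n j (y : {ffun 'I_n.+1 -> 'I_B}) :
  path_prob D p (consf (j, y)) = path_prob D p y * D (y ord0) j.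
Proof.
have maxE : ord_max = lift ord0 (ord_max : 'I_n.+1) by exact: val_inj.
rewrite /path_prob maxE consf_lift -mulrA; congr (_ * _).
rewrite big_ord_recl mulrC consf_lift; congr (_ * _).
  apply: eq_bigr => i _; rewrite consf_lift; congr (D _ _).
  have -> : widen_ord (leqnSn n.+1) (lift ord0 i) = lift ord0 (widen_ord (leqnSn n) i).
    exact: val_inj.
  by rewrite consf_lift.
have -> : widen_ord (leqnSn n.+1) ord0 = ord0 by exact: val_inj.
by rewrite consf0.
Qed.

Lemma path_row_word_prob D p n z :
  word_prob D p Phi n z = \sum_j path_row D p n z 0 j.
Proof.
rewrite /word_prob; under [RHS]eq_bigr do rewrite mxE big_mkcondr/=.
rewrite exchange_big/=; apply: eq_bigr => y _.
by rewrite -big_mkcond/= (bigD1 (y ord0))//= big1 ?addr0// => j /andP[/eqP -> /eqP].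
Qed.

Lemma path_row0 D p z : path_row D p 0 z = \row_j (if Phi j == z 0%N then p 0 j else 0).
Proof.
apply/rowP => j; rewrite !mxE; pose c := [ffun=> j] : {ffun 'I_1 -> 'I_B}.
have yE (y : {ffun 'I_1 -> 'I_B}) : y ord0 = j -> y = c.
  by move=> yj; apply/ffunP => i; rewrite ord1 ffunE.
case: ifP => Pj; last first.
  rewrite big1// => y /andP[/forallP /(_ ord0) + /eqP yj].
  by rewrite yj Pj.
rewrite (bigD1 c)/=; last first.
  rewrite ffunE eqxx andbT; apply/forallP => i; rewrite ffunE ord1; exact: Pj.
rewrite /path_prob big_ord0 mulr1 ffunE big1 ?addr0// => y /andP[/andP[_ /eqP yj]].
by rewrite (yE y yj) eqxx.
Qed.

Lemma path_rowS D p n z : path_row D p n.+1 z =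
  path_row D p n (shift_seq z) *m col_restrict Phi D (z 0%N).
Proof.
apply/rowP => j; rewrite !mxE.
rewrite (reindex (@consf n)); last exact/onW_bij/consf_bij.
have conE j' y : [forall i, Phi (consf (j', y) i) == z i] =
    (Phi j' == z 0%N) && [forall i, Phi (y i) == shift_seq z i] :> bool.
  apply/forallP/andP => [h|[h1 /forallP h2] i].
    split; first by have := h ord0; rewrite consf0.
    by apply/forallP => i; have := h (lift ord0 i); rewrite consf_lift.
  have [k ->|->] := unliftP ord0 i; last by rewrite consf0.
  by rewrite consf_lift; exact: h2.
under [RHS]eq_bigr do rewrite !mxE.
transitivity (\sum_(y : {ffun 'I_n.+1 -> 'I_B} | [forall i, Phi (y i) == shift_seq z i])
    path_prob D p y * (if Phi j == z 0%N then D (y ord0) j else 0)).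
  rewrite (eq_bigl (fun jy : 'I_B * {ffun 'I_n.+1 -> 'I_B} =>
    (jy.1 == j) && ((Phi j == z 0%N) &&
      [forall i, Phi (jy.2 i) == shift_seq z i]))); last first.
    move=> [j' y]; rewrite /= conE consf0/=.
    by case: (eqVneq j' j) => [->|_]; rewrite ?andbT ?andbF.
  rewrite (eq_bigr (fun jy : 'I_B * {ffun 'I_n.+1 -> 'I_B} =>
    path_prob D p jy.2 * D (jy.2 ord0) jy.1)); last first.
    by move=> [j' y] _; exact: path_prob_cons.
  rewrite -(pair_big_dep (fun j' : 'I_B => j' == j)
    (fun (j' : 'I_B) (y : {ffun 'I_n.+1 -> 'I_B}) => (Phi j == z 0%N) &&
    [forall i, Phi (y i) == shift_seq z i])
    (fun (j' : 'I_B) (y : {ffun 'I_n.+1 -> 'I_B}) =>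
      path_prob D p y * D (y ord0) j'))/=.
  rewrite big_pred1_eq; case: (Phi j == z 0%N) => //=.
  by rewrite big1// big1// => y _; rewrite mulr0.
under [RHS]eq_bigr do rewrite mulr_suml big_mkcondr/=.
rewrite exchange_big/=; apply: eq_bigr => y _.
rewrite (bigD1 (y ord0))//= eqxx big1 ?addr0// => l ly.
by rewrite eq_sym (negPf ly).
Qed.

(** Stationarity inserts one transition before the oldest letter, which gives each of the n + 1
    letters its own matrix. *)
Lemma path_rowE D p n z : p *m D = p ->
  path_row D p n z = p *m wprod Phi D (rcons (past z n) (z 0%N)).
Proof.
move=> pD; elim: n z => [|n ih] z.
  rewrite path_row0 /= mulmx1; apply/rowP => j; rewrite !mxE.
  case: ifP => Pj.
    by rewrite -{1}pD mxE; apply: eq_bigr => i _; rewrite mxE Pj.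
  by rewrite big1// => i _; rewrite mxE Pj mulr0.
rewrite path_rowS ih past_shift -[in RHS]cats1 wprod_cat /= mulmx1 mulmxA.
by congr (_ *m _).
Qed.

Lemma word_probE D p n z : p *m D = p ->
  word_prob D p Phi n z = \sum_i p 0 i * rsum Phi D (rcons (past z n) (z 0%N)) i.
Proof.
move=> pD; rewrite path_row_word_prob path_rowE//; under eq_bigr do rewrite mxE.
by rewrite exchange_big/=; apply: eq_bigr => i _; rewrite mulr_sumr.
Qed.

Lemma rsum_rcons (K : fieldType) (M : 'M[K]_B) s a i :
  rsum Phi M (rcons s a) i =
  \sum_j wprod Phi M s i j * \sum_l col_restrict Phi M a j l.
Proof.
rewrite /rsum -cats1 wprod_cat /= mulmx1; under eq_bigr do rewrite mxE.
by rewrite exchange_big/=; apply: eq_bigr => j _; rewrite mulr_sumr.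
Qed.

(** The weights are the law of the state preceding the past word, given that word. *)
Lemma cond_prob_average D p n z : stochastic D -> stationary_distribution D p ->
  (forall s i, 0 < rsum Phi D s i) ->
  exists w : 'I_B -> R, [/\ forall i, 0 <= w i, \sum_i w i = 1 &
    cond_prob D p Phi n z = \sum_i w i *
      \sum_j nrow Phi D (past z n.+1) i j * \sum_l col_restrict Phi D (z 0%N) j l].
Proof.
move=> sD [p0 p1 pD] rs0; set s := past z n.+1.
pose S := \sum_i p 0 i * rsum Phi D s i.
have S0 : 0 < S.
  rewrite lt_neqAle sumr_ge0 ?andbT => [|i _]; last by rewrite mulr_ge0// ltW.
  rewrite eq_sym; apply/negP => /eqP /psumr_eq0P H.
  have pi0 i : p 0 i = 0.
    have /eqP := H (fun i _ => mulr_ge0 (p0 i) (ltW (rs0 s i))) i isT.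
    by rewrite mulf_eq0 [X in _ || X]gt_eqF// orbF => /eqP.
  by have := oner_neq0 R; rewrite -p1 big1 ?eqxx// => i _; exact: pi0.
exists (fun i => p 0 i * rsum Phi D s i / S); split.
- by move=> i; rewrite divr_ge0 ?mulr_ge0// ltW.
- by rewrite -mulr_suml divff ?gt_eqF.
rewrite /cond_prob !word_probE// -past_shift -/s -/S mulr_suml.
apply: eq_bigr => i _; rewrite rsum_rcons.
rewrite mulr_sumr mulr_suml mulr_sumr; apply: eq_bigr => j _.
rewrite /nrow; have := rs0 s i; move: (rsum Phi D s i) => x x0.
by field; rewrite !gt_eqF.
Qed.

End positive_rows.

(** * Exact contraction rate *)

Section euclidean.
Context {R : realType} {n : nat}.
Implicit Types w : 'rV[R[i]]_n.

Lemma cn_le_euclidean w i : cn (w 0 i) <= euclidean_norm w.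
Proof.
rewrite -[leLHS]ger0_norm ?cn_ge0// -sqrtr_sqr ler_wsqrtr// (bigD1 i)//= lerDl.
by apply: sumr_ge0 => j _; exact: sqr_ge0.
Qed.

Lemma euclidean_le_sum w : euclidean_norm w <= \sum_i cn (w 0 i).
Proof.
have S0 : 0 <= \sum_i cn (w 0 i) by apply: sumr_ge0 => i _; exact: cn_ge0.
rewrite -[leRHS]ger0_norm// -sqrtr_sqr ler_wsqrtr// expr2 mulr_suml.
apply: ler_sum => i _; rewrite expr2 ler_wpM2l ?cn_ge0// (bigD1 i)//= lerDl.
by apply: sumr_ge0 => j _; exact: cn_ge0.
Qed.

Lemma euclidean_le_const w b : (forall i, cn (w 0 i) <= b) ->
  euclidean_norm w <= n%:R * b.
Proof.
move=> wb; apply: le_trans (euclidean_le_sum w) _.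
apply: le_trans (_ : \sum_(i < n) b <= _); first exact: ler_sum.
by rewrite sumr_const card_ord mulr_natl.
Qed.

End euclidean.

(** * Normalized rows as orbits of the letter maps *)

Section row_orbits.
Context {K : fieldType} {A B : nat} (Phi : 'I_B -> 'I_A.+1) (M : 'M[K]_B).
Context (i0 : 'I_B) (nz : forall s, rsum Phi M s i0 != 0).
Implicit Types s t : seq 'I_A.+1.

Definition xrow s : 'rV[K]_B := \row_j nrow Phi M s i0 j.

Lemma xrow_rcons t a : letter_map Phi M a (xrow t) = xrow (rcons t a).
Proof.
have E j : (xrow t *m col_restrict Phi M a) 0 j =
    wprod Phi M (rcons t a) i0 j / rsum Phi M t i0.
  rewrite -cats1 wprod_cat /= mulmx1 !mxE mulr_suml; apply: eq_bigr => l _.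
  by rewrite mxE mulrAC.
rewrite /letter_map /letter_mass; under eq_bigr do rewrite E.
rewrite -mulr_suml -/(rsum Phi M (rcons t a) i0).
apply/rowP => j; rewrite [LHS]mxE E [RHS]mxE /nrow.
by field; rewrite !nz.
Qed.

Lemma xrow_cat t s : word_map Phi M s (xrow t) = xrow (t ++ s).
Proof.
elim: s t => [|a s ih] t; first by rewrite cats0.
by rewrite /word_map /= xrow_rcons -cat_rcons; exact: ih.
Qed.

Lemma xrow_face t b i : Phi i != b -> xrow (rcons t b) 0 i = 0.
Proof.
move=> ib; rewrite mxE /nrow -cats1 wprod_cat /= mulmx1 mxE big1 ?mul0r// => l _.
by rewrite mxE (negPf ib) mulr0.
Qed.

Lemma xrow_sum t : \sum_i xrow t 0 i = 1.
Proof. by under eq_bigr do rewrite mxE; exact: nrow_sum. Qed.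

End row_orbits.

Section orbit_contraction.
Context {R : realType} {m A B : nat} (Phi : 'I_B -> 'I_A.+1).
Local Notation C := R[i].
Local Notation RC := (real_complex R).
Context (r rad rho K del : R) (N : nat) (D0 : 'M[R]_B).
Context (Dh : 'rV[C]_m -> 'M[C]_B) (i0 : 'I_B).
Context (r0 : 0 < r) (N0 : (0 < N)%N) (rho0 : 0 < rho) (rho1 : rho < 1).
Context (Dh0 : Dh 0 = toC D0) (sD0 : stochastic D0).
Context (nz : forall s h i, polydisc r h -> rsum Phi (Dh h) s i != 0).
Context (nrowK : forall s h i j, polydisc r h -> cn (nrow Phi (Dh h) s i j) <= K).
Context (near : forall s h i j, polydisc r h ->
  cn (nrow Phi (Dh h) s i j - nrow Phi (Dh 0) s i j) <= del).
Context (del_rad : B%:R * del <= rad).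
Context (contr : forall h, polydisc r h -> forall s b, size s = N ->
  forall w w', face_nbhd Phi D0 b rad w -> face_nbhd Phi D0 b rad w' ->
  euclidean_norm (word_map Phi (Dh h) s w - word_map Phi (Dh h) s w')
    <= rho ^+ N * euclidean_norm (w - w')).

Let p0 : polydisc r (0 : 'rV[C]_m). Proof. exact/polydisc0/ltW. Qed.

Let nz0 s : rsum Phi D0 s i0 != 0.
Proof. by have := nz s i0 p0; rewrite Dh0 rsum_toC fmorph_eq0. Qed.

(** The required nearby point is the row of the unperturbed product, which is the image under the
    map of [b] of the row of [t], a point of the simplex. *)
Lemma orbit_face_nbhd h t b : polydisc r h ->
  face_nbhd Phi D0 b rad (xrow Phi (Dh h) i0 (rcons t b)).
Proof.
move=> hr; split; first split.
- by apply: xrow_sum => s; exact: nz.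
- by move=> i; exact: xrow_face.
exists (xrow Phi D0 i0 t).
  split=> [i|]; last by apply: xrow_sum; exact: nz0.
  by rewrite mxE nrow_ge0.
rewrite xrow_rcons//; apply: le_trans del_rad; apply: euclidean_le_const => i.
by rewrite !mxE -nrow_toC -Dh0; exact: near.
Qed.

(** The hypothesis contracts whole blocks of [N] letters, and only between points of one
    neighbourhood; the shared letter just before each block puts both orbits in the same one. The
    initial distance is at most 2 B K. *)
Lemma orbit_contraction h t t' b k s : polydisc r h -> size s = (k * N)%N ->
  euclidean_norm (xrow Phi (Dh h) i0 (rcons t b ++ s) -
                  xrow Phi (Dh h) i0 (rcons t' b ++ s)) <=
  rho ^+ (k * N) * (2 * B%:R * K).
Proof.
move=> hr; have nzh s' : rsum Phi (Dh h) s' i0 != 0 by exact: nz.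
elim: k t t' b s => [|k ih] t t' b s sz.
  rewrite (size0nil sz) !cats0 mul0n expr0 mul1r -mulrA mulrCA.
  apply: euclidean_le_const => i; rewrite !mxE; apply: le_trans (cnD _ _) _.
  by rewrite cnN mulr_natl mulr2n lerD// nrowK.
have sk : (k * N <= size s)%N by rewrite sz leq_mul2r leqnSn orbT.
rewrite -(cat_take_drop (k * N) s) !catA.
set s1 := take _ s; set s2 := drop _ s.
have s1k : size s1 = (k * N)%N by rewrite size_takel.
have s2N : size s2 = N by rewrite size_drop sz mulSn addnK.
(* The shared letter is [b] before the first block and the last letter of [s1] afterwards. *)
have [u [v [c [e e']]]] : exists u v c, rcons t b ++ s1 = rcons u c /\
    rcons t' b ++ s1 = rcons v c.
  case/lastP: s1 {s1k} => [|w c]; first by rewrite !cats0; exists t, t', b.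
  by exists (rcons t b ++ w), (rcons t' b ++ w), c; rewrite !rcons_cat.
rewrite e e' -!xrow_cat// mulSn exprD -mulrA.
apply: le_trans (contr hr s2N (orbit_face_nbhd u c hr) (orbit_face_nbhd v c hr)) _.
rewrite -e -e' ler_wpM2l ?exprn_ge0 ?(ltW rho0)//; exact: ih.
Qed.

Lemma past_cat (z : left_seq R A) n d :
  exists u, past z (n + d) = u ++ past z n.
Proof.
elim: d => [|d [u ih]]; first by exists [::]; rewrite addn0.
by exists (z (n + d).+1 :: u); rewrite addnS /= ih.
Qed.

Lemma past_agree (z z' : left_seq R A) n :
  (forall i, (i <= n)%N -> z i = z' i) -> past z n = past z' n.
Proof.
elim: n => [//|n ih] zz; rewrite /= zz//; congr cons; apply: ih => i ni.
exact/zz/leqW.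
Qed.

Lemma size_past (z : left_seq R A) n : size (past z n) = n.
Proof. by elim: n => [//|n /= ->]. Qed.

Lemma past_contraction h (z z' : left_seq R A) n d j : polydisc r h ->
  (0 < n)%N -> (forall i, (i <= n)%N -> z i = z' i) ->
  cn (nrow Phi (Dh h) (past z (n + d)) i0 j - nrow Phi (Dh h) (past z' (n + d)) i0 j)
  <= rho ^- N * rho ^+ n * (2 * B%:R * K).
Proof.
(* Of the [n] common letters one fixes the initial neighbourhood, and [q] blocks fit in the others.
   At most [N] letters are lost, whence the factor rho^-N. *)
move=> hr n0 zz; pose q := (n.-1 %/ N)%N.
have qn : (q * N < n)%N.
  by rewrite -(prednK n0) ltnS leq_trunc_div.
have nq : (n <= q * N + N)%N.
  by rewrite -(prednK n0) addnC -mulSn ltn_ceil.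
have E (y : left_seq R A) : exists u,
    past y (n + d) = rcons u (y (q * N).+1) ++ past y (q * N).
  have [u uE] := past_cat y (q * N).+1 (n + d - (q * N).+1).
  exists u; rewrite cat_rcons -uE subnKC//.
  exact: leq_trans qn (leq_addr _ _).
have [u ->] := E z; have [u' ->] := E z'.
have zq : past z (q * N) = past z' (q * N).
  by apply: past_agree => i iq; apply: zz; apply: leq_trans iq (ltnW qn).
rewrite zq (zz _ qn).
have := orbit_contraction u u' (z' (q * N).+1) hr (size_past z' (q * N)).
have K0 : 0 <= K := le_trans (cn_ge0 _) (nrowK [::] i0 i0 hr).
move=> H; have := le_trans (cn_le_euclidean _ j) H; rewrite !mxE => /le_trans; apply.
rewrite ler_wpM2r ?mulr_ge0// mulrC ler_pdivlMr ?exprn_gt0// -exprD.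
by rewrite ler_wiXn2l ?(ltW rho0) ?(ltW rho1).
Qed.

End orbit_contraction.

(** * The conditional probabilities as power series *)

Section parametrization.
Context {R : realType} {m A B : nat} (Phi : 'I_B -> 'I_A.+1).
Local Notation C := R[i].
Local Notation RC := (real_complex R).
Context (Delta : 'rV[R]_m -> 'M[R]_B) (eps0 : 'rV[R]_m).

Lemma real_near (P : 'rV[R]_m -> Prop) : (\forall x \near eps0, P x) <->
  exists2 r : R, 0 < r & forall x, polydisc r (toC (x - eps0)) -> P x.
Proof.
split=> [/nbhs_ballP[e /= e0 eP]|[r r0 rP]].
  exists (e / 2); first by rewrite divr_gt0.
  move=> x xr; apply: eP; split=> // i j; rewrite -ball_normE /ball_ /= ord1.
  have := xr j; rewrite !mxE cn_real distrC => /le_lt_trans; apply.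
  by rewrite ltr_pdivrMr// ltr_pMr// ltr1n.
apply/nbhs_ballP; exists r => //= x [_ xr]; apply: rP => j.
by have := xr 0 j; rewrite -ball_normE /ball_ /= distrC !mxE cn_real => /ltW.
Qed.

Lemma toC_shift (e : 'rV[R]_m) : toC eps0 + toC (e - eps0) = toC e.
Proof. by rewrite /toC -map_mxD addrC subrK. Qed.

Lemma toC0 (k l : nat) : toC (0 : 'M[R]_(k, l)) = 0.
Proof. exact: map_mx0. Qed.

Lemma extension_majorized (DeltaC : 'rV[C]_m -> 'M[C]_B) :
  complex_extension Delta DeltaC eps0 ->
  exists r M, [/\ 0 < r, 0 <= M,
    (forall i j, majorized r (fun h => DeltaC (toC eps0 + h) i j) M) &
    (forall e, polydisc r (toC (e - eps0)) ->
       DeltaC (toC eps0 + toC (e - eps0)) = toC (Delta e))].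
Proof.
move=> [an /real_near[r1 r10 ext]].
have [r2 [M [r20 M0 H]]] := @common_majorized R m ('I_B * 'I_B)%type
  (fun ij h => DeltaC (toC eps0 + h) ij.1 ij.2)
  (fun ij => analytic_majorized (an ij.1 ij.2)).
exists (Num.min r1 r2), M; split=> //; first by rewrite lt_min r10.
  move=> i j; apply: majorized_radius (H (i, j)); last by rewrite ge_min lexx orbT.
  by rewrite le_min !ltW.
move=> e er; rewrite toC_shift; apply: ext; apply: polydisc_le er.
by rewrite ge_min lexx.
Qed.

Context (stat : 'rV[R]_m -> 'rV[R]_B) (rho : R).
Context (D0_stochastic : stochastic (Delta eps0)).
Context (stationary : forall e, stochastic (Delta e) ->
  stationary_distribution (Delta e) (stat e)).
Context (pos : forall a : 'I_A.+1,
  exists2 j, Phi j = a & forall i, 0 < Delta eps0 i j).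
Context (cols : forall j,
  (forall i, Delta eps0 i j = 0) \/ (forall i, 0 < Delta eps0 i j)).
Context (rho_contraction : contraction_constant Phi Delta eps0 rho).

(** [G z] extends the conditional probability of [z] to complex parameters: the limit row of the
    past, paired with the masses of the letter z_0. The lower bound [c] at eps_0 is what the
    logarithm requires. *)
Lemma cond_prob_family : exists r (G : left_seq R A -> 'rV[C]_m -> C) M T c,
  [/\ 0 < r, 0 < c & 0 <= T] /\
  [/\ (forall z, majorized r (G z) M),
      (forall h n z z', polydisc r h -> (forall i, (i <= n)%N -> z i = z' i) ->
        cn (G z h - G z' h) <= T * rho ^+ n),
      (forall e z, stochastic (Delta e) -> polydisc r (toC (e - eps0)) ->
        G z (toC (e - eps0)) = RC (cond_prob_limit (Delta e) (stat e) Phi z)) &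
      (forall z, c <= cond_prob_limit (Delta eps0) (stat eps0) Phi z)].
Proof.
have [/andP[rho0 rho1] [DeltaC [ext [N [rN [rad [N0 rN0 rad0 contr]]]]]]] :=
  rho_contraction.
have [r1 [M1 [r10 M10 DM Dreal]]] := extension_majorized ext.
pose Dh h := DeltaC (toC eps0 + h).
have Dh0 : Dh 0 = toC (Delta eps0).
  by have := Dreal eps0; rewrite subrr toC0; apply; apply/polydisc0/ltW.
have [r' [lam [K [[r'0 r'r1 lam0 lam1 K0] rows]]]] :=
  normalized_rows r10 M10 DM Dh0 D0_stochastic pos cols.
have [nz' nrowK' _] := rows r' r'0 (lexx _).
have [i0 _ _] := pos ord0.
have B0 : 0 < B%:R :> R by rewrite ltr0n; case: (B) i0 => [[]|].
(* Coordinates within rad / B of those at eps_0 keep the Euclidean distance below [rad]. *)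
have [r2 [r20 r2r' near]] := @near_base_value R m (seq 'I_A.+1 * 'I_B * 'I_B)%type
  (fun x h => nrow Phi (Dh h) x.1.1 x.1.2 x.2) r' K (rad / B%:R) r'0 K0
  (divr_gt0 rad0 B0) (fun x => nrowK' x.1.1 x.1.2 x.2).
(* The polydisc then lies in the Euclidean ball of radius [rN]; the denominator m + 1 is nonzero
   even without parameters. *)
pose r := Num.min r2 (rN / m.+1%:R).
have r0 : 0 < r by rewrite lt_min r20 divr_gt0.
have rr2 : r <= r2 by rewrite ge_min lexx.
have rr1 : r <= r1 by apply: le_trans rr2 (le_trans r2r' r'r1).
have [nz nrowM tail] := rows r r0 (le_trans rr2 r2r').
have r0' := ltW r0; have lam1' : 0 < 1 - lam by rewrite subr_gt0.
have nrowK s h i j : polydisc r h -> cn (nrow Phi (Dh h) s i j) <= K.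
  by move=> hr; exact: majorized_bound (nrowM s i j) hr.
have L_ex (zj : left_seq R A * 'I_B) : exists F, majorized r F (K + K / (1 - lam)) /\
    forall h n, polydisc r h ->
      cn (F h - nrow Phi (Dh h) (past zj.1 n) i0 zj.2) <= K / (1 - lam) * lam ^+ n.
  have [//|//|n|F FM FP] := @majorized_telescope R m r K lam
    (fun n h => nrow Phi (Dh h) (past zj.1 n) i0 zj.2) r0' lam0.
    by have := tail [:: zj.1 n.+1] (past zj.1 n) i0 i0 zj.2; rewrite size_past.
  by exists F.
have [L LP] := choice L_ex.
have LM z j : majorized r (L (z, j)) (K + K / (1 - lam)) := proj1 (LP (z, j)).
(* The limit is built from the row [i0], but every row converges to it; hence so does any average of
   rows. *)
have L_tail z j i h n : polydisc r h ->
    cn (L (z, j) h - nrow Phi (Dh h) (past z n) i j) <=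
    (K / (1 - lam) + K) * lam ^+ n.
  move=> hr; apply: le_trans (cn_triangle _ (nrow Phi (Dh h) (past z n) i0 j) _) _.
  rewrite mulrDl lerD//; first exact: (proj2 (LP (z, j))).
  by have := majorized_bound r0' (tail [::] (past z n) i0 i j) hr; rewrite size_past.
pose v (z : left_seq R A) j h : C := \sum_l col_restrict Phi (Dh h) (z 0%N) j l.
pose V := B%:R * M1.
have V0 : 0 <= V by rewrite mulr_ge0.
have vM z j : majorized r (v z j) V.
  have H l : majorized r (fun h => col_restrict Phi (Dh h) (z 0%N) j l) M1.
    have [za|za] := eqVneq (Phi l) (z 0%N).
      apply: majorized_ext (majorized_radius r0' rr1 (DM j l)) => h _.
      by rewrite mxE za eqxx.
    apply: majorized_ext (@majorized0 R m r M1 r0' M10) => h _.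
    by rewrite mxE (negPf za).
  have := majorized_sum (index_enum _) r0' (fun l (_ : xpredT l) => H l).
  by rewrite sumr_const card_ord -[_ *+ B]mulr_natl.
have vV z j h : polydisc r h -> cn (v z j h) <= V.
  by move=> hr; exact: majorized_bound (vM z j) hr.
pose G z h := \sum_j L (z, j) h * v z j h.
have cond_cvg e z : stochastic (Delta e) -> polydisc r (toC (e - eps0)) ->
    clim (fun n => RC (cond_prob (Delta e) (stat e) Phi n z)) (G z (toC (e - eps0))).
  move=> sD er; set h := toC (e - eps0) in er *.
  have DhE : Dh h = toC (Delta e) by apply: Dreal; exact: polydisc_le er.
  have rs0 s i : 0 < rsum Phi (Delta e) s i.
    by apply: rsum_gt0 => //; rewrite -DhE; exact: nz.
  apply: (@clim_squeeze _ _ _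
      (fun n => B%:R * V * ((K / (1 - lam) + K) * lam * lam ^+ n))).
    move=> n; have [w [w0 w1 ->]] := cond_prob_average n z sD (stationary sD) rs0.
    have -> : G z h = \sum_i RC (w i) * \sum_j L (z, j) h * v z j h.
      by rewrite -mulr_suml -(rmorph_sum RC) w1 mul1r.
    rewrite rmorph_sum -sumrB; apply: le_trans (cn_sum _ _ _) _.
    have avg (x : R) : x = \sum_i w i * x by rewrite -mulr_suml w1 mul1r.
    rewrite [leRHS]avg; apply: ler_sum => i _.
    rewrite rmorphM -mulrBr cnM cn_real ger0_norm// ler_wpM2l//.
    rewrite rmorph_sum -sumrB; apply: le_trans (cn_sum _ _ _) _.
    apply: le_trans (_ : \sum_(j < B) V * ((K / (1 - lam) + K) * lam * lam ^+ n) <= _).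
      apply: ler_sum => j _; rewrite rmorphM/= -nrow_toC.
      have -> : RC (\sum_l col_restrict Phi (Delta e) (z 0%N) j l) = v z j h.
        rewrite rmorph_sum /v DhE; apply: eq_bigr => l _.
        by rewrite col_restrict_toC [RHS]mxE.
      rewrite -DhE -mulrBl cnM mulrC ler_pM ?cn_ge0 ?vV// cnB -mulrA -exprS.
      exact: (L_tail z j i h n.+1 er).
    by rewrite sumr_const card_ord -[_ *+ B]mulr_natl mulrA.
  rewrite -[X in _ --> X](mulr0 (B%:R * V)).
  apply: cvgM; first exact: cvg_cst.
  rewrite -[X in _ --> X](mulr0 ((K / (1 - lam) + K) * lam)).
  apply: cvgM; first exact: cvg_cst.
  by apply: cvg_expr; rewrite ger0_norm.
have limE e z : stochastic (Delta e) -> polydisc r (toC (e - eps0)) ->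
    cond_prob (Delta e) (stat e) Phi n z @[n --> \oo] -->
      complex.Re (G z (toC (e - eps0))) /\
    G z (toC (e - eps0)) = RC (cond_prob_limit (Delta e) (stat e) Phi z).
  move=> sD er; have H := cond_cvg e z sD er; have H' := clim_Re H.
  split=> //; have -> : cond_prob_limit (Delta e) (stat e) Phi z =
      complex.Re (G z (toC (e - eps0))) by apply: cvg_lim.
  by apply: clim_unique H _; apply/real_clim.
(* Conditional probabilities at eps_0 are averages of these one-step masses, hence bounded below by
   their common lower bound. *)
have vpos (aj : 'I_A.+1 * 'I_B) :
    0 < \sum_l col_restrict Phi (Delta eps0) aj.1 aj.2 l.
  have [l la l0] := pos aj.1; rewrite (bigD1 l)//= mxE la eqxx.
  rewrite ltr_wpDr// sumr_ge0// => l' _; rewrite mxE; case: ifP => // _.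
  by have [+ _] := D0_stochastic; apply.
have [c [c0 _ cP]] := common_lower_bound vpos.
have er0 : polydisc r (toC (eps0 - eps0)) by rewrite subrr toC0; exact: polydisc0.
pose KL := 2 * (K / (1 - lam)).
have KL0 : 0 <= KL by rewrite mulr_ge0// divr_ge0// ltW.
(* [KL] covers n = 0, where the pasts share no letter; the other summand is the contraction
   bound. *)
pose T := B%:R * ((KL + rho ^- N * (2 * B%:R * K)) * V).
have rN0' : 0 <= rho ^- N by rewrite invr_ge0 exprn_ge0// ltW.
have rK0 : 0 <= rho ^- N * (2 * B%:R * K) by rewrite !mulr_ge0.
exists r, G, (\sum_(j < B) (K + K / (1 - lam)) * V), T, c; split.
  by split=> //; rewrite /T !mulr_ge0 ?addr_ge0.
split.
- move=> z.
  apply: (@majorized_sum _ _ r _ _ xpredT (fun j h => L (z, j) h * v z j h)) => // j _.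
  exact: majorizedM.
- move=> h n z z' hr zz.
  have vE j : v z' j h = v z j h by rewrite /v (zz 0%N).
  have LL j : cn (L (z, j) h - L (z', j) h) <=
      (KL + rho ^- N * (2 * B%:R * K)) * rho ^+ n.
    case: n zz => [|n] zz.
      rewrite expr0 mulr1; apply: le_trans (_ : KL <= _); last by rewrite lerDl.
      have H y := proj2 (LP (y, j)) h 0%N hr.
      apply: le_trans (cn_triangle _ (nrow Phi (Dh h) [::] i0 j) _) _.
      rewrite /KL mulr_natl mulr2n; apply: lerD.
        by have := H z; rewrite expr0 mulr1.
      by rewrite cnB; have := H z'; rewrite expr0 mulr1.
    apply: le_trans (_ : rho ^- N * rho ^+ n.+1 * (2 * B%:R * K) <= _); last first.
      by rewrite mulrAC ler_wpM2r ?exprn_ge0 ?(ltW rho0)// lerDr.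
    have Lc y : clim (fun d => nrow Phi (Dh h) (past y (d + n.+1)) i0 j) (L (y, j) h).
      apply: (@clim_shift _ (fun k => nrow Phi (Dh h) (past y k) i0 j)).
      apply: (@clim_squeeze _ _ _ (fun k => K / (1 - lam) * lam ^+ k)).
        by move=> k; rewrite cnB; exact: (proj2 (LP (y, j))).
      rewrite -[X in _ --> X](mulr0 (K / (1 - lam))).
      by apply: cvgM; [exact: cvg_cst|apply: cvg_expr; rewrite ger0_norm].
    have := climD (Lc z) (climZ (-1) (Lc z')); rewrite mulN1r => Ld.
    rewrite -[X in cn X]subr0; apply: (clim_near_le Ld (N := 0)) => d _.
    rewrite subr0 mulN1r addnC.
    have del_rad : B%:R * (rad / B%:R) <= rad by rewrite mulrC divfK// gt_eqF.
    apply: (past_contraction i0 (Dh := Dh) r0 N0 rho0 rho1 Dh0 D0_stochastic nz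
      nrowK _ del_rad _ d j hr _ zz) => //.
      move=> s k i l kr; have := majorized_bound (ltW r20) (near (s, i, l)).
      by apply; exact: polydisc_le kr.
    move=> k kr s b sN w w' Uw Uw'.
    have [|_ H] := contr (toC eps0 + k) _ s b sN; last exact: H.
    rewrite addrC addKr; apply: le_trans (euclidean_le_const (b := rN / m.+1%:R) _) _.
      by move=> i; apply: le_trans (kr i) _; rewrite ge_min lexx orbT.
    by rewrite mulrCA ler_piMr ?(ltW rN0)// ler_pdivrMr ?ltr0n// mul1r ler_nat.
  rewrite /G; under [X in cn (_ - X)]eq_bigr do rewrite vE.
  rewrite -sumrB; apply: le_trans (cn_sum _ _ _) _.
  apply: le_trans (_ : \sum_(j < B)
    ((KL + rho ^- N * (2 * B%:R * K)) * rho ^+ n * V) <= _).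
    by apply: ler_sum => j _; rewrite -mulrBl cnM ler_pM ?cn_ge0 ?vV.
  rewrite sumr_const card_ord -[_ *+ B]mulr_natl /T.
  by rewrite [_ * rho ^+ n * V]mulrAC !mulrA.
- by move=> e z sD er; have [] := limE e z sD er.
- move=> z; have [H E] := limE eps0 z D0_stochastic er0.
  have -> : cond_prob_limit (Delta eps0) (stat eps0) Phi z =
      complex.Re (G z (toC (eps0 - eps0))) by rewrite E.
  rewrite -lerN2; apply: (cvg_near_le (cvgN H) (N := 0)) => n _; rewrite lerN2.
  have rs0 s i : 0 < rsum Phi (Delta eps0) s i.
    apply: rsum_gt0 => //; rewrite -Dh0; apply: nz; exact: polydisc0.
  have [w [w0 w1 ->]] :=
    cond_prob_average n z D0_stochastic (stationary D0_stochastic) rs0.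
  have avg (x : R) : x = \sum_i w i * x by rewrite -mulr_suml w1 mul1r.
  rewrite [leLHS]avg; apply: ler_sum => i _; rewrite ler_wpM2l//.
  have navg (x : R) : x = \sum_j nrow Phi (Delta eps0) (past z n.+1) i j * x.
    by rewrite -mulr_suml nrow_sum ?mul1r// gt_eqF.
  rewrite [leLHS]navg; apply: ler_sum => j _.
  by rewrite ler_wpM2l ?nrow_ge0//; exact: (cP (z 0%N, j)).
Qed.

End parametrization.

(** * Logarithms *)

Section logarithm_series.
Context {R : realType}.
Implicit Types (x u : R) (n : nat).

(** ln (1 + x) minus its Taylor polynomial of degree [n], built up term by term so that the
    derivative collapses to (-x)^n / (1 + x). *)
Fixpoint ln_remainder n : R -> R :=
  if n is k.+1 then fun x => ln_remainder k x + k.+1%:R^-1 * (- x) ^+ k.+1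
  else fun x => ln (1 + x).

Lemma ln_remainderE n x : ln_remainder n x =
  ln (1 + x) - \sum_(k < n) - (k.+1%:R^-1 * (- x) ^+ k.+1).
Proof.
elim: n => [|n ih]; first by rewrite big_ord0 subr0.
by rewrite /= ih big_ord_recr/= opprD opprK addrA.
Qed.

Lemma is_derive_ln_remainder n x : -1 < x ->
  is_derive x 1 (ln_remainder n) ((- x) ^+ n / (1 + x)).
Proof.
move=> x1; have x1' : 0 < 1 + x by rewrite -ltrBlDl sub0r.
elim: n => [|n ih].
  rewrite expr0 /=.
  have H1 : is_derive x 1 (fun y : R => 1 + y) (1 : R).
    by apply: is_derive_eq; rewrite add0r mulr1.
  have H2 := is_derive1_ln x1'.
  have := @is_derive1_comp R (@ln R) (fun y => 1 + y) x _ _ H2 H1.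
  by rewrite mulr1 mul1r.
rewrite /=.
have H : is_derive x 1 (fun y : R => n.+1%:R^-1 * (- y) ^+ n.+1) (- (- x) ^+ n).
  have H0 : is_derive x 1 (fun y : R => (- y) ^+ n.+1)
      (n.+1%:R * (- x) ^+ n * -1).
    have H1 : is_derive x 1 (fun y : R => - y) (-1 : R) by exact: is_derive_eq.
    have := @is_deriveX _ _ (fun y : R => - y) n.+1 x 1 (-1) H1.
    by rewrite exprfctE.
  have := @is_deriveZ _ _ _ (fun y : R => (- y) ^+ n.+1) n.+1%:R^-1 x 1 _ H0.
  by rewrite /GRing.scale/= mulrN1 mulrN mulrA mulVf ?pnatr_eq0// mul1r.
have := is_deriveD ih H.
rewrite (_ : _ / _ + _ = (- x) ^+ n.+1 / (1 + x))//.
rewrite exprS; have : 1 + x != 0 by rewrite gt_eqF.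
by move=> nz; field.
Qed.

(** Mean value theorem between 0 and [u]: the derivative is at most twice 2^-n there, and the
    interval has length at most 1/2. *)
Lemma ln_remainder_le n u : `|u| <= 2^-1 -> `|ln_remainder n u| <= 2^-1 ^+ n.
Proof.
move=> u2; have rem0 : ln_remainder n 0 = 0.
  rewrite ln_remainderE addr0 ln1 big1 ?subr0// => k _.
  by rewrite oppr0 expr0n mulr0 oppr0.
have d (y : R) : `|y| <= 2^-1 -> -1 < y.
  rewrite ler_norml => /andP[+ _]; apply: lt_le_trans.
  by rewrite ltrN2 invf_lt1 ?ltr1n.
have db (y : R) : `|y| <= 2^-1 -> `|(- y) ^+ n / (1 + y)| <= 2 * 2^-1 ^+ n.
  move=> y2; have y1 : 2^-1 <= 1 + y.
    by move: y2; rewrite ler_norml => /andP[+ _]; lra.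
  rewrite normrM normrX normrN normfV mulrC ler_pM ?invr_ge0//.
    by rewrite ger0_norm ?(le_trans _ y1)// invf_ple ?posrE// (lt_le_trans _ y1).
  by apply: lerXn2r; rewrite ?nnegrE ?invr_ge0.
have mvt (a b : R) : a < b -> `|a| <= 2^-1 -> `|b| <= 2^-1 ->
    `|ln_remainder n b - ln_remainder n a| <= 2 * 2^-1 ^+ n * (b - a).
  move=> ab a2 b2.
  have inab (y : R) : a <= y <= b -> `|y| <= 2^-1.
    move: a2 b2; rewrite !ler_norml => /andP[? ?] /andP[? ?] /andP[? ?].
    by apply/andP; split; lra.
  have [||c cab ->] := @MVT R (ln_remainder n) (fun y => (- y) ^+ n / (1 + y)) a b ab.
  - move=> y; rewrite in_itv/= => /andP[ay yb]; apply: is_derive_ln_remainder.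
    by apply/d/inab; rewrite !ltW.
  - apply: derivable_within_continuous => y; rewrite in_itv/= => yab.
    by have [] := is_derive_ln_remainder n (d _ (inab y yab)).
  rewrite normrM [`|b - a|]ger0_norm ?subr_ge0 ?(ltW ab)//.
  rewrite ler_wpM2r ?subr_ge0 ?(ltW ab)//.
  by apply/db/inab; move: cab; rewrite in_itv/= => /andP[? ?]; rewrite !ltW.
have e0 : 0 <= 2^-1 ^+ n :> R by rewrite exprn_ge0.
have z2 : `|0 : R| <= 2^-1 by rewrite normr0.
have [u0|u0|->] := ltgtP u 0; last by rewrite rem0 normr0.
- have := mvt _ _ u0 u2 z2; rewrite rem0 sub0r normrN => /le_trans; apply.
  rewrite sub0r mulrAC ler_piMl//; move: u2; rewrite ler_norml; lra.
- have := mvt _ _ u0 z2 u2; rewrite rem0 !subr0 => /le_trans; apply.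
  rewrite mulrAC ler_piMl//; move: u2; rewrite ler_norml; lra.
Qed.

Lemma ln_lipschitz (c x y : R) : 0 < c -> c <= x -> c <= y ->
  `|ln x - ln y| <= `|x - y| / c.
Proof.
move=> c0; wlog xy : x y / y <= x.
  move=> H cx cy; have [/H|/ltW/H] := leP y x; first exact.
  by rewrite distrC [`|y - x|]distrC; apply.
move=> cx cy; have y0 := lt_le_trans c0 cy; have x0 := lt_le_trans c0 cx.
rewrite ger0_norm ?subr_ge0 ?ler_ln ?posrE// ger0_norm ?subr_ge0//.
rewrite -ln_div ?posrE//; have -> : x / y = 1 + (x - y) / y by field; rewrite gt_eqF.
apply: le_trans (le_ln1Dx _) _.
  by apply: lt_le_trans (_ : 0 <= _) => //; rewrite ?ltrN10// divr_ge0 ?subr_ge0// ltW.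
by rewrite ler_wpM2l ?subr_ge0// lef_pV2 ?posrE.
Qed.

End logarithm_series.

(** * Logarithms of a family of power series *)

Section logarithm_family.
Context {R : realType} {m : nat} (T : Type).
Local Notation C := R[i].
Local Notation RC := (real_complex R).

Lemma cn_powB (x y : C) (b : R) n : cn x <= b -> cn y <= b ->
  cn (x ^+ n.+1 - y ^+ n.+1) <= n.+1%:R * b ^+ n * cn (x - y).
Proof.
move=> xb yb; rewrite subrXX cnM mulrC ler_wpM2r ?cn_ge0//.
apply: le_trans (cn_sum _ _ _) _; rewrite mulr_natl.
rewrite -[in leRHS](card_ord n.+1) -sumr_const.
have b0 : 0 <= b := le_trans (cn_ge0 _) xb.
apply: ler_sum => k _; rewrite cnM !cnX /=.
rewrite (_ : b ^+ n = b ^+ (n - k) * b ^+ k); last first.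
  by rewrite -exprD subnK// -ltnS ltn_ord.
by apply: ler_pM; rewrite ?exprn_ge0 ?cn_ge0//; apply: lerXn2r; rewrite ?nnegrE ?cn_ge0.
Qed.

(* The branch of the logarithm is  ln (1 + u) = - sum_k (- u)^(k+1) / (k+1). *)
Lemma log1p_family r (u : T -> 'rV[C]_m -> C) : 0 <= r ->
  (forall t, majorized r (u t) 2^-1) ->
  exists F : T -> 'rV[C]_m -> C,
  [/\ (forall t, majorized r (F t) 1),
      (forall t t' h, polydisc r h -> cn (F t h - F t' h) <= 2 * cn (u t h - u t' h)) &
      (forall t h x, polydisc r h -> u t h = RC x -> F t h = RC (ln (1 + x)))].
Proof.
move=> r0 uM.
pose f t k h : C := - RC k.+1%:R^-1 * (- u t h) ^+ k.+1.
have kle (k : nat) : `|k.+1%:R^-1 : R| <= 1.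
  by rewrite ger0_norm ?invr_ge0// invf_le1// ler1n.
have fM t k : majorized r (f t k) (2^-1 ^+ k.+1).
  have := majorizedZ (- RC k.+1%:R^-1) r0 (majorizedX k.+1 r0 (majorizedN r0 (uM t))).
  move=> H; apply: majorized_le H _; rewrite cnN cn_real ler_piMl// exprn_ge0//.
have sumE n : \sum_(k < n) (2^-1 : R) ^+ k.+1 = 1 - 2^-1 ^+ n.
  under eq_bigr do rewrite exprS; rewrite -mulr_sumr geometric_partial; last first.
    by rewrite lt_eqF// invf_lt1 ?ltr1n.
  by field.
have sum1 n : \sum_(k < n) (2^-1 : R) ^+ k.+1 <= 1 by rewrite sumE gerBl exprn_ge0.
have F_ex t : exists F, majorized r F 1 /\ forall h n, polydisc r h ->
    cn (F h - \sum_(k < n) f t k h) <= 2^-1 ^+ n.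
  have [F FM FP] := majorized_series r0 (fM t) sum1; exists F; split=> // h n hr.
  by have := FP h n hr; rewrite sumE subKr.
have [F FP] := choice F_ex.
have half : (2^-1 : R) ^+ n @[n --> \oo] --> (0 : R).
  by apply: cvg_expr; rewrite ger0_norm ?invf_lt1 ?ltr1n.
have Fc t h : polydisc r h -> clim (fun n => \sum_(k < n) f t k h) (F t h).
  move=> hr; apply: (@clim_squeeze _ _ _ (fun n => 2^-1 ^+ n)) => // n.
  by rewrite cnB; exact: (proj2 (FP t)).
exists F; split=> [t|t t' h hr|t h x hr ux]; first exact: (proj1 (FP t)).
- have := climD (Fc t h hr) (climZ (-1) (Fc t' h hr)); rewrite mulN1r => Fd.
  rewrite -[X in cn X]subr0; apply: (clim_near_le Fd (N := 0)) => n _.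
  rewrite subr0 mulN1r -sumrB; apply: le_trans (cn_sum _ _ _) _.
  have uu := majorized_bound r0 (uM t) hr; have uu' := majorized_bound r0 (uM t') hr.
  (* As |u| <= 1/2, the k-th term is Lipschitz in [u] with constant 2^-k; the constants add up to at
     most 2. *)
  apply: le_trans (_ : \sum_(k < n) 2^-1 ^+ k * cn (u t h - u t' h) <= _).
    apply: ler_sum => k _; rewrite /f -mulrBr cnM cnN cn_real ger0_norm ?invr_ge0//.
    rewrite ler_pdivrMl ?ltr0n//.
    apply: le_trans (@cn_powB _ _ 2^-1 k _ _) _; rewrite ?cnN//.
    by rewrite -opprD cnN mulrA.
  rewrite -mulr_suml ler_wpM2r ?cn_ge0// geometric_partial; last first.
    by rewrite lt_eqF// invf_lt1 ?ltr1n.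
  rewrite (_ : 1 - 2^-1 = 2^-1 :> R); last by field.
  by rewrite invrK mulrC ler_piMr// gerBl exprn_ge0.
- have x2 : `|x| <= 2^-1 by rewrite -cn_real -ux; exact: majorized_bound (uM t) hr.
  apply: clim_unique (Fc t h hr) _.
  have -> : (fun n => \sum_(k < n) f t k h) =
      (fun n => RC (\sum_(k < n) - (k.+1%:R^-1 * (- x) ^+ k.+1))).
    apply/funext => n; rewrite rmorph_sum; apply: eq_bigr => k _.
    by rewrite /f ux rmorphN rmorphM rmorphXn rmorphN mulNr.
  apply: (@clim_squeeze _ _ _ (fun n => 2^-1 ^+ n)) => // n.
  by rewrite -rmorphB cn_real distrC -ln_remainderE; exact: ln_remainder_le.
Qed.

End logarithm_family.

(** * Analytic maps into normed spaces *)

Section weak_analyticity.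
Context {R : realType} {m : nat}.
Local Notation C := R[i].
Local Notation RC := (real_complex R).

Lemma monomial_toC (h : 'rV[R]_m) (a : 'I_m -> nat) :
  monomial (toC h) a = RC (monomial h a).
Proof.
by rewrite /monomial rmorph_prod; apply: eq_bigr => i _; rewrite mxE rmorphXn.
Qed.

Lemma Re_mul_real (x : C) (a : R) : complex.Re (x * RC a) = a * complex.Re x.
Proof. by case: x => x y /=; rewrite mulr0 subr0 mulrC. Qed.

Lemma Re_sum (I : Type) (s : seq I) (F : I -> C) :
  complex.Re (\sum_(i <- s) F i) = \sum_(i <- s) complex.Re (F i).
Proof. by apply: (big_morph (@complex.Re R)) => // -[a b] [a' b']. Qed.

Lemma ReB (x y : C) : complex.Re (x - y) = complex.Re x - complex.Re y.
Proof. by case: x; case: y. Qed.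

Lemma real_expansion r c f M (h : 'rV[R]_m) : expansion r c f M ->
  polydisc r (toC h) ->
  \sum_(a <- boxseq n) monomial h a * complex.Re (c a) @[n --> \oo] -->
    complex.Re (f (toC h)).
Proof.
move=> [_ cf] hr; have := clim_Re (cf _ hr).
by under eq_fun => n do
  (rewrite Re_sum; under eq_bigr do rewrite monomial_toC Re_mul_real).
Qed.

Lemma expansionB r (c c' : ('I_m -> nat) -> C) f f' M M' :
  expansion r c f M -> expansion r c' f' M' ->
  0 <= r -> expansion r (fun a => c a - c' a) (fun h => f h - f' h) (M + M').
Proof.
move=> [cM cf] [cM' cf'] r0; split=> [n|h hr].
  apply: le_trans (lerD (cM n) (cM' n)); rewrite -big_split/=; apply: ler_sum => a _.
  by rewrite -mulrDl ler_wpM2r ?exprn_ge0//; apply: le_trans (cnD _ _) _; rewrite cnN.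
have := climD (cf h hr) (climZ (-1) (cf' h hr)); rewrite mulN1r.
congr (clim _ _); apply/funext => n; rewrite mulN1r -sumrB.
by apply: eq_bigr => a _; rewrite mulrBl.
Qed.

(* A norm which is the supremum of the seminorms [|ev t| / w t] transfers uniform
   bounds on the scalar functions [G t] to power series with values in [V]. *)
Lemma analytic_from_family (V : normedModType R) (T : Type) (ev : T -> V -> R)
    (w : T -> R) (G : T -> 'rV[C]_m -> C) (c : T -> ('I_m -> nat) -> C)
    (cV : ('I_m -> nat) -> V) (f : 'rV[R]_m -> V) (eps0 : 'rV[R]_m) (r K : R) :
  0 < r -> 0 <= K -> (forall t, 0 <= w t) ->
  (forall t v v', ev t (v + v') = ev t v + ev t v') ->
  (forall t a v, ev t (a *: v) = a * ev t v) ->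
  (forall t v, `|ev t v| <= `|v| * w t) ->
  (forall v M, 0 <= M -> (forall t, `|ev t v| <= M * w t) -> `|v| <= M) ->
  (forall t, exists M, expansion r (c t) (G t) M) ->
  (forall t h, polydisc r h -> cn (G t h) <= K * w t) ->
  (forall t a, ev t (cV a) = complex.Re (c t a)) ->
  (forall t e, polydisc r (toC (e - eps0)) ->
     ev t (f e) = complex.Re (G t (toC (e - eps0)))) ->
  analytic_at f eps0.
Proof.
move=> r0 K0 w0 evD evZ ev_le norm_le cG GK cVE fE; exists cV.
apply/real_near; exists (r / 2); first by rewrite divr_gt0.
move=> e er2; have er : polydisc r (toC (e - eps0)).
  by apply: polydisc_le er2; rewrite ler_pdivrMr// ler_peMr ?ler1n// ltW.
have ev0 t : ev t 0 = 0 by rewrite -(scale0r (0 : V)) evZ mul0r.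
have evB t v v' : ev t (v - v') = ev t v - ev t v'.
  by rewrite evD -[- v']scaleN1r evZ mulN1r.
have ev_sum t n : ev t (\sum_(a <- boxseq n) monomial (e - eps0) a *: cV a) =
    \sum_(a <- boxseq n) monomial (e - eps0) a * complex.Re (c t a).
  rewrite (big_morph _ (evD t) (ev0 t)); apply: eq_bigr => a _.
  by rewrite evZ cVE.
apply: (@power_series_of_bound _ _ V cV K r) => //.
- move=> a; rewrite -ler_pdivlMr ?exprn_gt0//; apply: norm_le => [|t].
    by rewrite divr_ge0// exprn_ge0// ltW.
  rewrite cVE; apply: le_trans (cn_Re _) _; have [M cM] := cG t.
  rewrite mulrAC ler_pdivlMr ?exprn_gt0//.
  exact: (cauchy_estimate a r0 cM (GK t)).
- by move=> i; have := er2 i; rewrite mxE cn_real.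
move=> n M bM; have M0 : 0 <= M by apply: le_trans (bM n (leqnn n)).
apply: norm_le => // t; rewrite evB fE// ev_sum; have [Mt ct] := cG t.
have lim1 := real_expansion ct er.
have lim2 : `|\sum_(a <- boxseq N) monomial (e - eps0) a * complex.Re (c t a) -
    \sum_(a <- boxseq n) monomial (e - eps0) a * complex.Re (c t a)| @[N --> \oo] -->
  `|complex.Re (G t (toC (e - eps0))) -
    \sum_(a <- boxseq n) monomial (e - eps0) a * complex.Re (c t a)|.
  by apply: cvg_norm; apply: cvgB => //; exact: cvg_cst.
apply: (cvg_near_le lim2 (N := n)) => N nN.
rewrite -!ev_sum -evB; apply: le_trans (ev_le _ _) _.
by rewrite ler_wpM2r// bM.
Qed.

End weak_analyticity.

(** * Norm and membership in F^rho *)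

Section holder_elements.
Context {R : realType} {A : nat} (rho : {posnum R}).
Local Notation X := (left_seq R A).
Implicit Types (v : holder A rho) (f : X -> R).

Lemma holder_normE v : (`|v|)%:E = holder_norm rho%:num v.
Proof.
rewrite [`|v|]/(holder_normr v) /holder_normr fineK// ge0_fin_numE ?holder_norm_ge0//.
by apply: holder_norm_lty; have := valP v; rewrite inE.
Qed.

Lemma holder_sup_le v z : `|v z| <= `|v|.
Proof. by rewrite -lee_fin holder_normE le_max le_sup_norm. Qed.

Lemma holder_var_le v n z z' : (forall i, (i <= n)%N -> z i = z' i) ->
  `|v z - v z'| <= `|v| * rho%:num ^+ n.
Proof.
move=> zz; rewrite -ler_pdivrMr ?exprn_gt0// mulrC -lee_fin holder_normE.
apply: le_trans (_ : (var_norm rho%:num v <= _)%E); last by rewrite le_max lexx orbT.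
apply: le_trans (le_var_norm rho%:num n v).
by rewrite EFinM lee_wpmul2l ?le_var// lee_fin invr_ge0 exprn_ge0.
Qed.

Lemma holder_norm_leE f M : (forall z, `|f z| <= M) ->
  (forall n z z', (forall i, (i <= n)%N -> z i = z' i) ->
    `|f z - f z'| <= M * rho%:num ^+ n) ->
  (holder_norm rho%:num f <= M%:E)%E.
Proof.
move=> fM fV; rewrite ge_max; apply/andP; split.
  by apply: ge_ereal_sup => _ [z _ <-]; rewrite lee_fin.
apply: ge_ereal_sup => _ [n _ <-].
apply: (@le_trans _ _ ((rho%:num ^- n)%:E * (M * rho%:num ^+ n)%:E)%E).
  rewrite lee_wpmul2l ?lee_fin ?invr_ge0 ?exprn_ge0//.
  by apply/var_leP => z z' zz; rewrite lee_fin; exact: fV.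
by rewrite -EFinM lee_fin mulrCA mulVf ?mulr1// expf_neq0.
Qed.

Lemma holder_norm_le v M : (forall z, `|v z| <= M) ->
  (forall n z z', (forall i, (i <= n)%N -> z i = z' i) ->
    `|v z - v z'| <= M * rho%:num ^+ n) -> `|v| <= M.
Proof. by move=> vM vV; rewrite -lee_fin holder_normE; exact: holder_norm_leE. Qed.

(** Continuity follows from the variation bound: points closer than 2^-n agree up to index [n], and
    rho^n tends to 0. *)
Lemma holder_intro f M : rho%:num < 1 -> (forall z, `|f z| <= M) ->
  (forall n z z', (forall i, (i <= n)%N -> z i = z' i) ->
    `|f z - f z'| <= M * rho%:num ^+ n) ->
  exists v : holder A rho, forall z, v z = f z.
Proof.
move=> rho1 fM fV; have fh : f \in @holder_pred R A rho.
  rewrite inE; split.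
    move=> z; apply/(@cvgrPdist_le _ _ _ _ (nbhs_filter (z : X)) f (f z)) => e e0.
    have H : M * rho%:num ^+ n @[n --> \oo] --> 0.
      rewrite -[X in _ --> X](mulr0 M); apply: cvgM; first exact: cvg_cst.
      by apply: cvg_expr; rewrite ger0_norm.
    have /cvgrPdist_le /(_ e e0) [n _ /(_ n (leqnn n))] := H.
    rewrite /= sub0r normrN => /(le_trans (ler_norm _)) Mn.
    apply/nbhs_ballP; exists (2 ^- n); first by rewrite /= invr_gt0 exprn_gt0.
    move=> x; rewrite ballEmdist/= => /left_seq_dist_ltP zx.
    exact: le_trans (fV n z x zx) Mn.
  apply: le_lt_trans (ltry M); apply: le_trans (holder_norm_leE fM fV).
  by rewrite le_max lexx orbT.
by exists (Holder fh).
Qed.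

End holder_elements.

(** * Analyticity of the logarithm in F^rho *)

Section log_cond_prob.
Context {R : realType} {m A B : nat} (Phi : 'I_B -> 'I_A.+1).
Local Notation C := R[i].
Local Notation RC := (real_complex R).
Local Notation X := (left_seq R A).
Context (Delta : 'rV[R]_m -> 'M[R]_B) (eps0 : 'rV[R]_m).
Context (stat : 'rV[R]_m -> 'rV[R]_B) (rho : {posnum R}).
Context (D0_stochastic : stochastic (Delta eps0)).
Context (stationary : forall e, stochastic (Delta e) ->
  stationary_distribution (Delta e) (stat e)).
Context (pos : forall a : 'I_A.+1,
  exists2 j, Phi j = a & forall i, 0 < Delta eps0 i j).
Context (cols : forall j,
  (forall i, Delta eps0 i j = 0) \/ (forall i, 0 < Delta eps0 i j)).
Context (rho_contraction : contraction_constant Phi Delta eps0 rho%:num).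

(** Together with the points, these triples index the functionals whose supremum, after division by
    [holder_weight], is the norm of F^rho. *)
Definition agreement :=
  {p : nat * X * X | forall i, (i <= p.1.1)%N -> p.1.2 i = p.2 i}.

Definition holder_eval (t : X + agreement) (v : holder A rho) : R :=
  match t with inl z => v z | inr p => v (sval p).1.2 - v (sval p).2 end.

Definition holder_weight (t : X + agreement) : R :=
  match t with inl _ => 1 | inr p => rho%:num ^+ (sval p).1.1 end.

(** Cauchy's estimate for each [G z] bounds the coefficients in sup norm; applied to each difference
    [G z - G z'] it bounds their variations. *)
Lemma holder_analytic (G : X -> 'rV[C]_m -> C) (K r : R) : rho%:num < 1 ->
  0 < r -> 0 <= K -> (forall z, exists M, majorized r (G z) M) ->
  (forall z h, polydisc r h -> cn (G z h) <= K) ->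
  (forall h n z z', polydisc r h -> (forall i, (i <= n)%N -> z i = z' i) ->
    cn (G z h - G z' h) <= K * rho%:num ^+ n) ->
  exists2 f : 'rV[R]_m -> holder A rho, analytic_at f eps0 &
    forall e z, polydisc r (toC (e - eps0)) -> f e z = complex.Re (G z (toC (e - eps0))).
Proof.
move=> rho1 r0 K0 GM GK GV.
have c_ex z : exists c, exists M, expansion r c (G z) M.
  by have [Mz H] := GM z; have [c cH] := majorized_expansion r0 H; exists c, Mz.
have [c cP] := choice c_ex.
have c_diff z z' : exists M, expansion r (fun a => c z a - c z' a)
    (fun h => G z h - G z' h) M.
  have [M1 H1] := cP z; have [M2 H2] := cP z'; exists (M1 + M2).
  exact: expansionB H1 H2 (ltW r0).
have cV_ex a : exists v : holder A rho, forall z, v z = complex.Re (c z a).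
  apply: (@holder_intro _ _ rho _ (K / r ^+ deg a)) => // [z|n z z' zz].
    apply: le_trans (cn_Re _) _; rewrite ler_pdivlMr ?exprn_gt0//.
    by have [Mz H] := cP z; exact: (cauchy_estimate a r0 H (GK z)).
  rewrite -ReB; apply: le_trans (cn_Re _) _; rewrite mulrAC ler_pdivlMr ?exprn_gt0//.
  have [Mz H] := c_diff z z'; apply: (cauchy_estimate a r0 H) => h hr.
  exact: GV.
have [cV cVE] := choice cV_ex.
(* Outside the polydisc the value is set to 0; only parameters near eps_0 matter. *)
have f_ex e : exists v : holder A rho, polydisc r (toC (e - eps0)) ->
    forall z, v z = complex.Re (G z (toC (e - eps0))).
  have [er|ner] := pselect (polydisc r (toC (e - eps0))); last by exists 0.
  have [|n z z' zz|v vE] := @holder_intro _ _ rho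
    (fun z => complex.Re (G z (toC (e - eps0)))) K rho1.
  - by move=> z; apply: le_trans (cn_Re _) _; exact: GK.
  - by rewrite -ReB; apply: le_trans (cn_Re _) _; exact: GV.
  - by exists v.
have [f fE] := choice f_ex.
exists f => [|e z er]; last exact: fE.
apply: (@analytic_from_family _ _ _ (X + agreement)%type holder_eval holder_weight
  (fun t => match t with inl z => G z
    | inr p => fun h => G (sval p).1.2 h - G (sval p).2 h end)
  (fun t => match t with inl z => c z
    | inr p => fun a => c (sval p).1.2 a - c (sval p).2 a end) cV f eps0 r K) => //.
- by case=> [z|p] //=; rewrite exprn_ge0.
- by case=> [z|p] //= v v'; rewrite opprD addrACA.
- by case=> [z|p] //= a v; rewrite mulrBr.
- case=> [z|p] /= v; first by rewrite mulr1; exact: holder_sup_le.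
  by apply: holder_var_le; exact: (svalP p).
- move=> v M' M0 vM; apply: holder_norm_le => [z|n z z' zz].
    by have := vM (inl z); rewrite /= mulr1.
  exact: (vM (inr (exist _ (n, z, z') zz))).
- by case=> [z|p]; [exact: cP|exact: c_diff].
- case=> [z|p] h hr /=; first by rewrite mulr1; exact: GK.
  by apply: GV => //; exact: (svalP p).
- by case=> [z|p] a /=; rewrite !cVE// ReB.
- by case=> [z|p] e er /=; rewrite !fE// ReB.
Qed.

(** The logarithm is taken relative to its value at eps_0, as ln (g z) + log (1 + u z) with u z = (G
    z - g z) / g z. *)
Lemma log_cond_prob_analytic : exists2 logp : 'rV[R]_m -> holder A rho,
  analytic_at logp eps0 & \forall e \near eps0, stochastic (Delta e) ->
    forall z, logp e z = ln (cond_prob_limit (Delta e) (stat e) Phi z).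
Proof.
have rho1 : rho%:num < 1 by have [/andP[]] := rho_contraction.
have [r [G [M [T [c [[r0 c0 T0] [GM GT GE Gc]]]]]]] :=
  cond_prob_family D0_stochastic stationary pos cols rho_contraction.
have er0 : polydisc r (toC (eps0 - eps0)) by rewrite subrr toC0; exact/polydisc0/ltW.
pose g z := cond_prob_limit (Delta eps0) (stat eps0) Phi z.
have g0 z : 0 < g z := lt_le_trans c0 (Gc z).
have GE0 z : G z 0 = RC (g z).
  by have := GE eps0 z D0_stochastic er0; rewrite subrr toC0.
have p0 : polydisc r (0 : 'rV[C]_m) by exact/polydisc0/ltW.
have gM z : g z <= M.
  by have := majorized_bound (ltW r0) (GM z) p0; rewrite GE0 cn_real ger0_norm// ltW.
have z0 : X := fun=> ord0.
have M0 : 0 < M := lt_le_trans (g0 z0) (gM z0).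
(* Since g >= c, a deviation of at most c / 2 makes |u| at most 1/2 for all sequences at once. *)
have [r2 [r20 r2r near]] := @near_base_value R m X G r M (c / 2) r0 (ltW M0)
  (divr_gt0 c0 (ltr0Sn _ 1)) GM.
pose u z h : C := RC (g z)^-1 * (G z h - G z 0).
have uM z : majorized r2 (u z) 2^-1.
  apply: majorized_le (majorizedZ (RC (g z)^-1) (ltW r20) (near z)) _.
  rewrite cn_real ger0_norm ?invr_ge0 ?(ltW (g0 z))// ler_pdivrMl//.
  by rewrite ler_wpM2r ?invr_ge0//; exact: Gc.
have [F [FM FV FE]] := log1p_family (ltW r20) uM.
pose Lg z h : C := RC (ln (g z)) + F z h.
have r2le (h : 'rV[C]_m) : polydisc r2 h -> polydisc r h by exact: polydisc_le.
have gV n (z z' : X) : (forall i, (i <= n)%N -> z i = z' i) ->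
    `|g z - g z'| <= T * rho%:num ^+ n.
  by move=> zz; have := GT 0 n z z' p0 zz; rewrite !GE0 -rmorphB cn_real.
(* The first term bounds the difference of [G] divided by g(z), the second that of the reciprocals 1
   / g(z) and 1 / g(z') multiplied by G(z'). *)
pose L1 := T / c + M * (T / c ^+ 2).
have Tc0 : 0 <= T / c by rewrite divr_ge0// ltW.
have L10 : 0 <= L1 by rewrite addr_ge0// mulr_ge0 ?(ltW M0)// divr_ge0// exprn_ge0// ltW.
have uV h n (z z' : X) : polydisc r2 h -> (forall i, (i <= n)%N -> z i = z' i) ->
    cn (u z h - u z' h) <= L1 * rho%:num ^+ n.
  move=> hr zz; have nz y : RC (g y) != 0 by rewrite (fmorph_eq0 RC) gt_eqF.
  have -> : u z h - u z' h = RC (g z)^-1 * (G z h - G z' h) +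
      G z' h * RC ((g z * g z')^-1 * (g z' - g z)).
    rewrite /u !GE0 rmorphM rmorphB !fmorphV rmorphM/=.
    by field; apply/andP; split; exact: nz.
  apply: le_trans (cnD _ _) _; rewrite !cnM !cn_real mulrDl; apply: lerD.
    rewrite ger0_norm ?invr_ge0 ?(ltW (g0 z))// mulrC mulrAC.
    rewrite ler_pM ?cn_ge0 ?invr_ge0 ?(ltW (g0 z))//.
      by apply: GT => //; exact: r2le.
    by rewrite lef_pV2 ?posrE//; exact: Gc.
  rewrite -mulrA ler_pM ?cn_ge0//.
    by apply: (majorized_bound (ltW r0) (GM z')); exact: r2le.
  rewrite normrM distrC mulrC mulrAC ler_pM//; first exact: gV.
  rewrite ger0_norm ?invr_ge0 ?mulr_ge0 ?(ltW (g0 _))//.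
  rewrite lef_pV2 ?posrE ?exprn_gt0 ?mulr_gt0// expr2.
  by rewrite ler_pM ?(ltW c0)//; exact: Gc.
pose K := `|ln c| + `|ln M| + 1 + (T / c + 2 * L1).
have K0 : 0 <= K by rewrite !addr_ge0// mulr_ge0.
have ln_g z : `|ln (g z)| <= `|ln c| + `|ln M|.
  have lo : ln c <= ln (g z) by rewrite ler_ln ?posrE.
  have hi : ln (g z) <= ln M by rewrite ler_ln ?posrE.
  rewrite ler_norml; apply/andP; split.
    apply: le_trans lo; rewrite lerNl; apply: le_trans (ler_norm (- ln c)) _.
    by rewrite normrN lerDl.
  by apply: le_trans hi (le_trans (ler_norm _) _); rewrite lerDr.
have LgM z : exists M', majorized r2 (Lg z) M'.
  by exists (cn (RC (ln (g z))) + 1); apply: majorizedD => //; apply/majorized_cst/ltW.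
have LgK z h : polydisc r2 h -> cn (Lg z h) <= K.
  move=> hr; apply: le_trans (cnD _ _) _; rewrite cn_real.
  rewrite /K -addrA lerD// -[leLHS]addr0 lerD//.
    exact: majorized_bound (ltW r20) (FM z) hr.
  by rewrite addr_ge0// mulr_ge0.
have LgV h n (z z' : X) : polydisc r2 h -> (forall i, (i <= n)%N -> z i = z' i) ->
    cn (Lg z h - Lg z' h) <= K * rho%:num ^+ n.
  move=> hr zz; have rn0 : 0 <= rho%:num ^+ n by rewrite exprn_ge0.
  apply: le_trans (_ : (T / c + 2 * L1) * rho%:num ^+ n <= _); last first.
    by rewrite ler_wpM2r// lerDr !addr_ge0.
  rewrite /Lg opprD addrACA; apply: le_trans (cnD _ _) _; rewrite mulrDl lerD//.
    rewrite -rmorphB cn_real; apply: le_trans (ln_lipschitz c0 (Gc z) (Gc z')) _.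
    by rewrite mulrAC ler_wpM2r ?invr_ge0 ?(ltW c0)// gV.
  apply: le_trans (FV z z' h hr) _; rewrite -mulrA ler_wpM2l//.
  exact: uV.
have [logp an logpE] := holder_analytic rho1 r20 K0 LgM LgK LgV.
exists logp => //; apply/real_near; exists r2 => // e er sD z.
have ge := GE e z sD (r2le _ er); set h := toC (e - eps0) in er ge *.
set g1 := cond_prob_limit (Delta e) (stat e) Phi z in ge *.
pose x := (g z)^-1 * (g1 - g z).
have ux : u z h = RC x by rewrite /u ge GE0 rmorphM rmorphB.
have x2 : `|x| <= 2^-1.
  by rewrite -cn_real -ux; exact: majorized_bound (ltW r20) (uM z) er.
have x1 : 1 + x = g1 / g z.
  by rewrite /x mulrBr mulVf ?gt_eqF// addrC subrK mulrC.
have x10 : 0 < 1 + x by move: x2; rewrite ler_norml => /andP[+ _]; lra.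
have g10 : 0 < g1.
  by rewrite -[g1](divfK (_ : g z != 0)) ?gt_eqF// -x1 mulr_gt0.
rewrite logpE// /Lg (FE z h x er ux) -rmorphD x1 -lnM ?posrE ?divr_gt0//.
by rewrite [g z * _]mulrC divfK ?gt_eqF.
Qed.

End log_cond_prob.

(** * Stationary distribution *)

Section stationary.
Context {R : realType} {m A B : nat} (Phi : 'I_B -> 'I_A.+1).
Local Notation C := R[i].
Local Notation RC := (real_complex R).
Context (Delta : 'rV[R]_m -> 'M[R]_B) (eps0 : 'rV[R]_m).

(* The row sums of the complex extension are only known to be 1 at real
   parameters; correcting one column makes them 1 everywhere. *)
Lemma stochastic_extension (DeltaC : 'rV[C]_m -> 'M[C]_B) (i0 : 'I_B) (delta : R) :
  0 < delta -> complex_extension Delta DeltaC eps0 -> stochastic (Delta eps0) ->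
  exists r (D : 'rV[C]_m -> 'M[C]_B),
  [/\ 0 < r, (forall h i, \sum_j D h i j = 1),
    (forall i j, majorized r (fun h => D h i j - RC (Delta eps0 i j)) delta) &
    (forall e, stochastic (Delta e) -> polydisc r (toC (e - eps0)) ->
       D (toC (e - eps0)) = toC (Delta e))].
Proof.
move=> d0 ext sD0; have [r [M [r0 M0 DM Dreal]]] := extension_majorized ext.
pose E h := DeltaC (toC eps0 + h).
pose D h := \matrix_(i, j) (if j == i0 then 1 - \sum_(l | l != i0) E h i l else E h i j).
have r0' := ltW r0.
have Drow h i : \sum_j D h i j = 1.
  rewrite (bigD1 i0)//= mxE eqxx (eq_bigr (fun j => E h i j)) ?subrK// => j /negPf j0.
  by rewrite mxE j0.
have DE e : stochastic (Delta e) -> polydisc r (toC (e - eps0)) ->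
    D (toC (e - eps0)) = toC (Delta e).
  move=> [_ De] er; apply/matrixP => i j; rewrite mxE /E Dreal//.
  case: eqP => [->|//]; rewrite [RHS]mxE.
  rewrite (eq_bigr (fun l => RC (Delta e i l))) => [|l _]; last by rewrite mxE.
  rewrite -(rmorph_sum RC) -(rmorph1 RC) -rmorphB; congr (RC _).
  by rewrite -(De i) (bigD1 i0)//= addrK.
have M1 : 0 <= 1 + \sum_(l < B) M by rewrite addr_ge0// sumr_ge0.
have DM' (ij : 'I_B * 'I_B) : majorized r (fun h => D h ij.1 ij.2) (1 + \sum_(l < B) M).
  case: ij => i j /=; have [->|ji] := eqVneq j i0.
    have := majorizedB r0' (@majorized_cst R m r 1 r0')
      (majorized_sum (index_enum _) r0' (fun l (_ : l != i0) => DM i l)).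
    rewrite cn1 => H; apply: majorized_le (majorized_ext _ H) _ => [h _|].
      by rewrite mxE eqxx.
    by rewrite lerD2l [leRHS](bigID (fun l => l != i0))/= lerDl sumr_ge0.
  apply: majorized_le (majorized_ext _ (DM i j)) _ => [h _|].
    by rewrite mxE (negPf ji).
  by rewrite (bigD1 i0)//= addrCA lerDl addr_ge0// sumr_ge0.
have [r2 [r20 r2r near]] := near_base_value r0 M1 d0 DM'.
exists r2, D; split=> // [i j|e sD er]; last by apply: DE => //; exact: polydisc_le er.
apply: majorized_ext (near (i, j)) => h _ /=.
have := DE eps0 sD0; rewrite subrr toC0 => -> //; last exact: polydisc0.
by rewrite [in X in _ - X = _]mxE.
Qed.

Context (stat : 'rV[R]_m -> 'rV[R]_B).
Context (stationary : forall e, stochastic (Delta e) ->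
  stationary_distribution (Delta e) (stat e)).

(** The rows of the powers of [D] merge geometrically; an invariant probability vector averages them
    to itself and must equal their common limit. *)
Lemma stationary_family (D : 'rV[C]_m -> 'M[C]_B) (r delta c : R) (l0 : 'I_B) :
  0 < r -> 0 < c -> c < 1 -> 4 * B%:R * delta <= c -> 0 <= delta ->
  stochastic (Delta eps0) -> (forall i, c <= Delta eps0 i l0) ->
  (forall h i, \sum_j D h i j = 1) ->
  (forall i j, majorized r (fun h => D h i j - RC (Delta eps0 i j)) delta) ->
  (forall e, stochastic (Delta e) -> polydisc r (toC (e - eps0)) ->
     D (toC (e - eps0)) = toC (Delta e)) ->
  exists (p : 'I_B -> 'rV[C]_m -> C) M,
    (forall j, majorized r (p j) M) /\
    (forall e j, stochastic (Delta e) -> polydisc r (toC (e - eps0)) ->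
       p j (toC (e - eps0)) = RC (stat e 0 j)).
Proof.
move=> r0 c0 c1 Bd d0 sD0 cl Drow DM DE; have r0' := ltW r0.
(* [x j n h i] is the entry (i, j) of the n-th power of [D h]. *)
pose x (j : 'I_B) := fix x n h : 'I_B -> C := if n is k.+1 then
  fun i => \sum_l D h i l * x k h l else fun i => (i == j)%:R.
(* The error 2 B delta is at most c / 2, so half of the gain [c] survives. *)
pose lam := 1 - c / 2.
have lam0 : 0 <= lam by rewrite /lam; move: c1; lra.
have lam1 : lam < 1 by rewrite /lam; move: c0; lra.
pose kap j : R := if j == l0 then c else 0.
have kapP i j : kap j <= Delta eps0 i j.
  by rewrite /kap; case: eqP => [->|_]; [exact: cl|exact: (proj1 sD0)].
have kap1 : \sum_j kap j = c by rewrite -big_mkcond big_pred1_eq.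
have step j n Dd : (forall i l, majorized r (fun h => x j n h i - x j n h l) Dd) ->
    forall i l, majorized r (fun h => x j n.+1 h i - x j n.+1 h l) (lam * Dd) /\
      majorized r (fun h => x j n.+1 h i - x j n h l) (2 * Dd).
  move=> H i l; have Dd0 := majorized_ge0 (H i l).
  have [H1 H2] := dobrushin_step (W := fun i l h => D h i l)
    (X := fun i h => x j n h i) r0' c1 (proj1 sD0) kapP (proj2 sD0) kap1 DM
    (fun i h _ => Drow h i) H i l.
  split; first by apply: majorized_le H1 _; rewrite ler_wpM2r// /lam; move: Bd; lra.
  by apply: majorized_le H2 _; rewrite ler_wpM2r//; move: Bd c1 c0; lra.
have osc j n i l : majorized r (fun h => x j n h i - x j n h l) (lam ^+ n).
  elim: n i l => [|n ih] i l; last by rewrite exprS; have [] := step j n _ ih i l.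
  apply: majorized_le (@majorized_cst R m r ((i == j)%:R - (l == j)%:R) r0') _.
  rewrite expr0; case: (i == j); case: (l == j);
    by rewrite ?subrr ?subr0 ?sub0r ?cnN ?cn0 ?cn1 ?ler01 ?lexx.
have p_ex j : exists F, majorized r F (2 + 2 / (1 - lam)) /\ forall h n, polydisc r h ->
    cn (F h - x j n h l0) <= 2 / (1 - lam) * lam ^+ n.
  have [||F FM FP] := @majorized_telescope R m r 2 lam
    (fun n h => x j n h l0) r0' lam0 lam1.
  - apply: majorized_le (@majorized_cst R m r (l0 == j)%:R r0') _.
    by case: (l0 == j); rewrite ?cn0 ?cn1// ler1n.
  - by move=> n; have [_] := step j n _ (osc j n) l0 l0.
  - by exists F.
have [p pP] := choice p_ex; exists p, (2 + 2 / (1 - lam)).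
split=> [j|e j sD er]; first exact: (proj1 (pP j)).
set h := toC (e - eps0) in er *; have [p0 p1 pD] := stationary sD.
have DhE i l : D h i l = RC (Delta e i l) by rewrite DE// mxE.
have inv n : RC (stat e 0 j) = \sum_i RC (stat e 0 i) * x j n h i.
  elim: n => [|n ->] /=.
    by rewrite (bigD1 j)//= eqxx mulr1 big1 ?addr0// => i /negPf ->; rewrite mulr0.
  under [RHS]eq_bigr do rewrite mulr_sumr.
  rewrite exchange_big/=; apply: eq_bigr => l _; rewrite -{1}pD mxE rmorph_sum mulr_suml.
  by apply: eq_bigr => i _; rewrite DhE rmorphM mulrA.
pose K := 2 / (1 - lam) + 1.
apply: (@clim_unique _ (fun=> p j h)); first exact: clim_cst.
apply: (@clim_squeeze _ _ _ (fun n => K * lam ^+ n)); last first.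
  rewrite -[X in _ --> X](mulr0 K); apply: cvgM; first exact: cvg_cst.
  by apply: cvg_expr; rewrite ger0_norm.
move=> n; have -> : p j h = \sum_i RC (stat e 0 i) * p j h.
  by rewrite -mulr_suml -(rmorph_sum RC) p1 mul1r.
rewrite (inv n) -sumrB; apply: le_trans (cn_sum _ _ _) _.
have avg (y : R) : y = \sum_i stat e 0 i * y by rewrite -mulr_suml p1 mul1r.
rewrite [leRHS]avg; apply: ler_sum => i _.
rewrite -mulrBr cnM cn_real ger0_norm// ler_wpM2l//.
apply: le_trans (cn_triangle _ (x j n h l0) _) _; rewrite /K mulrDl mul1r lerD//.
  exact: (proj2 (pP j)).
by have := majorized_bound r0' (osc j n l0 i) er.
Qed.

End stationary.

(** * Sums over words *)

Section word_sums.
Context {A B : nat} (Phi : 'I_B -> 'I_A.+1).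

(* The sum over paths i, y_1, ..., y_n of the product of the transition weights,
   weighted by a function [c] of the word Phi(y_1), ..., Phi(y_n). *)
Fixpoint wsum {K : fieldType} (M : 'M[K]_B) n (c : seq 'I_A.+1 -> K) (i : 'I_B) : K :=
  if n is k.+1 then \sum_j M i j * wsum M k (fun w => c (Phi j :: w)) j else c [::].

Lemma eq_wsum (K : fieldType) (M : 'M[K]_B) n c c' i :
  (forall w, size w = n -> c w = c' w) -> wsum M n c i = wsum M n c' i.
Proof.
elim: n c c' i => [|n ih] c c' i H; first exact: H.
by apply: eq_bigr => j _; congr (_ * _); apply: ih => w wn; apply: H; rewrite /= wn.
Qed.

Lemma wsumD (K : fieldType) (M : 'M[K]_B) n c c' i :
  wsum M n (fun w => c w + c' w) i = wsum M n c i + wsum M n c' i.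
Proof.
elim: n c c' i => [//|n ih] c c' i; rewrite /= -big_split; apply: eq_bigr => j _.
by rewrite ih mulrDr.
Qed.

Lemma wsumZ (K : fieldType) (M : 'M[K]_B) n a c i :
  wsum M n (fun w => a * c w) i = a * wsum M n c i.
Proof.
elim: n c i => [//|n ih] c i; rewrite /= mulr_sumr; apply: eq_bigr => j _.
by rewrite ih mulrCA.
Qed.

(** A weight that ignores the oldest letter lets the first transition be absorbed by the invariant
    [p]. *)
Lemma wsum_behead (K : fieldType) (M : 'M[K]_B) (p : 'rV[K]_B) n c : p *m M = p ->
  \sum_i p 0 i * wsum M n.+1 (fun w => c (behead w)) i = \sum_i p 0 i * wsum M n c i.
Proof.
move=> pM; rewrite /=; under eq_bigr do rewrite mulr_sumr.
rewrite exchange_big/=; apply: eq_bigr => j _; rewrite -{2}pM mxE mulr_suml.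
by apply: eq_bigr => i _; rewrite mulrA.
Qed.

Lemma wsum_toC (R : realType) (D : 'M[R]_B) n c i :
  wsum (toC D) n (fun w => real_complex R (c w)) i = real_complex R (wsum D n c i).
Proof.
elim: n c i => [//|n ih] c i; rewrite /= rmorph_sum; apply: eq_bigr => j _.
by rewrite ih mxE rmorphM.
Qed.

Fixpoint words n : seq (seq 'I_A.+1) :=
  if n is k.+1 then [seq a :: w | a <- enum 'I_A.+1, w <- words k] else [:: [::]].

Lemma mem_words n w : (w \in words n) = (size w == n).
Proof.
elim: n w => [|n ih] [|a w] //=.
  by apply/negbTE/negP => /allpairsP[[b v] /= [_ _]].
rewrite eqSS -ih; apply/allpairsP/idP => [[[b v] /= [_ vn [_ ->]]]//|wn].
by exists (a, w); rewrite /= mem_enum.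
Qed.

Lemma words_uniq n : uniq (words n).
Proof.
elim: n => [//|n ih] /=; apply: allpairs_uniq => //; first exact: enum_uniq.
by move=> [a w] [b v] _ _ /= [-> ->].
Qed.

Lemma wsum_words (K : fieldType) (M : 'M[K]_B) n c i :
  wsum M n c i = \sum_(w <- words n) c w * rsum Phi M w i.
Proof.
elim: n c i => [|n ih] c i; first by rewrite /= big_seq1 rsum_nil mulr1.
rewrite /= big_allpairs_dep/= big_enum/=.
transitivity (\sum_(a : 'I_A.+1) \sum_j \sum_(w <- words n)
    c (a :: w) * (col_restrict Phi M a i j * rsum Phi M w j)); last first.
  apply: eq_bigr => a _; rewrite exchange_big/=; apply: eq_bigr => w _.
  by rewrite rsum_cons mulr_sumr.
rewrite exchange_big/=; apply: eq_bigr => j _; rewrite ih mulr_sumr.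
rewrite exchange_big/=; apply: eq_bigr => w _.
rewrite (bigD1 (Phi j))//= mxE eqxx [X in _ + X]big1 ?addr0 => [|a aj].
  by rewrite mulrCA.
by rewrite mxE eq_sym (negPf aj) mul0r mulr0.
Qed.

(** Paths are bounded through row sums: their total weight grows like q^n, and the number of words
    never enters. *)
Lemma wsum_majorized (R : realType) (m : nat) (r q K : R)
    (D : 'rV[R[i]]_m -> 'M[R[i]]_B) (N : 'I_B -> 'I_B -> R) n c i :
  0 <= r -> 0 <= K -> 0 <= q -> (forall i j, majorized r (fun h => D h i j) (N i j)) ->
  (forall i, \sum_j N i j <= q) -> (forall w, size w = n -> cn (c w) <= K) ->
  majorized r (fun h => wsum (D h) n c i) (K * q ^+ n).
Proof.
move=> r0 K0 q0 DN Nq; elim: n c i => [|n ih] c i cK.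
  by rewrite expr0 mulr1; apply: majorized_le (majorized_cst _ r0) _; exact: cK.
have H := majorized_sum (index_enum _) r0 (fun j (_ : xpredT j) =>
  majorizedM r0 (DN i j) (ih (fun w => c (Phi j :: w)) j
    (fun w (wn : size w = n) => cK (Phi j :: w) (congr1 succn wn)))).
apply: majorized_le H _; rewrite -mulr_suml exprS [leRHS]mulrCA.
by rewrite ler_wpM2r ?mulr_ge0 ?exprn_ge0.
Qed.

End word_sums.

(** * Increments in the length of the word *)

Section telescoping.
Context {R : realType} {A B : nat} (Phi : 'I_B -> 'I_A.+1) (rho : {posnum R}).
Local Notation RC := (real_complex R).
Local Notation X := (left_seq R A).

(* Words are read from the past: the last letter of [w] is the entry at time 0. *)
Definition extend (w : seq 'I_A.+1) : X := fun i => nth ord0 (rev w) i.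

(** The effect on [f] of the oldest letter of [w], which [behead] forgets. *)
Definition increment (f : X -> R) (w : seq 'I_A.+1) : R :=
  f (extend w) - f (extend (behead w)).

Lemma increment_le (f : holder A rho) w n : rho%:num < 1 -> size w = n.+1 ->
  `|increment f w| <= 2 / rho%:num * `|f| * rho%:num ^+ n.
Proof.
move=> rho1; case: w => [//|a w] /= [wn]; rewrite /increment /=.
have rho0 : 0 < rho%:num by [].
(* A single letter and the empty word may differ at time 0, so only the sup norm applies. A longer
   word agrees with its beheading on one entry fewer than its length, whence the factor 1 / rho. *)
case: n wn => [|n] wn.
  rewrite expr0 mulr1; apply: le_trans (ler_normB _ _) _.
  apply: le_trans (lerD (holder_sup_le f _) (holder_sup_le f _)) _.
  rewrite mulrAC ler_pdivlMr//.
  have : `|f| * rho%:num <= `|f| by rewrite ler_piMr// ltW.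
  by lra.
have H : forall i, (i <= n)%N -> extend (a :: w) i = extend w i.
  by move=> i i_n; rewrite /extend rev_cons nth_rcons size_rev wn ltnS i_n.
apply: le_trans (holder_var_le f H) _; rewrite exprS mulrA.
rewrite ler_wpM2r ?exprn_ge0//.
have -> : 2 / rho%:num * `|f| * rho%:num = 2 * `|f| by field.
by rewrite ler_peMl// ler1n.
Qed.

Lemma increment_telescope (f : X -> R) (D : 'M[R]_B) (p : 'rV[R]_B) n : p *m D = p ->
  \sum_i p 0 i * f (extend [::]) +
    \sum_(k < n) \sum_i p 0 i * wsum Phi D k.+1 (increment f) i =
  \sum_i p 0 i * wsum Phi D n (fun w => f (extend w)) i.
Proof.
move=> pD; elim: n => [|n ih]; first by rewrite big_ord0 addr0.
rewrite big_ord_recr/= addrA ih.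
rewrite -[X in X + _](wsum_behead Phi n (fun w => f (extend w)) pD).
rewrite -big_split/=; apply: eq_bigr => i _; rewrite -mulrDr; congr (_ * _).
rewrite -[\sum_j _ * _]/(wsum Phi D n.+1 (fun w => f (extend (behead w))) i).
rewrite -[X in _ + X]/(wsum Phi D n.+1 (increment f) i) -wsumD.
rewrite -[RHS]/(wsum Phi D n.+1 (fun w => f (extend w)) i).
by apply: eq_wsum => w _; rewrite /increment addrC subrK.
Qed.

End telescoping.

(** * Integrals over the space of sequences *)

#[local] Arguments words : simpl never.

Section borel_integrals.
Context {R : realType} {A : nat}.
Local Notation X := (left_seq R A).
Context (P : probability (borel X) R).

Lemma continuous_borel_measurable (f : X -> R) : continuous f ->
  measurable_fun (setT : set (borel X)) (f : borel X -> R).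
Proof.
move=> fc; apply: (measurability _ (measurable_realfun.RGenOInfty.measurableE R)) => //.
move=> _ [_ [x ->] <-]; rewrite setTI; apply: sub_sigma_algebra.
by apply: open_comp => // z _; exact: fc.
Qed.

Lemma cylinder_measurable n (z : X) : measurable (cylinder n z : set (borel X)).
Proof.
apply: sub_sigma_algebra; rewrite /= openE => x xz.
apply/nbhs_ballP; exists (2 ^- n); first by rewrite /= invr_gt0 exprn_gt0.
move=> y; rewrite ballEmdist/= => /left_seq_dist_ltP xy i i_n.
by rewrite -xy// xz.
Qed.

Lemma bounded_borel_integrable (f : X -> R) M : continuous f ->
  (forall z, `|f z| <= M) -> P.-integrable setT (EFin \o (f : borel X -> R)).
Proof.
move=> fc fM; apply: measurable_bounded_integrable => //.
- by rewrite -ge0_fin_numE ?measure_ge0// fin_num_measure.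
- exact: continuous_borel_measurable.
- exists M; split; first exact: num_real.
  by move=> y My z _; apply: le_trans (fM z) (ltW My).
Qed.

Lemma Rintegral_sum_indic (I : eqType) (s : seq I) (a : I -> R)
    (C : I -> set (borel X)) : (forall i, measurable (C i)) ->
  P.-integrable setT (EFin \o (fun z => \sum_(i <- s) a i * \1_(C i) z)) /\
  \int[P]_z (\sum_(i <- s) a i * \1_(C i) z) = \sum_(i <- s) a i * fine (P (C i)).
Proof.
move=> mC; elim: s => [|i s [int1 int2]].
  have E : (fun z : borel X => \sum_(i <- [::]) a i * \1_(C i) z) = cst 0.
    by apply/funext => z; rewrite big_nil.
  by rewrite E big_nil Rintegral_cst// mul0r; split=> //; exact: integrable0.
have inti : P.-integrable setT (EFin \o (\1_(C i) : borel X -> R)).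
  by apply: integrable_indic => //; exact: measurableT.
have intai : P.-integrable setT (EFin \o (fun z : borel X => a i * \1_(C i) z)).
  by have := integrableZl measurableT (a i) inti.
have -> : (fun z : borel X => \sum_(j <- i :: s) a j * \1_(C j) z) =
    (fun z => a i * \1_(C i) z + \sum_(j <- s) a j * \1_(C j) z).
  by apply/funext => z; rewrite big_cons.
split; first by have := integrableD measurableT intai int1.
rewrite RintegralD// int2 big_cons; congr (_ + _).
rewrite RintegralZl//; congr (_ * _).
by rewrite /Rintegral integral_indic// setIT.
Qed.

Definition last_word n (z : X) : seq 'I_A.+1 := rev (mkseq z n.+1).

Lemma past_last_word n z : rcons (past z n) (z 0%N) = last_word n z.
Proof.
elim: n => [//|n ih]; rewrite /last_word mkseqS rev_rcons -/(last_word n z) -ih.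
by [].
Qed.

Lemma size_last_word n z : size (last_word n z) = n.+1.
Proof. by rewrite size_rev size_mkseq. Qed.

Lemma extend_last_word n z i : (i <= n)%N -> (extend (last_word n z) : X) i = z i.
Proof. by move=> i_n; rewrite /extend /last_word revK nth_mkseq. Qed.

Lemma last_word_extend n w : size w = n.+1 -> last_word n (extend w) = w.
Proof.
move=> wn; rewrite /last_word -[RHS]revK; congr rev.
apply: (@eq_from_nth _ ord0); first by rewrite size_mkseq size_rev wn.
by move=> i; rewrite size_mkseq => i_n; rewrite nth_mkseq.
Qed.

Lemma cylinder_last_word n w z : size w = n.+1 ->
  (z \in (cylinder n (extend w) : set (borel X))) = (last_word n z == w).
Proof.
move=> wn; apply/idP/eqP => [|<-]; last first.
  by rewrite inE => i i_n; rewrite extend_last_word.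
rewrite inE => zw; rewrite -(last_word_extend wn) /last_word; congr rev.
apply: (@eq_from_nth _ ord0); first by rewrite !size_mkseq.
by move=> i; rewrite size_mkseq => i_n; rewrite !nth_mkseq//; apply: zw.
Qed.

Context {B : nat} (Phi : 'I_B -> 'I_A.+1) (D : 'M[R]_B) (p : 'rV[R]_B).
Context (pD : p *m D = p).
Context (Pcyl : forall n (z : X), P (cylinder n z) = (word_prob D p Phi n z)%:E).

Lemma integral_last_word n (f : X -> R) :
  P.-integrable setT (EFin \o (fun z : borel X => f (extend (last_word n z)))) /\
  \int[P]_z (f (extend (last_word n z))) =
  \sum_i p 0 i * wsum Phi D n.+1 (fun w => f (extend w)) i.
Proof.
have [H1 H2] := @Rintegral_sum_indic _ (words n.+1) (fun w => f (extend w))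
  (fun w => cylinder n (extend w)) (fun w => cylinder_measurable n (extend w)).
have E z : f (extend (last_word n z)) = \sum_(w <- words n.+1)
    f (extend w) * \1_(cylinder n (extend w) : set (borel X)) z.
  have wz : last_word n z \in words n.+1 by rewrite mem_words size_last_word.
  rewrite (bigD1_seq _ wz (words_uniq _))/= indicE cylinder_last_word ?size_last_word//.
  rewrite eqxx mulr1 big_seq_cond big1 ?addr0// => w /andP[].
  rewrite mem_words => /eqP wn ww; rewrite indicE cylinder_last_word//.
  by rewrite eq_sym (negPf ww) mulr0.
split; first by under eq_fun do rewrite E.
under eq_Rintegral do rewrite E; rewrite H2.
under [RHS]eq_bigr do rewrite wsum_words mulr_sumr.
rewrite exchange_big/=; apply: eq_big_seq => w; rewrite mem_words => /eqP wn.
rewrite Pcyl/= word_probE// past_last_word last_word_extend// mulr_sumr.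
by apply: eq_bigr => i _; rewrite mulrCA.
Qed.

(** Filling the past beyond time -n with the default letter moves [f] by at most |f| rho^n, and the
    new integrand is a finite sum over cylinders. *)
Lemma integral_approximation (rho : {posnum R}) (f : holder A rho) n :
  `|\int[P]_z f z - \sum_i p 0 i * wsum Phi D n.+1 (fun w => f (extend w)) i|
  <= `|f| * rho%:num ^+ n.
Proof.
have [fint <-] := integral_last_word n f.
have fc : continuous (f : X -> R) by have := valP f; rewrite inE => -[].
have fI := bounded_borel_integrable fc (holder_sup_le f).
have dI : P.-integrable setT
    (EFin \o (fun z : borel X => f z - f (extend (last_word n z)))).
  by have := integrableB measurableT fI fint.
rewrite -RintegralB//; apply: le_trans (le_normr_Rintegral _ dI) _ => //.
have -> : `|f| * rho%:num ^+ n = \int[P]_(z in setT) (`|f| * rho%:num ^+ n).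
  rewrite Rintegral_cst//; have /= -> := @probability_setT _ _ _ P.
  by rewrite mulr1.
apply: le_Rintegral => //.
- exact: integrable_norm.
- by apply: finite_measure_integrable_cst; exact: measurableT.
- move=> z _; apply: (@holder_var_le R A rho f n z (extend (last_word n z))).
  by move=> i i_n; rewrite extend_last_word.
Qed.

End borel_integrals.

(** * Stationary measure *)

Section stationary_measure.
Context {R : realType} {m A B : nat} (Phi : 'I_B -> 'I_A.+1).
Local Notation C := R[i].
Local Notation RC := (real_complex R).
Local Notation X := (left_seq R A).
Context (Delta : 'rV[R]_m -> 'M[R]_B) (eps0 : 'rV[R]_m).
Context (stat : 'rV[R]_m -> 'rV[R]_B) (rho : {posnum R}).
Context (nu : 'rV[R]_m -> probability (borel X) R).
Context (D0_stochastic : stochastic (Delta eps0)).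
Context (stationary : forall e, stochastic (Delta e) ->
  stationary_distribution (Delta e) (stat e)).
Context (nu_cylinder : forall e, stochastic (Delta e) ->
  forall (n : nat) (z : X),
    nu e (cylinder n z) = (word_prob (Delta e) (stat e) Phi n z)%:E).
Context (pos : forall a : 'I_A.+1,
  exists2 j, Phi j = a & forall i, 0 < Delta eps0 i j).
Context (rho_contraction : contraction_constant Phi Delta eps0 rho%:num).

Lemma nu_family : exists r K (G : holder A rho -> 'rV[C]_m -> C),
  [/\ 0 < r, 0 <= K & forall f, exists M, majorized r (G f) M] /\
  [/\ (forall f h, polydisc r h -> cn (G f h) <= K * `|f|),
      (forall a f g h, polydisc r h -> G (a *: f + g) h = RC a * G f h + G g h) &
      (forall e f, stochastic (Delta e) -> polydisc r (toC (e - eps0)) ->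
         G f (toC (e - eps0)) = RC (\int[nu e]_z f z))].
Proof.
have [/andP[rho0 rho1] [DeltaC [ext _]]] := rho_contraction.
have [l0 _ l0_pos] := pos ord0.
have [c' [c'0 c'1 cP]] := common_lower_bound l0_pos; pose c := c' / 2.
have c0 : 0 < c by rewrite divr_gt0.
have c1 : c < 1 by rewrite /c; move: c'1; lra.
have cl i : c <= Delta eps0 i l0 by have := cP i; rewrite /c; move: c'0; lra.
have B0 : 0 < B%:R :> R by rewrite ltr0n (leq_ltn_trans _ (ltn_ord l0)).
(* The first bound serves the stationary vector, the second makes rho (1 + B delta) < 1. *)
pose delta := Num.min (c / (4 * B%:R)) ((1 - rho%:num) / (2 * B%:R)).
have B4 : 0 < 4 * B%:R :> R by rewrite mulr_gt0.
have B2 : 0 < 2 * B%:R :> R by rewrite mulr_gt0.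
have delta0 : 0 < delta.
  by rewrite lt_min; apply/andP; split; apply: divr_gt0 => //; rewrite subr_gt0.
have Bd : 4 * B%:R * delta <= c.
  by rewrite mulrC -ler_pdivlMr// ge_min lexx.
pose q := 1 + B%:R * delta.
have q_ge0 : 0 <= q by rewrite addr_ge0// mulr_ge0// ltW.
pose lam := rho%:num * q.
have lam0 : 0 <= lam by rewrite mulr_ge0.
have lam1 : lam < 1.
  have Bd2 : 2 * (B%:R * delta) <= 1 - rho%:num.
    by rewrite mulrA mulrC -ler_pdivlMr// ge_min lexx orbT.
  have : rho%:num * (2 * (B%:R * delta)) <= rho%:num * (1 - rho%:num).
    by rewrite ler_wpM2l.
  have : rho%:num * (1 - rho%:num) < 1 * (1 - rho%:num).
    by rewrite ltr_pM2r// subr_gt0.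
  by rewrite /lam /q; move: rho1; lra.
have [r [D [r0 Drow DM DE]]] := stochastic_extension l0 delta0 ext D0_stochastic.
have r0' := ltW r0.
have [p [Mp [pM pE]]] := stationary_family stationary r0 c0 c1 Bd (ltW delta0)
  D0_stochastic cl Drow DM DE.
have Mp0 : 0 <= Mp := majorized_ge0 (pM l0).
have DN i j : majorized r (fun h => D h i j) (Delta eps0 i j + delta).
  have := majorizedD (majorized_cst (RC (Delta eps0 i j)) r0') (DM i j).
  rewrite cn_real ger0_norm; last exact: (proj1 D0_stochastic).
  by apply: majorized_ext => h _; rewrite addrC subrK.
have Nq i : \sum_j (Delta eps0 i j + delta) <= q.
  by rewrite big_split/= (proj2 D0_stochastic) sumr_const card_ord -[_ *+ B]mulr_natl.
pose T (f : holder A rho) n h : C :=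
  \sum_i p i h * wsum Phi (D h) n.+1 (fun w => RC (increment f w)) i.
pose S (f : holder A rho) n h : C :=
  \sum_i p i h * RC (f (extend [::])) + \sum_(k < n) T f k h.
(* B Mp bounds the sum of the entries of [p]; the term 1 is for the initial value, and 2 / rho times
   [q] for the increments, whose words have one letter more than their index. *)
pose K1 := B%:R * Mp * (1 + 2 / rho%:num * q).
have rq0 : 0 <= 2 / rho%:num * q by rewrite mulr_ge0// divr_ge0.
have K10 : 0 <= K1 by rewrite !mulr_ge0// addr_ge0.
have S0M f : majorized r (S f 0%N) (K1 * `|f|).
  have := majorized_sum (index_enum _) r0' (fun i (_ : xpredT i) =>
    majorizedM r0' (pM i) (majorized_cst (RC (f (extend [::]))) r0')).
  rewrite sumr_const card_ord -[_ *+ B]mulr_natl => H.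
  apply: majorized_le (majorized_ext _ H) _ => [h _|].
    by rewrite /S big_ord0 addr0.
  rewrite cn_real mulrA ler_pM ?mulr_ge0 ?holder_sup_le//.
  by rewrite /K1 ler_peMr ?mulr_ge0// lerDl.
have TM f n : majorized r (T f n) (K1 * `|f| * lam ^+ n).
  have wM i : majorized r
      (fun h => wsum Phi (D h) n.+1 (fun w => RC (increment f w)) i)
      (2 / rho%:num * `|f| * rho%:num ^+ n * q ^+ n.+1).
    apply: wsum_majorized DN Nq _ => // w wn.
    by rewrite cn_real; exact: increment_le.
  have := majorized_sum (index_enum _) r0' (fun i (_ : xpredT i) =>
    majorizedM r0' (pM i) (wM i)).
  rewrite sumr_const card_ord -[_ *+ B]mulr_natl => H.
  apply: majorized_le H _.
  rewrite /K1 /lam exprMn (exprS q).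
  set x := rho%:num ^+ n; set y := q ^+ n.
  have xy : 0 <= B%:R * Mp * `|f| * (x * y) by rewrite !mulr_ge0 ?exprn_ge0.
  rewrite -subr_ge0 (_ : _ - _ = B%:R * Mp * `|f| * (x * y))//.
  by ring.
have G_ex f : exists F, majorized r F (K1 * `|f| + K1 * `|f| / (1 - lam)) /\
    forall h n, polydisc r h ->
      cn (F h - S f n h) <= K1 * `|f| / (1 - lam) * lam ^+ n.
  have [|F FM FP] := majorized_telescope r0' lam0 lam1 (S0M f); last by exists F.
  move=> n; apply: majorized_ext (TM f n) => h _.
  have -> : S f n.+1 h = S f n h + T f n h by rewrite /S big_ord_recr/= addrA.
  by rewrite addrAC subrr add0r.
have [G GP] := choice G_ex.
have lamn (K : R) : K * lam ^+ n @[n --> \oo] --> (0 : R).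
  rewrite -[X in _ --> X](mulr0 K); apply: cvgM; first exact: cvg_cst.
  by apply: cvg_expr; rewrite ger0_norm.
have Gc f h : polydisc r h -> clim (fun n => S f n h) (G f h).
  move=> hr.
  apply: (@clim_squeeze _ _ _ (fun n => K1 * `|f| / (1 - lam) * lam ^+ n)) => // n.
  by rewrite cnB; exact: (proj2 (GP f)).
have K0 : 0 <= K1 + K1 / (1 - lam).
  by rewrite addr_ge0// divr_ge0// subr_ge0 ltW.
exists r, (K1 + K1 / (1 - lam)), G; split.
  by split=> // f; exists (K1 * `|f| + K1 * `|f| / (1 - lam)); exact: (proj1 (GP f)).
split=> [f h hr|a f g h hr|e f sD er].
- apply: le_trans (majorized_bound r0' (proj1 (GP f)) hr) _.
  by rewrite le_eqVlt; apply/orP; left; apply/eqP; ring.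
- apply: clim_unique (Gc _ h hr) _.
  have := climD (climZ (RC a) (Gc f h hr)) (Gc g h hr).
  congr (clim _ _); apply/funext => n; rewrite /S mulrDr addrACA; congr (_ + _).
    rewrite mulr_sumr -big_split/=; apply: eq_bigr => i _.
    by rewrite rmorphD rmorphM/=; ring.
  rewrite mulr_sumr -big_split/=; apply: eq_bigr => k _.
  rewrite /T mulr_sumr -big_split/=; apply: eq_bigr => i _.
  rewrite mulrCA -mulrDr; congr (_ * _).
  rewrite -[\sum_j _ * _]/(wsum Phi (D h) k.+1 (fun w => RC (increment f w)) i).
  rewrite -[X in _ + X]/(wsum Phi (D h) k.+1 (fun w => RC (increment g w)) i).
  rewrite -wsumZ -wsumD.
  rewrite -[RHS]/(wsum Phi (D h) k.+1 (fun w => RC (increment (a *: f + g) w)) i).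
  apply: eq_wsum => w _; rewrite -rmorphM -rmorphD; congr (RC _).
  have ev x : (a *: f + g) x = a * f x + g x by [].
  by rewrite /increment !ev; ring.
- have [p0 p1 pD] := stationary sD.
  have SE n : S f n (toC (e - eps0)) = RC (\sum_i stat e 0 i *
      wsum Phi (Delta e) n (fun w => f (extend w)) i).
    rewrite -(increment_telescope _ _ _ pD) rmorphD /S !rmorph_sum; congr (_ + _).
      by apply: eq_bigr => i _; rewrite pE// rmorphM.
    apply: eq_bigr => k _; rewrite rmorph_sum; apply: eq_bigr => i _.
    by rewrite pE// DE// wsum_toC rmorphM.
  (* The shift by 1 matches words of length n + 1 with agreement up to index [n]. *)
  apply: clim_unique (clim_shift 1 (Gc f _ er)) _.
  apply: (@clim_squeeze _ _ _ (fun n => `|f| * rho%:num ^+ n)) => [n|].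
    rewrite addn1 SE -rmorphB cn_real distrC.
    exact: (integral_approximation pD (nu_cylinder sD)).
  rewrite -[X in _ --> X](mulr0 `|f|); apply: cvgM; first exact: cvg_cst.
  by apply: cvg_expr; rewrite ger0_norm.
Qed.

Lemma dual_intro (V : normedModType R) (phi : V -> R) (M : R) :
  (forall a u v, phi (a *: u + v) = a * phi u + phi v) ->
  (forall v, `|phi v| <= M * `|v|) -> exists d : dual_space V, forall v, d v = phi v.
Proof.
move=> lin bnd; have H : phi \in @dual_pred R V by rewrite inE; split=> //; exists M.
by exists (Dual H).
Qed.

Lemma expansionZ r a (c : ('I_m -> nat) -> C) f M : 0 <= r -> expansion r c f M ->
  expansion r (fun b => a * c b) (fun h => a * f h) (cn a * M).
Proof.
move=> r0 [cM cf]; split=> [n|h hr].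
  rewrite (eq_bigr (fun b : {ffun 'I_m -> nat} => cn a * (cn (c b) * r ^+ deg b))).
    by rewrite -mulr_sumr ler_wpM2l ?cn_ge0.
  by move=> b _; rewrite cnM mulrA.
have := climZ a (cf h hr); congr (clim _ _); apply/funext => n.
by rewrite mulr_sumr; apply: eq_bigr => b _; rewrite mulrA.
Qed.

Lemma nu_analytic : exists2 nuF : 'rV[R]_m -> dual_space (holder A rho),
  analytic_at nuF eps0 &
  \forall e \near eps0, stochastic (Delta e) ->
    forall f : holder A rho, nuF e f = \int[nu e]_z f z.
Proof.
have [r [K [G [[r0 K0 GM] [GK Glin GE]]]]] := nu_family; have r0' := ltW r0.
have c_ex f : exists c, exists M, expansion r c (G f) M.
  by have [Mf H] := GM f; have [c cH] := majorized_expansion r0 H; exists c, Mf.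
have [c cP] := choice c_ex.
have Re_lin a (x y : C) : complex.Re (RC a * x + y) = a * complex.Re x + complex.Re y.
  by rewrite mulrC; case: x y => x1 x2 [y1 y2] /=; ring.
(* The coefficients were chosen separately for each [f]. Linearity is recovered from uniqueness:
   Cauchy's estimate with bound 0, applied to the expansion of the zero function. *)
have c_lin a f g b : c (a *: f + g) b = RC a * c f b + c g b.
  have [M1 H1] := cP (a *: f + g); have [M2 H2] := cP f; have [M3 H3] := cP g.
  have H := expansionB (expansionB H1 (expansionZ (RC a) r0' H2) r0') H3 r0'.
  have x0 : cn (c (a *: f + g) b - RC a * c f b - c g b) * r ^+ deg b <= 0.
    apply: (cauchy_estimate b r0 H) => h hr.
    by rewrite Glin// addrAC addrK subrr cn0.
  apply/eqP; rewrite -subr_eq0 opprD addrA -cn_eq0; apply/eqP/le_anti.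
  by rewrite cn_ge0 andbT -(pmulr_lle0 _ (exprn_gt0 (deg b) r0)).
have cV_ex b : exists d : dual_space (holder A rho), forall f, d f = complex.Re (c f b).
  apply: (@dual_intro _ _ (K / r ^+ deg b)) => [a f g|f]; first by rewrite c_lin Re_lin.
  apply: le_trans (cn_Re _) _; rewrite mulrAC ler_pdivlMr ?exprn_gt0//.
  have [Mf H] := cP f; exact: (cauchy_estimate b r0 H (GK f)).
have [cV cVE] := choice cV_ex.
have F_ex e : exists d : dual_space (holder A rho), polydisc r (toC (e - eps0)) ->
    forall f, d f = complex.Re (G f (toC (e - eps0))).
  have [er|ner] := pselect (polydisc r (toC (e - eps0))); last by exists 0.
  have [a f g|f|d dE] := @dual_intro _
    (fun f : holder A rho => complex.Re (G f (toC (e - eps0)))) K.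
  - by rewrite Glin// Re_lin.
  - by apply: le_trans (cn_Re _) _; exact: GK.
  - by exists d.
have [F FE] := choice F_ex.
have dualP (d : dual_space (holder A rho)) : bounded_functional d.
  by have := valP d; rewrite inE.
exists F.
  apply: (@analytic_from_family _ _ _ (holder A rho)
    (fun (f : holder A rho) (d : dual_space (holder A rho)) => d f)
    (fun f : holder A rho => `|f|) G c cV F eps0 r K) => //.
  - by move=> f d; exact: le_dual_norm.
  - move=> d M' M0 dM; apply: dual_norm_le => f f1; apply: le_trans (dM f) _.
    by rewrite ler_piMr.
  - by move=> f e er; rewrite FE.
apply/real_near; exists r => // e er sD f.
by rewrite FE// GE.
Qed.

End stationary_measure.

Theorem theorem8p1 (R : realType) (A B m : nat) (Phi : 'I_B -> 'I_A.+1)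
    (Delta : 'rV[R]_m -> 'M[R]_B) (eps0 : 'rV[R]_m)
    (stat : 'rV[R]_m -> 'rV[R]_B)
    (nu : 'rV[R]_m -> probability (borel (left_seq R A)) R)
    (rho : {posnum R})
    (Delta_analytic : forall i j, analytic_at (fun e => Delta e i j : R^o) eps0)
    (Delta_row_sums : \forall e \near eps0, forall i, \sum_j Delta e i j = 1)
    (Delta_stochastic : stochastic (Delta eps0))
    (stat_stationary : forall e, stochastic (Delta e) ->
       stationary_distribution (Delta e) (stat e))
    (nu_cylinder : forall e, stochastic (Delta e) ->
       forall (n : nat) (z : left_seq R A),
         nu e (cylinder n z) = (word_prob (Delta e) (stat e) Phi n z)%:E)
    (Delta_positive_column : forall a : 'I_A.+1,
       exists2 j, Phi j = a & forall i, 0 < Delta eps0 i j)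
    (Delta_columns : forall j,
       (forall i, Delta eps0 i j = 0) \/ (forall i, 0 < Delta eps0 i j))
    (rho_contraction : contraction_constant Phi Delta eps0 rho%:num) :
  (exists2 logp : 'rV[R]_m -> holder A rho,
     analytic_at logp eps0 &
     \forall e \near eps0, stochastic (Delta e) ->
       forall z, logp e z = ln (cond_prob_limit (Delta e) (stat e) Phi z)) /\
  (exists2 nuF : 'rV[R]_m -> dual_space (holder A rho),
     analytic_at nuF eps0 &
     \forall e \near eps0, stochastic (Delta e) ->
       forall f : holder A rho, nuF e f = \int[nu e]_z f z).
Proof.
split.
- exact: (log_cond_prob_analytic Delta_stochastic stat_stationary
    Delta_positive_column Delta_columns rho_contraction).
- exact: (nu_analytic Delta_stochastic stat_stationary nu_cylinder
    Delta_positive_column rho_contraction).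
Qed.
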